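(* Let $b,\sigma:\mathbb{R}\to\mathbb{R}$ be Lipschitz continuous, let $X_0$ be a square integrable real random variable, and let $h:\mathbb{R}\to\mathbb{R}$ be an increasing function, twice continuously differentiable with bounded derivatives, for which there are constants $0<m\le M$ with $m|x-y|\le|h(x)-h(y)|\le M|x-y|$ for all $x,y\in\mathbb{R}$. Assume $\mathbb{E}[h(X_0)]\ge0$. Let $(X,K)$ denote the unique flat deterministic solution of the mean reflected SDE $$X_t=X_0+\int_0^t b(X_s)\,ds+\int_0^t\sigma(X_s)\,dB_s+K_t,\quad \mathbb{E}[h(X_t)]\ge0,\quad \int_0^t\mathbb{E}[h(X_s)]\,dK_s=0,\qquad t\ge0.$$ Then the Stieltjes measure $dK$ is absolutely continuous with respect to the Lebesgue measure on $\mathbb{R}^+$, with density $$k_t=\frac{\big(\mathbb{E}[\mathcal{L}h(X_t)]\big)^-}{\mathbb{E}[h'(X_t)]}\,\mathbf{1}_{\{\mathbb{E}[h(X_t)]=0\}},\qquad t\in\mathbb{R}^+ .$$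
   Context: $(B_t)_{t\ge0}$ is a standard Brownian motion on a complete probability space, independent of $X_0$. A flat deterministic solution is a pair of continuous processes $(X,K)$ satisfying the displayed system with $K$ a non-decreasing deterministic function and $K_0=0$; under the stated hypotheses it exists and is unique. $\mathcal{L}$ is the second order operator $\mathcal{L}f(x)=b(x)f'(x)+\frac12\sigma(x)^2f''(x)$ for twice continuously differentiable $f$. For a real number $a$, $a^-=\max(-a,0)$. *)

(* Defs.v *)
From HB Require Import structures.
From mathcomp Require Import all_boot all_order all_algebra.
From mathcomp Require Import all_classical all_reals all_analysis.

Set Implicit Arguments.
Unset Strict Implicit.
Unset Printing Implicit Defensive.

Import Order.TTheory GRing.Theory Num.Theory.
Import numFieldNormedType.Exports.

Local Open Scope classical_set_scope.
Local Open Scope ring_scope.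

(* Time ranges over the nonnegative elements of R; the values of a process at
   negative times are never used. *)

Section defs.
Context {d : measure_display} {T : measurableType d} {R : realType}.
Implicit Types (P : probability T R) (F : R -> set_system T)
  (X H I : R -> T -> R).

Definition sigma_of (Y : T -> R) : set_system T :=
  preimage_set_system setT Y measurable.

Definition independent_systems P (G G' : set_system T) :=
  forall A A', G A -> G' A' -> P (A `&` A') = (P A * P A')%E.

Definition natural_filtration X : R -> set_system T :=
  fun t => <<s \bigcup_(s in `[0, t]) sigma_of (X s) >>.

Definition sigma_path X : set_system T :=
  <<s \bigcup_(s in `[0, +oo[) sigma_of (X s) >>.

Definition adapted F X :=
  forall t : R, 0 <= t -> sigma_of (X t) `<=` F t.

Definition continuous_process P X :=
  {ae P, forall w, {within `[0, +oo[, continuous (X ^~ w)}}.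

Record brownian_motion P (B : R -> {RV P >-> R}) : Prop := {
  bm_start : {ae P, forall w, B 0 w = 0} ;
  bm_indep_incr : forall s t : R, 0 <= s -> s <= t ->
    independent_systems P (natural_filtration (fun u => B u) s)
                          (sigma_of (B t \- B s)) ;
  (* The second argument of normal_prob is the standard deviation. *)
  bm_gauss_incr : forall s t : R, 0 <= s -> s < t ->
    forall A, measurable A ->
      P ((B t \- B s) @^-1` A) = normal_prob 0 (Num.sqrt (t - s)) A ;
  bm_continuous : continuous_process P (fun u => B u) }.

Definition augmented_filtration P (X0 : T -> R) (B : R -> T -> R) :
    R -> set_system T :=
  fun t => <<s sigma_of X0 `|` \bigcup_(s in `[0, t]) sigma_of (B s)
               `|` P.-negligible >>.

(* \sum_(i < n) xi_i 1_{]t_i, t_(i+1)]}, with xi_i bounded and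
   F_(t_i)-measurable. *)
Record simple_process F := SimpleProcess {
  sp_size : nat ;
  sp_time : nat -> R ;
  sp_val : nat -> T -> R ;
  sp_time_ge0 : forall i, (0 : R) <= sp_time i ;
  sp_time_nd : {homo sp_time : i j / (i <= j)%N >-> i <= j} ;
  sp_val_bounded : forall i, exists C : R, forall w, `|sp_val i w| <= C ;
  sp_val_meas : forall i, sigma_of (sp_val i) `<=` F (sp_time i) }.

Definition sp_fun F (phi : simple_process F) (t : R) (w : T) : R :=
  \sum_(i < sp_size phi)
    sp_val phi i w * \1_(`]sp_time phi i, sp_time phi i.+1]) t.

Definition sp_integral F (phi : simple_process F) (B : R -> T -> R)
    (t : R) (w : T) : R :=
  \sum_(i < sp_size phi)
    sp_val phi i w * (B (Num.min (sp_time phi i.+1) t) w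
                      - B (Num.min (sp_time phi i) t) w).

Definition cvg0_in_probability P (Y : nat -> T -> \bar R) :=
  forall e : R, 0 < e -> P [set w | (e%:E <= Y n w)%E] @[n --> \oo] --> 0%E.

(* I is (a continuous version of) the Ito integral process of H against B:
   H is approximated by simple processes phi_n with \int_0^t |phi_n - H|^2 ds
   -> 0 in probability, and I_t is the limit in probability of the elementary
   integrals of the phi_n. No moment is required of H. *)
Definition is_ito_integral P F (B : R -> T -> R) H I :=
  [/\ adapted F I, continuous_process P I &
    exists phi : nat -> simple_process F, forall t : R, 0 <= t ->
      cvg0_in_probability P (fun n w =>
        \int[lebesgue_measure]_(s in `[0%R, t])
          ((sp_fun (phi n) s w - H s w) ^+ 2)%:E)%E /\
      cvg0_in_probability P (fun n w =>
        `|sp_integral (phi n) B t w - I t w|%:E) ].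

(* K is a function of t >= 0 extended by 0 to negative times, so that its
   Lebesgue-Stieltjes measure is carried by [0, +oo[. Being of class cumulative,
   K is nondecreasing. The integrability of h (X t) is not required: with
   X 0 square integrable and h Lipschitz, it follows from the equation because
   K is deterministic. *)
Record flat_deterministic_solution P (b sigma h : R -> R) (X0 : T -> R)
    (B : R -> T -> R) X (K : cumulative R R) : Prop := {
  sol_adapted : adapted (augmented_filtration P X0 B) X ;
  sol_continuous : continuous_process P X ;
  sol_K_continuous : continuous K ;
  sol_K_start : forall t : R, t <= 0 -> K t = 0 ;
  sol_equation : exists I : R -> T -> R,
    is_ito_integral P (augmented_filtration P X0 B) B
      (fun s w => sigma (X s w)) I /\
    {ae P, forall w, forall t : R, 0 <= t ->
      X t w = X0 w + \int[lebesgue_measure]_(s in `[0, t]) b (X s w)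
              + I t w + K t} ;
  sol_constraint : forall t : R, 0 <= t -> (0 <= 'E_P[h \o X t])%E ;
  sol_flat : forall t : R, 0 <= t ->
    (\int[lebesgue_stieltjes_measure K]_(s in `[0%R, t]) 'E_P[h \o X s] = 0)%E }.

End defs.

Section generator.
Context {R : realType}.

Definition generator (b sigma f : R -> R) (x : R) : R :=
  b x * derive1 f x + 2^-1 * sigma x ^+ 2 * derive1n 2 f x.

Definition twice_continuously_differentiable (f : R -> R) :=
  [/\ forall x : R, derivable f x 1, forall x : R, derivable (derive1 f) x 1 &
      continuous (derive1n 2 f)].

Definition negpart (a : R) : R := Num.max (- a) 0.

End generator.

Definition reflection_density {d : measure_display} {T : measurableType d}
    {R : realType} (P : probability T R) (b sigma h : R -> R)
    (X : R -> T -> R) (t : R) : R :=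
  negpart (fine ('E_P[generator b sigma h \o X t])%E)
    / fine ('E_P[derive1 h \o X t])%E
    * ('E_P[h \o X t] == 0)%E%:R.

(* Main.v *)
(* Write Delta for t - s, phi t = E[h (X t)], g t = E[h' (X t)] and
   a t = E[L h (X t)]. A second order Taylor expansion of h along the solution
   gives, for every s >= 0 and as t decreases to s,
     phi t - phi s = a s * Delta + g s * (K t - K s) + o(Delta + K t - K s).
   Together with phi >= 0, g >= m > 0, the continuity of phi, a, g and the fact
   that K is locally constant where phi > 0, this determines K: the increments
   of chi_n = phi / (1 + n phi) are those of
   a (1 + n phi)^-2 du + g dK, and n -> oo shows that dK = - (a / g) 1_{phi = 0} du,
   whence dK = (a^- / g) 1_{phi = 0} du since dK >= 0.

   The expansion needs the Ito isometry for the integral defined by limits in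
   probability. It comes from simple processes switched off once their energy
   exceeds a level N, for which the isometry is algebraic, and from Fatou's
   lemma. Localising by the event that int_0^t (1 + X_u^2) du is at most N, and
   not by a stopping time, turns it into a Gronwall inequality for
   E[min (int_0^t (1 + X_u^2) du, N)], so X has locally bounded second moments.
   The martingale part of X t - X s is then compared with sigma (X s) (B t - B s)
   in L^2, and the fourth Gaussian moment controls the Taylor remainder. *)

Require Import Defs.
From HB Require Import structures.
From mathcomp Require Import all_boot all_order all_algebra.
From mathcomp Require Import all_classical all_reals all_analysis.
From mathcomp Require Import measurable_realfun ring lra.

Set Implicit Arguments.
Unset Strict Implicit.
Unset Printing Implicit Defensive.

Import Order.TTheory GRing.Theory Num.Theory.
Import numFieldNormedType.Exports.
Local Open Scope classical_set_scope.
Local Open Scope ring_scope.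

(** * Integrals over time intervals *)

(** The obstacle is that [K] is only known to be continuous and nondecreasing, so its increments
    cannot be compared with those of time in advance. Errors are therefore measured against
    [t - s + (K t - K s)], and a continuous function whose right increments are negligible with
    respect to that quantity is constant; this replaces any differentiation of [K] and any Stieltjes
    calculus. The identity behind the density is that a continuous function [phi >= 0] of bounded
    variation does not vary on the set where it vanishes. The other constraint is the lack of
    moments: the stochastic integral has none by definition and [X] is shown to have two, so
    [sigma (X s)] is cut at a level [L] before a fourth moment of [B] is used. As [h''] has no
    modulus of continuity, the Taylor remainder is only known to vanish, by dominated convergence,
    without a rate. This dictates the order in which the parameters are chosen: a weight in an
    arithmetic-geometric inequality, then [L], then a second weight, and the time step last. *)

Section real_integrable.
Context d (T : measurableType d) (R : realType).
Variables (mu : {measure set T -> \bar R}) (D : set T) (mD : measurable D).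
Implicit Types f g : T -> R.
Local Notation intg f := (mu.-integrable D (EFin \o f)).

Lemma rintegrableD f g : intg f -> intg g -> intg (fun x => f x + g x).
Proof.
move=> fi gi; rewrite (_ : _ \o _ = (EFin \o f) \+ (EFin \o g))%E//.
exact: integrableD.
Qed.

Lemma rintegrableB f g : intg f -> intg g -> intg (fun x => f x - g x).
Proof.
move=> fi gi; rewrite (_ : _ \o _ = (EFin \o f) \- (EFin \o g))%E//.
exact: integrableB.
Qed.

Lemma rintegrableZl c f : intg f -> intg (fun x => c * f x).
Proof. by move=> fi; exact: (integrableZl mD c fi). Qed.

Lemma rintegrable_le f g : measurable_fun D f ->
  (forall x, D x -> `|f x| <= g x) -> intg g -> intg f.
Proof.
move=> mf fg; apply: le_integrable => //; first exact/measurable_EFinP.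
move=> x Dx /=; rewrite lee_fin (le_trans (fg x Dx))//; exact: ler_norm.
Qed.

Lemma rintegrable_measurable f : intg f -> measurable_fun D f.
Proof. by move=> /(measurable_int mu)/measurable_EFinP. Qed.

Lemma Rintegral_dct (f_ : nat -> T -> R) (f g : T -> R) :
  (forall n, measurable_fun D (f_ n)) -> measurable_fun D f -> intg g ->
  (forall n x, D x -> `|f_ n x| <= g x) ->
  {ae mu, forall x, D x -> f_ n x @[n --> \oo] --> f x} ->
  intg f /\ \int[mu]_(x in D) f_ n x @[n --> \oo] --> \int[mu]_(x in D) f x.
Proof.
move=> mf_ mf gi fg cf.
have h1 n : measurable_fun D (EFin \o f_ n) by exact/measurable_EFinP.
have h2 : measurable_fun D (EFin \o f) by exact/measurable_EFinP.
have h3 : {ae mu, forall x, D x -> (EFin \o f_ n) x @[n --> \oo] --> (EFin \o f) x}.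
  by apply: filterS cf => x cx Dx; apply/cvg_EFin; [exact: nearW|exact: cx].
have h4 : {ae mu, forall x n, D x -> `|(EFin \o f_ n) x| <= (EFin \o g) x}%E.
  by apply: aeW => x n Dx; rewrite /= lee_fin; exact: fg.
have [fi _ cvg] := dominated_convergence mD h1 h2 h3 gi h4.
split => //; rewrite /Rintegral.
have E : (\int[mu]_(x in D) (f x)%:E = (fine (\int[mu]_(x in D) (f x)%:E))%:E)%E.
  by rewrite fineK//; exact: integrable_fin_num.
by move: cvg; rewrite /= {}E => /fine_cvgP[_].
Qed.

End real_integrable.

Section time_integral.
Context {R : realType}.
Notation leb := (@lebesgue_measure R).
Implicit Types (f g : R -> R) (s t r c e : R).

(** The interval is empty when [t < s]: the value is then 0, not minus the integral over [t, s]. *)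
Definition tint f s t : R := \int[leb]_(u in `[s, t]) f u.

Lemma itv_integrable f s t C : measurable_fun `[s, t] f ->
  (forall u, s <= u <= t -> `|f u| <= C) ->
  leb.-integrable `[s, t] (EFin \o f).
Proof.
move=> mf fC; apply: measurable_bounded_integrable => //.
  by rewrite /= lebesgue_measure_itv/=; case: ifP => // _; rewrite -EFinB ltry.
exists C; split; first exact: num_real.
move=> x Cx u /=; rewrite in_itv/= => su; exact: le_trans (fC _ su) (ltW Cx).
Qed.

Lemma tint_cst c s t : s <= t -> tint (fun=> c) s t = c * (t - s).
Proof.
move=> st; rewrite /tint Rintegral_cst//; congr (_ * _).
rewrite /= lebesgue_measure_itv/= lte_fin.
by case: ltP => [//|ts]; rewrite (@le_anti _ _ s t) ?st ?ts// subrr.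
Qed.

Lemma tint_split f s r t : s <= r -> r <= t ->
  leb.-integrable `[s, t] (EFin \o f) -> tint f s t = tint f s r + tint f r t.
Proof.
move=> sr rt fi; rewrite /tint.
have := @Rintegral_itvB R f (BLeft s) (BRight t) r fi.
rewrite !bnd_simp => /(_ sr rt) E.
rewrite Rintegral_itv_obnd_cbnd in E; first by rewrite -E; ring.
apply: integrableS fi => //; apply: subset_itvr; rewrite bnd_simp.
exact: sr.
Qed.

Lemma tint_diff_le f s t c e : s <= t -> measurable_fun `[s, t] f ->
  (forall u, s <= u <= t -> `|f u - c| <= e) ->
  `|tint f s t - c * (t - s)| <= e * (t - s).
Proof.
move=> st mf fe.
have fi : leb.-integrable `[s, t] (EFin \o f).
  apply: (@itv_integrable _ _ _ (`|c| + e)) => // u su.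
  by have := ler_normD c (f u - c); rewrite addrC subrK; have := fe u su; lra.
have ci : leb.-integrable `[s, t] (EFin \o (fun=> c)).
  by apply: (@itv_integrable _ _ _ `|c|).
have ei : leb.-integrable `[s, t] (EFin \o (fun=> e)).
  by apply: (@itv_integrable _ _ _ `|e|).
have di : leb.-integrable `[s, t] (EFin \o (fun u => f u - c)).
  exact: rintegrableB.
rewrite -(tint_cst c st) /tint -RintegralB//.
apply: (le_trans (le_normr_Rintegral _ _)) => //.
apply: le_trans (le_Rintegral _ _ ei _) _ => //.
  exact: integrable_norm di.
have := tint_cst e st; rewrite /tint => ->; exact: lexx.
Qed.

Lemma le_tint f g s t : leb.-integrable `[s, t] (EFin \o f) ->
  leb.-integrable `[s, t] (EFin \o g) ->
  (forall u, s <= u <= t -> f u <= g u) -> tint f s t <= tint g s t.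
Proof.
by move=> fi gi fg; apply: le_Rintegral => // u /=; rewrite in_itv/=; exact: fg.
Qed.

Lemma tintB f g s t : leb.-integrable `[s, t] (EFin \o f) ->
  leb.-integrable `[s, t] (EFin \o g) ->
  tint (fun u => f u - g u) s t = tint f s t - tint g s t.
Proof. by move=> fi gi; exact: RintegralB. Qed.

Lemma continuous_lim_eps f s e : {for s, continuous f} -> 0 < e ->
  exists2 d, 0 < d & forall t, `|t - s| < d -> `|f t - f s| < e.
Proof.
move=> fs e0; have /cvgrPdist_lt/(_ e e0) := fs.
move=> [d /= d0 Hd]; exists d => // t td.
by rewrite distrC; apply: Hd => /=; rewrite distrC.
Qed.

(* The supremum of the times up to which the estimate holds is the endpoint. *)
Lemma real_induction_le (F v : R -> R) s T e :
  (forall r z, s < r <= T -> 0 < z -> exists2 d, 0 < d &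
     forall t, s <= t <= r -> r - d < t -> `|F r - F t| < z) ->
  {homo v : x y / x <= y} -> 0 <= e -> s <= T ->
  (forall u, s <= u < T -> exists2 d, 0 < d & forall t, u < t <= T -> t < u + d ->
     `|F t - F u| <= e * (v t - v u)) ->
  `|F T - F s| <= e * (v T - v s).
Proof.
move=> Fc vnd e0 sT loc.
pose S := [set t | s <= t <= T /\ `|F t - F s| <= e * (v t - v s)].
have Ss : S s by split; rewrite ?lexx//= !subrr normr0 mulr0.
have hS : has_sup S.
  by split; [exists s|exists T => t [/andP[]]].
set r := sup S.
have sr : s <= r by apply: ub_le_sup => //; case: hS.
have rT : r <= T by apply: sup_le_ub; [exists s|move=> t [/andP[]]].
(* The supremum belongs to [S]: [F] is left continuous there, and monotonicity of [v] suffices to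
   pass from [v t] to [v r]. *)
have Sr : S r.
  split; first by rewrite sr.
  apply/ler_addgt0Pr => z z0.
  move: sr; rewrite le_eqVlt => /predU1P[<-|sr].
    by rewrite !subrr normr0 mulr0 add0r ltW.
  have /Fc/(_ z0)[d d0 Hd] : s < r <= T by rewrite sr.
  have [t St rt] := sup_adherent d0 hS.
  have tr : t <= r by apply: ub_le_sup => //; case: hS.
  have [/andP[st _] H] := St.
  have {}Hd : `|F r - F t| < z by apply: Hd => //; rewrite st.
  have : e * (v t - v s) <= e * (v r - v s).
    by apply: ler_wpM2l => //; apply: lerB => //; exact: vnd.
  have := ler_normD (F r - F t) (F t - F s).
  rewrite (_ : F r - F t + (F t - F s) = F r - F s); last by ring.
  lra.
suff -> : T = r by case: Sr.
apply/eqP; rewrite eq_le rT andbT leNgt; apply/negP => rltT.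
have /loc[d d0 Hd] : s <= r < T by rewrite sr.
pose t := Num.min T (r + d / 2).
have rt : r < t by rewrite lt_min rltT/=; lra.
have tT : t <= T by rewrite ge_min lexx.
have td : t < r + d by rewrite gt_min; apply/orP; right; lra.
have St : S t.
  split; first by rewrite (le_trans sr (ltW rt)).
  have [_ H] := Sr.
  have H' := Hd t; rewrite rt tT td in H'; have {H'} := H' isT isT.
  have := ler_normD (F t - F r) (F r - F s).
  rewrite (_ : F t - F r + (F r - F s) = F t - F s); last by ring.
  by rewrite !mulrBr in H *; lra.
have : t <= r by apply: ub_le_sup => //; case: hS.
by rewrite leNgt rt.
Qed.

End time_integral.

(** * The density of K *)

Section continuously_dominated.
Context {R : realType}.
Notation leb := (@lebesgue_measure R).
Variables (f b : R -> R).
Hypotheses (mf : measurable_fun setT f) (bc : continuous b).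
Hypothesis fb : forall u, `|f u| <= b u.

Lemma dominated_itv_integrable s t : leb.-integrable `[s, t] (EFin \o f).
Proof.
apply: (@rintegrable_le _ _ _ leb `[s, t] _ f b) => //.
  exact: measurable_funTS.
apply: continuous_compact_integrable; first exact: segment_compact.
exact/continuous_subspaceT/bc.
Qed.

(** Near [r] the integrand is at most [b r + 1]. The continuous majorant [b] stands in for
    continuity of [f], which fails for rates carrying the indicator of contact. *)
Lemma tint_left_continuous s r z : 0 < z -> exists2 d, 0 < d &
  forall t, s <= t <= r -> r - d < t -> `|tint f s r - tint f s t| < z.
Proof.
move=> z0.
have [d1 d10 H1] := continuous_lim_eps (@bc r) (@ltr01 R).
pose C := b r + 1.
have C0 : 0 < C by rewrite ltr_wpDl// (le_trans _ (fb r)).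
exists (Num.min d1 (z / C)); first by rewrite lt_min d10 divr_gt0.
move=> t /andP[st tr]; rewrite ltrBlDr -ltrBlDl lt_min => /andP[t1 t2].
rewrite (@tint_split _ _ s t r)//; last exact: dominated_itv_integrable.
rewrite addrC addKr.
have := @tint_diff_le _ f t r 0 C tr; rewrite mul0r subr0 => H.
apply: (@le_lt_trans _ _ (C * (r - t))); last by rewrite mulrC -ltr_pdivlMr.
apply: H; first exact: measurable_funTS.
move=> u /andP[tu ur]; rewrite subr0 (le_trans (fb u))// /C -lerBlDl.
apply: (le_trans (ler_norm _)); apply/ltW/H1.
by rewrite ler0_norm ?subr_le0//; lra.
Qed.

End continuously_dominated.

Section contact_density.
Context {R : realType}.
Notation leb := (@lebesgue_measure R).
Variables (K phi a g : R -> R) (m : R).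
Hypotheses (Knd : {homo K : x y / x <= y}) (Kc : continuous K).
Hypotheses (phic : continuous phi) (ac : continuous a) (gc : continuous g).
Hypotheses (m0 : 0 < m) (gm : forall t, m <= g t) (phi0 : forall t, 0 <= phi t).
Hypothesis flat : forall s, 0 <= s -> 0 < phi s ->
  exists2 d, 0 < d & forall t, s < t < s + d -> K t = K s.
Hypothesis expansion : forall s e, 0 <= s -> 0 < e ->
  exists2 d, 0 < d & forall t, s < t < s + d ->
    `|phi t - phi s - a s * (t - s) - g s * (K t - K s)|
    <= e * (t - s + (K t - K s)).

(** The common gauge for all errors: absolute continuity of [K] is the goal, so [K t - K s] cannot
    be bounded by a multiple of [t - s]. *)
Let v t := t + K t.
Let vnd : {homo v : x y / x <= y}.
Proof. by move=> x y xy; rewrite lerD// Knd. Qed.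

(* The derivative [(1 + n x)^-2] of [x / (1 + n x)] tends to the indicator of
   [x = 0], while [chi n] tends to 0 uniformly. *)
Let chi n t : R := phi t / (1 + n%:R * phi t).
Let cn n t : R := (1 + n%:R * phi t)^-1.
Let kn n t : R := a t / g t * cn n t ^+ 2.
(** The limit of [kn n]. Its opposite is the density before the sign of [dK] is taken into
    account. *)
Let kc t : R := a t / g t * (phi t == 0)%:R.

Let den_ge1 n t : 1 <= 1 + n%:R * phi t.
Proof. by rewrite lerDl mulr_ge0. Qed.

Let den_neq0 n t : 1 + n%:R * phi t != 0.
Proof. by rewrite gt_eqF// (lt_le_trans ltr01)// den_ge1. Qed.

Let cn_itv n t : 0 < cn n t <= 1.
Proof.
rewrite /cn invr_gt0 (lt_le_trans ltr01) ?den_ge1//=.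
by rewrite invf_le1 ?den_ge1// (lt_le_trans ltr01)// den_ge1.
Qed.

Let g_gt0 t : 0 < g t. Proof. exact: lt_le_trans m0 (gm t). Qed.

Let cnc n : continuous (cn n).
Proof.
move=> t; apply: cvgV; first exact: den_neq0.
by apply: cvgD; [exact: cvg_cst|apply: cvgM; [exact: cvg_cst|exact: phic]].
Qed.

Let knc n : continuous (kn n).
Proof.
move=> t; apply: cvgM; last by apply: cvgM; exact: cnc.
apply: cvgM; first exact: ac.
by apply: cvgV; [rewrite gt_eqF|exact: gc].
Qed.

Let chic n : continuous (chi n).
Proof. by move=> t; apply: cvgM; [exact: phic|exact: cnc]. Qed.

(** The expansion with error 1 makes [phi] Lipschitz with respect to [v] on the right of [s]. In the
    quadratic remainder of [chi n], one factor [phi t - phi s] is bounded in this way and the other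
    one by continuity. *)
Let phi_incr s e : 0 <= s -> 0 < e -> exists2 d, 0 < d &
  forall t, s < t < s + d -> `|phi t - phi s| < e /\
   `|phi t - phi s| <= (`|a s| + `|g s| + 1) * (v t - v s).
Proof.
move=> s0 e0; have [d1 d10 H1] := expansion s0 (@ltr01 R).
have [d2 d20 H2] := continuous_lim_eps (@phic s) e0.
exists (Num.min d1 d2); first by rewrite lt_min d10.
move=> t /andP[st]; rewrite -ltrBlDl lt_min => /andP[t1 t2]; split.
  by apply: H2; rewrite gtr0_norm ?subr_gt0.
have := H1 t; rewrite st -ltrBlDl t1 => /(_ isT).
set r := (X in `|X| <= _) => rle.
have k0 : 0 <= K t - K s by rewrite subr_ge0 Knd// ltW.
have -> : phi t - phi s = r + a s * (t - s) + g s * (K t - K s) by rewrite /r; ring.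
have ts : 0 <= t - s by rewrite subr_ge0 ltW.
apply: (le_trans (ler_normD _ _)); rewrite normrM (ger0_norm k0).
apply: (@le_trans _ _ (`|r| + `|a s| * (t - s) + `|g s| * (K t - K s))).
  by rewrite lerD2r (le_trans (ler_normD _ _))// lerD2l normrM (ger0_norm ts).
have : 0 <= `|a s| * (K t - K s) by rewrite mulr_ge0.
have : 0 <= `|g s| * (t - s) by rewrite mulr_ge0.
by rewrite /v; lra.
Qed.

Ltac expansion_lra :=
  clear - K phi a g m Knd Kc phic ac gc m0 gm phi0 flat expansion v vnd chi cn
    kn kc den_ge1 den_neq0 cn_itv g_gt0 cnc knc chic phi_incr; lra.

Let chi_expansion n s e : 0 <= s -> 0 < e -> exists2 d, 0 < d &
  forall t, s < t < s + d ->
  `|chi n t - chi n s - g s * (kn n s * (t - s) + (K t - K s))|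
   <= e * (v t - v s).
Proof.
move=> s0 e0; pose C := `|a s| + `|g s| + 1.
have C0 : 0 < C by rewrite /C ltr_wpDl// addr_ge0.
have nC0 : 0 < n%:R * C + 1 by rewrite ltr_wpDl// mulr_ge0// ltW.
have e20 : 0 < e / 2 by rewrite divr_gt0.
have [d1 d10 H1] := expansion s0 e20.
have [d2 d20 H2] := phi_incr s0 (divr_gt0 e20 nC0).
(* The derivative [cn n s ^+ 2] of the composed function disappears in front of the increment of
   [K]: at contact it equals 1, and off contact flatness makes the increment vanish. *)
have [d3 d30 H3] : exists2 d, 0 < d & forall t, s < t < s + d ->
    cn n s ^+ 2 * (K t - K s) = K t - K s.
  have := phi0 s; rewrite le_eqVlt => /predU1P[ps0|/(flat s0)[d d0 Hd]].
    by exists 1 => // t _; rewrite /cn -ps0 mulr0 addr0 invr1 expr1n mul1r.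
  by exists d => // t /Hd->; rewrite subrr mulr0.
exists (Num.min d1 (Num.min d2 d3)); first by rewrite !lt_min d10 d20.
move=> t /andP[st]; rewrite -ltrBlDl !lt_min => /and3P[t1 t2 t3].
have ts : 0 <= t - s by rewrite subr_ge0 ltW.
have k0 : 0 <= K t - K s by rewrite subr_ge0 Knd// ltW.
have V0 : 0 <= v t - v s by rewrite subr_ge0 vnd// ltW.
have := H1 t; rewrite st -ltrBlDl t1 => /(_ isT).
set r := (X in `|X| <= _) => rle.
have := H2 t; rewrite st -ltrBlDl t2 => /(_ isT) [Pe PC].
have := H3 t; rewrite st -ltrBlDl t3 => /(_ isT) ck.
set P := phi t - phi s in Pe PC.
have /andP[cs0 cs1] := cn_itv n s; have /andP[ct0 ct1] := cn_itv n t.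
(* Exact expansion of f(x) = x / (1 + n x): f(y) - f(x) is (y - x) / (1 + n x)^2 minus n (y - x)^2 /
   ((1 + n x)^2 (1 + n y)). *)
have -> : chi n t - chi n s - g s * (kn n s * (t - s) + (K t - K s)) =
   cn n s ^+ 2 * r - n%:R * P ^+ 2 * (cn n s ^+ 2 * cn n t).
  rewrite -{1}ck /chi /kn /cn /r /P; field.
  by rewrite !den_neq0 gt_eqF.
apply: (le_trans (ler_normB _ _)).
have c2 : cn n s ^+ 2 <= 1 by rewrite expr_le1// ltW.
have c20 : 0 <= cn n s ^+ 2 by rewrite sqr_ge0.
have h1 : `|cn n s ^+ 2 * r| <= e / 2 * (v t - v s).
  rewrite normrM (ger0_norm c20) (le_trans (ler_piMl _ c2))//.
  by rewrite (le_trans rle)// /v; expansion_lra.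
have h2 : `|n%:R * P ^+ 2 * (cn n s ^+ 2 * cn n t)| <= e / 2 * (v t - v s).
  rewrite normrM (ger0_norm (mulr_ge0 _ _)) ?sqr_ge0//.
  rewrite [X in _ * X]ger0_norm; last by rewrite mulr_ge0// ltW.
  apply: (@le_trans _ _ (n%:R * P ^+ 2)).
    apply: ler_piMr; first by rewrite mulr_ge0// sqr_ge0.
    by rewrite mulr_ile1// ltW.
  rewrite -real_normK ?num_real// expr2 mulrA.
  apply: (@le_trans _ _ (n%:R * (e / 2 / (n%:R * C + 1)) * (C * (v t - v s)))).
    by apply: ler_pM => //; rewrite ?mulr_ge0// ler_wpM2l// ltW.
  rewrite [leLHS](_ : _ = n%:R * C / (n%:R * C + 1) * (e / 2 * (v t - v s))); last first.
    by field; rewrite gt_eqF.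
  apply: ler_piMl; first by rewrite mulr_ge0// ltW.
  by rewrite ler_pdivrMr// mul1r lerDl.
by apply: le_trans (lerD h1 h2) _; expansion_lra.
Qed.

Let knm n D : measurable_fun D (kn n).
Proof. by apply: measurable_funTS; apply: continuous_measurable_fun; exact: knc. Qed.

Let agc : continuous (fun t => `|a t / g t|).
Proof.
move=> t; apply: cvg_norm; apply: cvgM; first exact: ac.
by apply: cvgV; [rewrite gt_eqF|exact: gc].
Qed.

Let kn_ag n u : `|kn n u| <= `|a u / g u|.
Proof.
have /andP[c0 c1] := cn_itv n u.
by rewrite /kn normrM ler_piMr// ger0_norm ?sqr_ge0// expr_le1// ltW.
Qed.

Let kn_integrable n s t : leb.-integrable `[s, t] (EFin \o kn n).
Proof. exact: dominated_itv_integrable (@knm n _) agc (kn_ag n) s t. Qed.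

Ltac remainder_lra :=
  clear - K phi a g m Knd Kc phic ac gc m0 gm phi0 flat expansion v vnd chi cn
    kn kc den_ge1 den_neq0 cn_itv g_gt0 cnc knc chic phi_incr chi_expansion
    knm agc kn_ag kn_integrable; lra.

(** The radius [d] is chosen before [n], so the estimate survives n -> oo. Dividing by the constant
    [g s0] instead of [g u] avoids an integral against [dK]; the price is |1 / g u - 1 / g s0| times
    the variation of [chi n], and that variation is at most [C * (v x - v u)] with [C] independent
    of [n]. The radii of the local estimates fed to the real induction may depend on [n]. *)
Let cn_estimate s0 e : 0 <= s0 -> 0 < e -> exists2 d, 0 < d &
  forall n t, s0 < t < s0 + d ->
  `|K t - K s0 + tint (kn n) s0 t - (chi n t - chi n s0) / g s0|
   <= e * (v t - v s0).
Proof.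
move=> s00 e0.
(* One unit comes from the constant of [phi_incr], the other two from |a u - a s0| < 1 and |g u - g
   s0| < 1. *)
pose C := `|a s0| + `|g s0| + 3.
have C0 : 0 < C by rewrite /C ltr_wpDl// addr_ge0.
have gic : continuous (fun t => (g t)^-1).
  by move=> t; apply: cvgV; [rewrite gt_eqF|exact: gc].
have e1 : 0 < e / (4 * C) by rewrite divr_gt0// mulr_gt0.
have [d1 d10 H1] := continuous_lim_eps (gic s0) e1.
have [d2 d20 H2] := continuous_lim_eps (@ac s0) (@ltr01 R).
have [d3 d30 H3] := continuous_lim_eps (@gc s0) (@ltr01 R).
exists (Num.min d1 (Num.min d2 d3)); first by rewrite !lt_min d10 d20.
move=> n t /andP[s0t]; rewrite -ltrBlDl !lt_min => /and3P[t1 t2 t3].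
pose F x := K x + tint (kn n) s0 x - chi n x / g s0.
have -> : K t - K s0 + tint (kn n) s0 t - (chi n t - chi n s0) / g s0 = F t - F s0.
  have -> : F s0 = K s0 - chi n s0 / g s0.
    rewrite /F (_ : tint (kn n) s0 s0 = 0) ?addr0//.
    by rewrite /tint set_itv1 Rintegral_set1.
  by rewrite /F; ring.
apply: real_induction_le => //; [|exact: ltW|exact: ltW|].
  move=> r z /andP[s0r rt] z0.
  have z3 : 0 < z / 3 by rewrite divr_gt0.
  have Gc : continuous (fun x => chi n x / g s0).
    by move=> x; apply: cvgM; [exact: chic|exact: cvg_cst].
  have [b1 b10 G1] := continuous_lim_eps (@Kc r) z3.
  have [b2 b20 G2] := continuous_lim_eps (Gc r) z3.
  have [b3 b30 G3] := tint_left_continuous (@knm n _) agc (kn_ag n) s0 r z3.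
  exists (Num.min b1 (Num.min b2 b3)); first by rewrite !lt_min b10 b20.
  move=> x /andP[s0x xr]; rewrite ltrBlDr -ltrBlDl !lt_min => /and3P[x1 x2 x3].
  have xr' : `|x - r| = r - x by rewrite ler0_norm ?subr_le0// opprB.
  have := G1 x; rewrite xr' x1 => /(_ isT) A1.
  have := G2 x; rewrite xr' x2 => /(_ isT) A2.
  have := G3 x; rewrite s0x xr ltrBlDr -ltrBlDl x3 => /(_ isT isT) A3.
  rewrite /F.
  have -> : K r + tint (kn n) s0 r - chi n r / g s0 -
     (K x + tint (kn n) s0 x - chi n x / g s0) =
     (tint (kn n) s0 r - tint (kn n) s0 x) - (K x - K r) +
     (chi n x / g s0 - chi n r / g s0) by ring.
  have := ler_normD ((tint (kn n) s0 r - tint (kn n) s0 x) - (K x - K r))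
     (chi n x / g s0 - chi n r / g s0).
  have := ler_normB (tint (kn n) s0 r - tint (kn n) s0 x) (K x - K r).
  by move: A1 A2 A3; remainder_lra.
move=> u /andP[s0u ut].
have u0 : 0 <= u by exact: le_trans s0u.
have us0 : `|u - s0| = u - s0 by rewrite ger0_norm ?subr_ge0.
have := H1 u; have := H2 u; have := H3 u; rewrite !us0.
have [u1 u2 u3] : [/\ u - s0 < d1, u - s0 < d2 & u - s0 < d3] by split; move: s0u ut t1 t2 t3; remainder_lra.
rewrite u1 u2 u3 => /(_ isT) gu /(_ isT) au /(_ isT) giu.
(* The remainder of [chi_expansion] is going to be divided by [g u >= m]. *)
pose e' := Num.min 1 (e * m / 4).
have e'0 : 0 < e' by rewrite lt_min ltr01/= divr_gt0// mulr_gt0.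
have [b1 b10 G1] := chi_expansion n u0 e'0.
have e4 : 0 < e / 4 by rewrite divr_gt0.
have [b2 b20 G2] := continuous_lim_eps (@knc n u) e4.
have [b3 b30 G3] := phi_incr u0 (@ltr01 R).
exists (Num.min b1 (Num.min b2 b3)); first by rewrite !lt_min b10 b20.
move=> x /andP[ux xt]; rewrite -ltrBlDl !lt_min => /and3P[x1 x2 x3].
have ux' := ltW ux.
have xu0 : 0 <= x - u by rewrite subr_ge0.
have k0 : 0 <= K x - K u by rewrite subr_ge0 Knd.
have V0 : 0 <= v x - v u by rewrite subr_ge0 vnd.
have := G1 x; rewrite ux -ltrBlDl x1 => /(_ isT).
set r := (X in `|X| <= _) => rle.
have tu : `|tint (kn n) u x - kn n u * (x - u)| <= e / 4 * (x - u).
  apply: (@tint_diff_le _ (kn n) u x (kn n u) (e/4) ux' (@knm n _)).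
  move=> y /andP[uy yx]; apply/ltW/G2; rewrite ger0_norm ?subr_ge0//.
  by move: x2 yx; remainder_lra.
have chiC : `|chi n x - chi n u| <= C * (v x - v u).
  have := G3 x; rewrite ux -ltrBlDl x3 => /(_ isT) [_ PC].
  have -> : chi n x - chi n u = (phi x - phi u) * (cn n u * cn n x).
    by rewrite /chi /cn; field; rewrite !den_neq0.
  have /andP[cs0 cs1] := cn_itv n u; have /andP[ct0 ct1] := cn_itv n x.
  rewrite normrM [X in _ * X]ger0_norm; last by rewrite mulr_ge0// ltW.
  apply: le_trans (ler_piMr _ _) _ => //; first by rewrite mulr_ile1// ltW.
  rewrite (le_trans PC)// ler_wpM2r// /C.
  have := lerB_dist (a u) (a s0); have := lerB_dist (g u) (g s0).
  by move: au gu; remainder_lra.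
rewrite /F (@tint_split _ (kn n) s0 u x)//.
(* Three errors: freezing [kn n] at [u], the expansion of [chi n] at [u], and the replacement of
   [g u] by [g s0]. *)
have -> : K x + (tint (kn n) s0 u + tint (kn n) u x) - chi n x / g s0 -
   (K u + tint (kn n) s0 u - chi n u / g s0) =
   (tint (kn n) u x - kn n u * (x - u)) - r / g u
   + (chi n x - chi n u) * ((g u)^-1 - (g s0)^-1).
  by rewrite /r; field; rewrite !gt_eqF.
have A2 : `|r / g u| <= e / 4 * (v x - v u).
  rewrite normrM normfV (gtr0_norm (g_gt0 u)) ler_pdivrMr// (le_trans rle)//.
  rewrite mulrAC ler_wpM2r// (@le_trans _ _ (e * m / 4)) ?ge_min ?lexx ?orbT//.
  by have := gm u; rewrite mulrAC ler_wpM2l// ltW.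
have A3 : `|(chi n x - chi n u) * ((g u)^-1 - (g s0)^-1)| <= e / 4 * (v x - v u).
  rewrite normrM (le_trans (ler_pM _ _ chiC (ltW giu)))//.
  rewrite le_eqVlt; apply/orP; left; apply/eqP; field.
  by rewrite gt_eqF.
apply: (le_trans (ler_normD _ _)); have := ler_normB (tint (kn n) u x - kn n u * (x - u)) (r / g u).
have : e / 4 * (x - u) <= e / 4 * (v x - v u).
  by rewrite ler_wpM2l ?(ltW e4)// /v; move: k0; remainder_lra.
have : 0 <= e * (v x - v u) by rewrite mulr_ge0// ltW.
by move: tu A2 A3; remainder_lra.
Qed.

Let cn_cvg u : cn n u @[n --> \oo] --> ((phi u == 0)%:R : R).
Proof.
case: eqP => [p0|/eqP p0].
  rewrite (_ : (cn ^~ u) = fun=> 1); first exact: cvg_cst.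
  by apply/funext => n; rewrite /cn p0 mulr0 addr0 invr1.
have pu : 0 < phi u by rewrite lt_neqAle eq_sym p0 phi0.
(* Since M >= 1 and M phi >= 1, n + 1 <= M (1 + n phi). *)
pose M := Num.max 1 (phi u)^-1.
apply: (@squeeze_cvgr _ _ _ _ (fun=> 0) (fun n => M * harmonic n)).
- near=> n; have /andP[/ltW -> _] := cn_itv n u; rewrite /= /cn.
  rewrite -[leLHS]mul1r ler_pdivrMr ?(lt_le_trans ltr01) ?den_ge1//.
  rewrite /harmonic mulrAC ler_pdivlMr// mul1r -natr1 addrC mulrDr mulr1 lerD//.
    by rewrite /M le_max lexx.
  rewrite mulrCA ler_peMr// -ler_pdivrMr// mul1r /M le_max lexx orbT//.
- exact: cvg_cst.
- have cM : M * harmonic n @[n --> \oo] --> (M * 0 : R).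
    by apply: cvgM; [exact: cvg_cst|exact: cvg_harmonic].
  by rewrite mulr0 in cM.
Unshelve. all: by end_near. Qed.

Let mcontact : measurable_fun setT (fun u => (phi u == 0)%:R : R).
Proof.
have mphi := continuous_measurable_fun phic.
rewrite (_ : (fun _ => _) = \1_(phi @^-1` [set 0])).
  apply: measurable_indic; rewrite -[X in measurable X]setTI.
  by apply: mphi => //; exact: measurable_set1.
apply/funext => u; rewrite indicE; congr (_%:R); congr nat_of_bool.
by apply/eqP/idP => [p0|]; rewrite ?inE// in_setE.
Qed.

Let mag : measurable_fun setT (fun u => a u / g u).
Proof.
apply: continuous_measurable_fun => t; apply: cvgM; first exact: ac.
by apply: cvgV; [rewrite gt_eqF|exact: gc].
Qed.

Let mkc : measurable_fun setT kc.
Proof. exact: measurable_funM mag mcontact. Qed.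

Let kc_ag u : `|kc u| <= `|a u / g u|.
Proof.
by rewrite /kc normrM ler_piMr// normr_nat; case: eqP.
Qed.

Let kc_integrable s t : leb.-integrable `[s, t] (EFin \o kc).
Proof. exact: dominated_itv_integrable mkc agc kc_ag s t. Qed.

(** As n -> oo, [chi n] tends to [phi] times the indicator of [phi = 0], that is to 0, so only the
    increment of [K] and the integral of the limit rate remain. *)
Let kc_estimate s0 e : 0 <= s0 -> 0 < e -> exists2 d, 0 < d &
  forall t, s0 < t < s0 + d ->
  `|K t - K s0 + tint kc s0 t| <= e * (v t - v s0).
Proof.
move=> s00 e0; have [d d0 Hd] := cn_estimate s00 e0.
exists d => // t st.
have [_ c1] : leb.-integrable `[s0, t] (EFin \o kc) /\
    tint (kn n) s0 t @[n --> \oo] --> tint kc s0 t.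
  apply: (@Rintegral_dct _ _ _ leb `[s0, t] _ kn kc (fun u => `|a u / g u|)) => //.
  - by move=> n; exact: knm.
  - exact: measurable_funTS.
  - apply: continuous_compact_integrable; first exact: segment_compact.
    exact/continuous_subspaceT/agc.
  - apply: aeW => u _; apply: cvgM; first exact: cvg_cst.
    rewrite (_ : (_ == _)%:R = (phi u == 0)%:R ^+ 2 :> R); last first.
      by case: eqP; rewrite ?expr1n ?expr0n.
    by apply: cvgM; exact: cn_cvg.
have chi_cvg u : chi n u @[n --> \oo] --> 0.
  rewrite (_ : 0 = phi u * (phi u == 0)%:R).
    by apply: cvgM; [exact: cvg_cst|exact: cn_cvg].
  by case: eqP => [->|]; rewrite ?mul0r ?mulr0.
suff lc : (fun n => `|K t - K s0 + tint (kn n) s0 t - (chi n t - chi n s0) / g s0|)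
    @ \oo --> `|K t - K s0 + tint kc s0 t|.
  by apply: (cvgr_to_le lc); apply: nearW => n; exact: Hd.
apply: cvg_norm; rewrite -[X in _ --> X]subr0; apply: cvgB.
  by apply: cvgD; [exact: cvg_cst|exact: c1].
rewrite -(mul0r (g s0)^-1); apply: cvgM; last exact: cvg_cst.
by rewrite -[X in _ --> X](subr0 0); apply: cvgB; exact: chi_cvg.
Qed.

Definition contact_rate u := negpart (a u) / g u * (phi u == 0)%:R.

Let negpart_le (x : R) : `|negpart x| <= `|x|.
Proof. by rewrite /negpart; case: (leP (- x)) => _; rewrite ?normr0 ?normrN. Qed.

Let rate_ag u : `|contact_rate u| <= `|a u / g u|.
Proof.
rewrite /contact_rate normrM; apply: (@le_trans _ _ `|negpart (a u) / g u|).
  by rewrite ler_piMr// normr_nat; case: eqP.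
by rewrite !normrM ler_wpM2r// negpart_le.
Qed.

Lemma measurable_contact_rate : measurable_fun setT contact_rate.
Proof.
apply: measurable_funM mcontact; apply: measurable_funM.
  apply: measurable_maxr => //; apply: measurable_funN.
  exact: continuous_measurable_fun.
apply: continuous_measurable_fun => t.
by apply: cvgV; [rewrite gt_eqF|exact: gc].
Qed.

Lemma contact_rate_integrable s t : leb.-integrable `[s, t] (EFin \o contact_rate).
Proof. exact: dominated_itv_integrable measurable_contact_rate agc rate_ag s t. Qed.

(** The sign of [a s0] persists near [s0]. If it is negative, [contact_rate] is [- kc]. If it is
    positive, [contact_rate] is 0, and the increment of [K] and the integral of [kc] are nonnegative
    with a small sum, so the former is small by itself. If [a s0 = 0], both rates are small near
    [s0], and so is the difference between their integrals up to sign. *)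
Let rate_estimate s0 e : 0 <= s0 -> 0 < e -> exists2 d, 0 < d &
  forall t, s0 < t < s0 + d ->
  `|K t - K s0 - tint contact_rate s0 t| <= e * (v t - v s0).
Proof.
move=> s00 e0.
have e4 : 0 < e / 4 by rewrite divr_gt0.
have [d1 d10 H1] := kc_estimate s00 e4.
have vs t : s0 < t -> t - s0 <= v t - v s0 /\ 0 <= t - s0 /\ 0 <= K t - K s0.
  by move=> /ltW st; have := Knd st; rewrite /v; lra.
have [a0|a0|a0] := ltgtP (a s0) 0.
- have na0 : 0 < - a s0 by rewrite oppr_gt0.
  have [d2 d20 H2] := continuous_lim_eps (@ac s0) na0.
  exists (Num.min d1 d2); first by rewrite lt_min d10.
  move=> t /andP[st]; rewrite -ltrBlDl lt_min => /andP[t1 t2].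
  have := H1 t; rewrite st -ltrBlDl t1 => /(_ isT).
  have -> : tint contact_rate s0 t = - tint kc s0 t.
    rewrite -mulN1r /tint -RintegralZl//; apply: eq_Rintegral => u.
    rewrite inE/= in_itv/= => /andP[su ut].
    have au : a u < 0.
      have /H2 : `|u - s0| < d2 by rewrite ger0_norm ?subr_ge0//; lra.
      by move=> /(le_lt_trans (ler_norm _)); lra.
    rewrite /contact_rate /kc /negpart max_l ?oppr_ge0 ?ltW//; ring.
  rewrite opprK => /le_trans; apply; rewrite ler_wpM2r//; last lra.
  have [] := vs t st; lra.
- have [d2 d20 H2] := continuous_lim_eps (@ac s0) a0.
  exists (Num.min d1 d2); first by rewrite lt_min d10.
  move=> t /andP[st]; rewrite -ltrBlDl lt_min => /andP[t1 t2].
  have au u : s0 <= u <= t -> 0 < a u.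
    move=> /andP[su ut].
    have /H2 : `|u - s0| < d2 by rewrite ger0_norm ?subr_ge0//; lra.
    by rewrite distrC => /(le_lt_trans (ler_norm _)); lra.
  have := H1 t; rewrite st -ltrBlDl t1 => /(_ isT).
  have -> : tint contact_rate s0 t = 0.
    rewrite /tint (@eq_Rintegral _ _ _ _ _ (fun=> 0)); last first.
      move=> u; rewrite inE/= in_itv/= => /au u0.
      by rewrite /contact_rate /negpart max_r ?oppr_le0 ?ltW// !mul0r.
    by rewrite Rintegral_cst// mul0r.
  have kc0 : 0 <= tint kc s0 t.
    apply: Rintegral_ge0 => u /=; rewrite in_itv/= => /au u0.
    by rewrite /kc mulr_ge0// divr_ge0 ?ltW.
  have [tv [ts K0]] := vs t st.
  rewrite subr0 (ger0_norm K0) ger0_norm; last exact: addr_ge0.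
  move=> h.
  have : 0 <= e * (v t - v s0) by rewrite mulr_ge0 ?(ltW e0)//; lra.
  by lra.
- have em : 0 < e / 4 * m by rewrite mulr_gt0.
  have [d2 d20 H2] := continuous_lim_eps (@ac s0) em.
  exists (Num.min d1 d2); first by rewrite lt_min d10.
  move=> t /andP[st]; rewrite -ltrBlDl lt_min => /andP[t1 t2].
  have agu u : s0 <= u <= t -> `|a u / g u| <= e / 4.
    move=> /andP[su ut].
    have /H2 : `|u - s0| < d2 by rewrite ger0_norm ?subr_ge0//; lra.
    rewrite a0 subr0 normrM normfV (gtr0_norm (g_gt0 u)) ler_pdivrMr// => /ltW/le_trans; apply.
    by rewrite ler_wpM2l// ltW.
  have := H1 t; rewrite st -ltrBlDl t1 => /(_ isT).
  have [tv [ts K0]] := vs t st.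
  have := @tint_diff_le _ kc s0 t 0 (e / 4) (ltW st) (measurable_funTS mkc).
  rewrite mul0r subr0 => /(_ _)-A.
  have {A}A : `|tint kc s0 t| <= e / 4 * (t - s0).
    by apply: A => u su; rewrite subr0 (le_trans (kc_ag u))// agu.
  have := @tint_diff_le _ contact_rate s0 t 0 (e / 4) (ltW st)
    (measurable_funTS measurable_contact_rate).
  rewrite mul0r subr0 => /(_ _)-B.
  have {B}B : `|tint contact_rate s0 t| <= e / 4 * (t - s0).
    by apply: B => u su; rewrite subr0 (le_trans (rate_ag u))// agu.
  move=> H.
  have -> : K t - K s0 - tint contact_rate s0 t =
    (K t - K s0 + tint kc s0 t) - (tint kc s0 t + tint contact_rate s0 t) by ring.
  have := ler_normB (K t - K s0 + tint kc s0 t) (tint kc s0 t + tint contact_rate s0 t).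
  have := ler_normD (tint kc s0 t) (tint contact_rate s0 t).
  have : e / 4 * (t - s0) <= e / 4 * (v t - v s0) by rewrite ler_wpM2l// ltW.
  have : 0 <= e * (v t - v s0) by rewrite mulr_ge0 ?(ltW e0)//; lra.
  by lra.
Qed.

(** The local estimates are summed up by real induction with an arbitrary error [e] per unit of [v];
    [v t - v s] being finite, [e] is sent to 0. *)
Theorem contact_densityE s t : 0 <= s -> s <= t ->
  K t - K s = tint contact_rate s t.
Proof.
move=> s0 st.
suff H e : 0 < e -> `|K t - K s - tint contact_rate s t| <= e * (v t - v s).
  apply/eqP; rewrite -subr_eq0 -normr_le0; apply/ler_addgt0Pr => e e0.
  have V0 : 0 <= v t - v s by rewrite subr_ge0 vnd.
  have c0 : 0 < v t - v s + 1 by lra.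
  apply: (le_trans (H _ (divr_gt0 e0 c0))); rewrite add0r mulrAC ler_pdivrMr//.
  by rewrite ler_wpM2l ?ltW//; lra.
move=> e0.
pose F x := K x - tint contact_rate s x.
have -> : K t - K s - tint contact_rate s t = F t - F s.
  have -> : F s = K s.
    by rewrite /F (_ : tint _ s s = 0) ?subr0// /tint set_itv1 Rintegral_set1.
  by rewrite /F; ring.
apply: real_induction_le => //; [|exact: ltW|].
  move=> r z /andP[sr rt] z0.
  have z3 : 0 < z / 2 by rewrite divr_gt0.
  have [b1 b10 G1] := continuous_lim_eps (@Kc r) z3.
  have [b3 b30 G3] := tint_left_continuous measurable_contact_rate agc rate_ag s r z3.
  exists (Num.min b1 b3); first by rewrite !lt_min b10 b30.
  move=> x /andP[sx xr]; rewrite ltrBlDr -ltrBlDl !lt_min => /andP[x1 x3].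
  have xr' : `|x - r| = r - x by rewrite ler0_norm ?subr_le0// opprB.
  have := G1 x; rewrite xr' x1 => /(_ isT) A1.
  have := G3 x; rewrite sx xr ltrBlDr -ltrBlDl x3 => /(_ isT isT) A3.
  rewrite /F.
  have -> : K r - tint contact_rate s r - (K x - tint contact_rate s x) =
     - (K x - K r) - (tint contact_rate s r - tint contact_rate s x) by ring.
  have := ler_normB (- (K x - K r)) (tint contact_rate s r - tint contact_rate s x).
  by rewrite normrN; lra.
move=> u /andP[su ut].
have u0 : 0 <= u by exact: le_trans su.
have [d d0 Hd] := rate_estimate u0 e0; exists d => // x /andP[ux xt] xd.
have := Hd x; rewrite ux xd => /(_ isT).
rewrite /F (@tint_split _ contact_rate s u x) ?(ltW ux)//; last exact: contact_rate_integrable.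
by congr (_ <= _); congr `|_|; ring.
Qed.

End contact_density.

(** * Gaussian moments *)

Section integral_density.
Context d (T : measurableType d) (R : realType).
Variables (mu : {sigma_finite_measure set T -> \bar R}).
Variables (nu : {finite_measure set T -> \bar R}) (p : T -> R).
Hypotheses (numu : nu `<< mu) (mp : measurable_fun setT p).
Hypothesis pi : mu.-integrable setT (EFin \o p).
Hypothesis nuE : forall A, measurable A -> nu A = (\int[mu]_(x in A) (p x)%:E)%E.

(** The change of variables is the one for the Radon-Nikodym derivative of [nu], which is almost
    everywhere [p] because both have integral [nu A] over every measurable [A]. *)
Lemma ge0_integral_density (f : T -> R) : measurable_fun setT f ->
  (forall x, 0 <= f x) ->
  (\int[nu]_x (f x)%:E = \int[mu]_x (f x * p x)%:E)%E.
Proof.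
move=> mf f0.
have f0' x : (0 <= (EFin \o f) x)%E by rewrite lee_fin.
have mf' : measurable_fun setT (EFin \o f) by exact/measurable_EFinP.
rewrite -(Radon_Nikodym_SigmaFinite.change_of_variables numu f0' measurableT mf').
have gi := Radon_Nikodym_SigmaFinite.f_integrable numu.
have mg := measurable_int _ gi.
apply: ae_eq_integral => //.
- by apply: emeasurable_funM => //; exact/measurable_EFinP.
- by apply/measurable_EFinP; exact: measurable_funM.
- have : ae_eq mu setT (Radon_Nikodym_SigmaFinite.f nu mu) (EFin \o p).
    apply: integral_ae_eq => //; first exact/measurable_EFinP.
    move=> E _ mE; rewrite -nuE//.
    by rewrite -Radon_Nikodym_SigmaFinite.f_integral.
  by apply: filterS => x + Dx => /(_ Dx) ->; rewrite /= EFinM.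
Qed.

End integral_density.

Lemma Rintegral_probability_cst d (T : measurableType d) (R : realType)
  (P : probability T R) (r : R) : \int[P]_w r = r.
Proof.
rewrite Rintegral_cst//; have := @probability_setT _ _ _ P.
by move=> /= ->; rewrite mulr1.
Qed.

Section normal_mgf.
Context {R : realType}.
Notation leb := (@lebesgue_measure R).

(** Completing the square, exp (c x) times the density of N(0, s^2) is exp (c^2 s^2 / 2) times the
    density of N(c s^2, s^2). *)
Lemma normal_mgf (s c : R) : s != 0 ->
  (\int[normal_prob 0 s]_x (expR (c * x))%:E = (expR (c ^+ 2 * s ^+ 2 / 2))%:E)%E.
Proof.
move=> s0.
rewrite (@ge0_integral_density _ _ R leb (normal_prob 0 s) (normal_pdf 0 s))//.
- under eq_integral => x _.
    rewrite (_ : expR (c * x) * normal_pdf 0 s x =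
      expR (c ^+ 2 * s ^+ 2 / 2) * normal_pdf (c * s ^+ 2) s x); last first.
      rewrite !normal_pdfE// /normal_fun mulrCA [RHS]mulrCA -!expRD.
      congr (_ * expR _); rewrite -[_ *+ 2]mulr_natr; field.
      exact: s0.
    rewrite EFinM; over.
  rewrite ge0_integralZl_EFin ?expR_ge0//.
  + by rewrite integral_normal_pdf mule1.
  + by move=> x _; rewrite lee_fin normal_pdf_ge0.
  + by apply/measurable_EFinP; exact: measurable_normal_pdf.
- exact: normal_prob_dominates.
- exact: measurable_normal_pdf.
- apply: measurableT_comp; first exact: measurable_expR.
  exact: measurable_funM.
Qed.

(** The inequality 1 + x <= exp x, used at [z * u n] and at its opposite, encloses the quotient
    between [z] and [z * expR (z * u n)]. *)
Lemma expR_slope_cvg (z : R) (u : nat -> R) : (forall n, 0 < u n) ->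
  u n @[n --> \oo] --> 0 -> (expR (z * u n) - 1) / u n @[n --> \oo] --> z.
Proof.
move=> u0 cu; apply: (@squeeze_cvgr _ _ _ _ (fun=> z) (fun n => z * expR (z * u n))).
- apply: nearW => n; apply/andP; split.
    by rewrite ler_pdivlMr// lerBrDl expR_ge1Dx.
  rewrite ler_pdivrMr//.
  have := expR_ge1Dx (- (z * u n)).
  rewrite expRN -(ler_pM2r (expR_gt0 (z * u n))) mulVf ?gt_eqF ?expR_gt0//.
  lra.
- exact: cvg_cst.
- have c1 : z * u n @[n --> \oo] --> z * 0 by apply: cvgM => //; exact: cvg_cst.
  rewrite mulr0 in c1.
  have c2 : z * expR (z * u n) @[n --> \oo] --> z * expR 0.
    apply: cvgM; first exact: cvg_cst.
    by apply: (cvg_comp _ _ c1); exact: continuous_expR.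
  by rewrite expR0 mulr1 in c2.
Qed.

Lemma expR_sinh_le (y : R) : `|expR y - expR (- y)| <= 2 * `|y| * expR `|y|.
Proof.
wlog y0 : y / 0 <= y.
  move=> H; case: (leP 0 y) => [/H//|/ltW y0].
  by rewrite distrC -(normrN y) -{2}(opprK y) H// oppr_ge0.
rewrite (ger0_norm y0) ger0_norm ?subr_ge0 ?ler_expR ?ge0_cp//.
have := expR_ge1Dx (- (2 * y)).
rewrite -(ler_pM2r (expR_gt0 y)) -expRD (_ : - (2 * y) + y = - y); last by ring.
lra.
Qed.

End normal_mgf.

Section gaussian_moments.
Context d (T : measurableType d) (R : realType) (P : probability T R).
Variables (U : T -> R) (s : R).
Hypotheses (mU : measurable_fun setT U) (s0 : 0 < s).
Hypothesis U_mgf : forall c : R,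
  (\int[P]_w (expR (c * U w))%:E = (expR (c ^+ 2 * s ^+ 2 / 2))%:E)%E.
Local Notation intg f := (P.-integrable setT (EFin \o f)).

Let me c : measurable_fun setT (fun w => expR (c * U w)).
Proof. by apply: measurableT_comp => //; exact: measurable_funM. Qed.

Let ie c : intg (fun w => expR (c * U w)).
Proof.
apply/integrableP; split; first exact/measurable_EFinP.
under eq_integral do rewrite /= ger0_norm ?expR_ge0//.
by rewrite U_mgf ltry.
Qed.

Let mgfE c : \int[P]_w expR (c * U w) = expR (c ^+ 2 * s ^+ 2 / 2).
Proof. by rewrite /Rintegral U_mgf. Qed.

Let expR_abs_le (c x : R) : expR (c * `|x|) <= expR (c * x) + expR (- c * x).
Proof.
have [_|_] := ger0P x; first by rewrite lerDl expR_ge0.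
by rewrite mulrN mulNr lerDr expR_ge0.
Qed.

Let iabs c : 0 <= c -> intg (fun w => expR (c * `|U w|)).
Proof.
move=> c0; apply: (@rintegrable_le _ _ _ P setT measurableT _
    (fun w => expR (c * U w) + expR (- c * U w))) => //.
- by apply: measurableT_comp => //; apply: measurable_funM => //; exact: measurableT_comp.
- by move=> w _; rewrite ger0_norm ?expR_ge0// expR_abs_le.
- exact: rintegrableD.
Qed.

(** 2 N sinh (U / (2 N)) with N = n + 1. It tends to [U] and is dominated by exp (2 |U|), while its
    integral and that of its square are explicit in terms of the moment generating function; the
    first two moments follow without differentiating under the integral sign. *)
Let q n w := (expR (U w / (2 * n.+1%:R)) - expR (- (U w / (2 * n.+1%:R)))) * n.+1%:R.

Let qE n w : q n w = (expR ((2 * n.+1%:R)^-1 * U w) -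
   expR (- (2 * n.+1%:R)^-1 * U w)) * n.+1%:R.
Proof. by rewrite /q mulNr (mulrC (U w)). Qed.

Let sqrqE n w : q n w ^+ 2 = n.+1%:R ^+ 2 *
  (expR (n.+1%:R^-1 * U w) + expR (- n.+1%:R^-1 * U w) - 2).
Proof.
rewrite /q exprMn mulrC; congr (_ * _).
rewrite sqrrB -expRD subrr expR0 -!expRM_natl.
rewrite (_ : 2 * (U w / (2 * n.+1%:R)) = n.+1%:R^-1 * U w); last by field.
rewrite (_ : 2 * - (U w / (2 * n.+1%:R)) = - n.+1%:R^-1 * U w); last by field.
by rewrite mulr2n; ring.
Qed.

Let mq n : measurable_fun setT (q n).
Proof.
rewrite (_ : q n = fun w => (expR ((2 * n.+1%:R)^-1 * U w) -
   expR (- (2 * n.+1%:R)^-1 * U w)) * n.+1%:R); last exact/funext/qE.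
by apply: measurable_funM => //; exact: measurable_funB.
Qed.

Let q_le n w : `|q n w| <= expR (2 * `|U w|).
Proof.
have n0 : 0 < n.+1%:R :> R by [].
have n1 : 1 <= n.+1%:R :> R by rewrite ler1n.
rewrite /q normrM (ger0_norm (ltW n0)).
have H := expR_sinh_le (U w / (2 * n.+1%:R)).
apply: (@le_trans _ _ (`|U w| * expR `|U w|)).
  apply: (le_trans (ler_wpM2r (ltW n0) H)).
  rewrite normrM normfV (ger0_norm (_ : 0 <= 2 * n.+1%:R))//.
  rewrite [leLHS](_ : _ = `|U w| * expR (`|U w| / (2 * n.+1%:R))); last by field.
  apply: ler_wpM2l => //; rewrite ler_expR ler_pdivrMr//.
  by apply: ler_peMr => //; lra.
rewrite mulr_natl mulr2n expRD; apply: ler_wpM2r; first exact: expR_ge0.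
by have := expR_ge1Dx `|U w|; lra.
Qed.

Let invn_cvg : (n.+1%:R^-1 : R) @[n --> \oo] --> 0.
Proof. exact: cvg_harmonic. Qed.

Let q_cvg w : q n w @[n --> \oo] --> U w.
Proof.
have c0 : ((2 * n.+1%:R)^-1 : R) @[n --> \oo] --> 0.
  have : (2^-1 * n.+1%:R^-1 : R) @[n --> \oo] --> (2^-1 * 0 : R).
    by apply: cvgM; [exact: cvg_cst|exact: invn_cvg].
  by rewrite mulr0; under eq_fun do rewrite -invfM.
have p0 n : 0 < (2 * n.+1%:R)^-1 :> R by rewrite invr_gt0 mulr_gt0.
have c1 := @expR_slope_cvg R (U w) _ p0 c0.
have c2 := @expR_slope_cvg R (- U w) _ p0 c0.
have c3 : 2^-1 * ((expR (U w * (2 * n.+1%:R)^-1) - 1) / (2 * n.+1%:R)^-1 -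
   (expR (- U w * (2 * n.+1%:R)^-1) - 1) / (2 * n.+1%:R)^-1) @[n --> \oo]
   --> (2^-1 * (U w - - U w) : R).
  by apply: cvgM; [exact: cvg_cst|exact: cvgB].
rewrite (_ : 2^-1 * (U w - - U w) = U w) in c3; last by field.
apply: cvg_trans c3; apply: near_eq_cvg; apply: nearW => n /=.
by rewrite /q mulNr; field.
Qed.

Let iU2n n : intg (fun w => U w ^+ n.+1).
Proof.
apply: (@rintegrable_le _ _ _ P setT measurableT _
    (fun w => (n.+1)`!%:R * expR (1 * `|U w|))) => //.
- exact: measurable_funX.
- move=> w _; rewrite normrX mul1r mulrC -ler_pdivrMr ?ltr0n ?fact_gt0//.
  by have := expR_ge1Dxn n (normr_ge0 (U w)); lra.
- exact: rintegrableZl (iabs ler01).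
Qed.

Lemma gaussian_integrable : intg U.
Proof. exact: (iU2n 0). Qed.

Lemma gaussian_integrable2 : intg (fun w => U w ^+ 2).
Proof. exact: iU2n. Qed.

Lemma gaussian_integrable4 : intg (fun w => U w ^+ 4).
Proof. exact: iU2n. Qed.

Lemma gaussian_mean : \int[P]_w U w = 0.
Proof.
have [|_ c1] := @Rintegral_dct _ _ _ P setT measurableT q U
   (fun w => expR (2 * `|U w|)) mq mU (iabs (ler0n _ 2)) (fun n w _ => q_le n w).
  by apply: aeW => w _; exact: q_cvg.
have c2 : \int[P]_w q n w @[n --> \oo] --> (0 : R).
  rewrite (_ : (fun n => _) = fun=> 0); first exact: cvg_cst.
  apply/funext => n; rewrite (@eq_Rintegral _ _ _ _ _ _ _ (in1W (qE n))).
  rewrite RintegralZr//; last exact: rintegrableB.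
  by rewrite RintegralB// !mgfE sqrrN subrr mul0r.
exact: (cvg_unique _ c1 c2).
Qed.

Lemma gaussian_variance : \int[P]_w U w ^+ 2 = s ^+ 2.
Proof.
have [||_ c1] := @Rintegral_dct _ _ _ P setT measurableT
   (fun n w => q n w ^+ 2) (fun w => U w ^+ 2)
   (fun w => expR (4 * `|U w|)) (fun n => measurable_funX _ (mq n))
   (measurable_funX _ mU) (iabs (ler0n _ 4)).
- move=> n w _; rewrite normrX (_ : 4 * _ = 2%:R * (2 * `|U w|)); last by ring.
  by rewrite expRM_natl ler_pXn2r// ?nnegrE ?expR_ge0.
- by apply: aeW => w _; apply: cvgM; exact: q_cvg.
have c2 : \int[P]_w q n w ^+ 2 @[n --> \oo] --> s ^+ 2.
  have c3 : (n.+1%:R ^- 2 : R) @[n --> \oo] --> 0.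
    have : (n.+1%:R^-1 * n.+1%:R^-1 : R) @[n --> \oo] --> (0 * 0 : R).
      by apply: cvgM; exact: invn_cvg.
    by rewrite mulr0; under eq_fun do rewrite -invfM -expr2.
  have p0 n : 0 < n.+1%:R ^- 2 :> R by rewrite invr_gt0 exprn_gt0.
  have c4 := @expR_slope_cvg R (s ^+ 2 / 2) _ p0 c3.
  have c5 : 2 * ((expR (s ^+ 2 / 2 * n.+1%:R ^- 2) - 1) / n.+1%:R ^- 2)
     @[n --> \oo] --> (2 * (s ^+ 2 / 2) : R) by apply: cvgM => //; exact: cvg_cst.
  rewrite (_ : 2 * (s ^+ 2 / 2) = s ^+ 2) in c5; last by field.
  apply: cvg_trans c5; apply: near_eq_cvg; apply: nearW => n /=.
  rewrite (@eq_Rintegral _ _ _ _ _ _ _ (in1W (sqrqE n))).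
  have i2 : intg (fun=> 2) by exact: finite_measure_integrable_cst.
  have iD : intg (fun w => expR (n.+1%:R^-1 * U w) + expR (- n.+1%:R^-1 * U w)).
    exact: rintegrableD.
  rewrite RintegralZl//; last exact: rintegrableB.
  rewrite RintegralB// RintegralD// !mgfE Rintegral_probability_cst.
  rewrite sqrrN exprVn (_ : n.+1%:R ^- 2 * s ^+ 2 / 2 = s ^+ 2 / 2 / n.+1%:R ^+ 2); last by field.
  by field.
exact: (cvg_unique _ c1 c2).
Qed.

(** The exact value is 3 s^4, but only the order s^4 matters. From x^4 / 24 <= exp x at x = |U| / s
    and the generating function at 1 / s and - 1 / s, each worth exp (1 / 2), comes 24 times 2 exp
    (1 / 2). *)
Lemma gaussian_fourth : \int[P]_w U w ^+ 4 <= 48 * expR 2^-1 * s ^+ 4.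
Proof.
have i1 : intg (fun w => 24 * s ^+ 4 * (expR (s^-1 * U w) + expR (- s^-1 * U w))).
  by apply: rintegrableZl => //; exact: rintegrableD.
apply: (@le_trans _ _ (\int[P]_w (24 * s ^+ 4 * (expR (s^-1 * U w) + expR (- s^-1 * U w))))).
  apply: (le_Rintegral measurableT gaussian_integrable4 i1).
  move=> w _; have si : 0 <= s^-1 by rewrite invr_ge0 ltW.
  apply: le_trans (ler_wpM2l _ (expR_abs_le s^-1 (U w))); last first.
    by rewrite mulr_ge0// exprn_ge0// ltW.
  have := expR_ge1Dxn 3 (_ : 0 <= s^-1 * `|U w|).
  rewrite mulr_ge0// => /(_ isT).
  rewrite exprMn (_ : 4`!%:R = 24)// exprVn => H.
  have s4 : 0 < s ^+ 4 by rewrite exprn_gt0.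
  have -> : U w ^+ 4 = 24 * s ^+ 4 * ((s ^+ 4)^-1 * `|U w| ^+ 4 / 24).
    rewrite -normrX ger0_norm; last by rewrite (exprM _ 2 2) sqr_ge0.
    by field; rewrite gt_eqF.
  by apply: ler_wpM2l; [rewrite mulr_ge0// ltW|lra].
rewrite RintegralZl//; last exact: rintegrableD.
rewrite RintegralD// !mgfE sqrrN exprVn mulVf ?expf_neq0 ?gt_eqF// mul1r.
by rewrite le_eqVlt; apply/orP; left; apply/eqP; ring.
Qed.

End gaussian_moments.

(** * Independence of the Brownian increments *)

Section independent_product.
Context d (T : measurableType d) (R : realType) (P : probability T R).
Variables (Z U : T -> R).
Hypotheses (mZ : measurable_fun setT Z) (mU : measurable_fun setT U).
Hypothesis ZU_indep : independent_systems P (sigma_of Z) (sigma_of U).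
Local Notation intg f := (P.-integrable setT (EFin \o f)).

Let mZU : measurable_fun setT (fun w => (Z w, U w)).
Proof. exact: measurable_fun_pair. Qed.

Let Zm : {mfun T >-> R} := HB.pack Z (isMeasurableFun.Build _ _ _ _ _ mZ).
Let Um : {mfun T >-> R} := HB.pack U (isMeasurableFun.Build _ _ _ _ _ mU).
Let ZUm : {mfun T >-> (R * R)%type} :=
  HB.pack (fun w => (Z w, U w)) (isMeasurableFun.Build _ _ _ _ _ mZU).
Let lawZ : probability _ R := distribution P Zm.
Let lawU : probability _ R := distribution P Um.
Let lawZU : probability _ R := distribution P ZUm.

(** Independence is the equality on rectangles, and rectangles determine the product measure. *)
Let lawZUE A : measurable A -> (lawZ \x lawU)%E A = lawZU A.
Proof.
apply: product_measure_unique => {}A C mA mC.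
rewrite /= /pushforward/=.
rewrite -ZU_indep; first by [].
- by exists A => //; rewrite setTI.
- by exists C => //; rewrite setTI.
Qed.

Lemma independent_integrableM : intg Z -> intg U -> intg (fun w => Z w * U w).
Proof.
move=> iZ iU; apply/integrableP; split.
  by apply/measurable_EFinP; exact: measurable_funM.
have mf : measurable_fun setT (fun x : R * R => `|(x.1 * x.2)%:E|%E).
  apply: measurableT_comp => //; apply/measurable_EFinP.
  by apply: measurable_funM; [exact: measurable_fst|exact: measurable_snd].
have -> : (\int[P]_w `|(EFin \o (fun w => Z w * U w)%R) w| =
           \int[lawZU]_x `|(x.1 * x.2)%:E|)%E.
  by rewrite /lawZU /distribution ge0_integral_pushforward.
rewrite (eq_measure_integral (lawZ \x lawU)%E); last by move=> A mA _; exact/esym/lawZUE.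
rewrite (fubini_tonelli1 _ mf)//.
rewrite /fubini_F /=.
under eq_integral => x _.
  under eq_integral => y _ do rewrite normrM EFinM.
  rewrite ge0_integralZl_EFin//; last by do 2 apply: measurableT_comp => //.
  over.
have iUoo : (\int[lawU]_y `|y%:E| < +oo)%E.
  have /integrableP[_] := iU.
  by rewrite /lawU /distribution ge0_integral_pushforward//; exact: measurableT_comp.
rewrite ge0_integralZr//; last 2 first.
  by do 2 apply: measurableT_comp => //.
  exact: integral_ge0.
have iZoo : (\int[lawZ]_y `|y%:E| < +oo)%E.
  have /integrableP[_] := iZ.
  by rewrite /lawZ /distribution ge0_integral_pushforward//; exact: measurableT_comp.
by apply: lte_mul_pinfty => //; [exact: integral_ge0|rewrite ge0_fin_numE//; exact: integral_ge0].
Qed.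

Lemma independent_RintegralM : intg Z -> intg U ->
  \int[P]_w (Z w * U w) = (\int[P]_w Z w) * (\int[P]_w U w).
Proof.
move=> iZ iU; have iZU := independent_integrableM iZ iU.
have mf : measurable_fun setT (fun x : R * R => (x.1 * x.2)%:E).
  apply/measurable_EFinP.
  by apply: measurable_funM; [exact: measurable_fst|exact: measurable_snd].
have iL : lawZU.-integrable setT (fun x : R * R => (x.1 * x.2)%:E).
  exact: (@integrable_pushforward _ _ _ _ _ _ mZU P setT _ mf iZU measurableT).
have iP : (lawZ \x lawU)%E.-integrable setT (fun x : R * R => (x.1 * x.2)%:E).
  apply/integrableP; split => //.
  rewrite (eq_measure_integral lawZU); first by case/integrableP : iL.
  by move=> A mA _; exact: lawZUE.
rewrite /Rintegral.
have -> : (\int[P]_w (Z w * U w)%:E = \int[lawZU]_x (x.1 * x.2)%:E)%E.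
  by rewrite /lawZU /distribution integral_pushforward.
rewrite (eq_measure_integral (lawZ \x lawU)%E); last by move=> A mA _; exact/esym/lawZUE.
rewrite -(integral12_prod_meas1 iP).
have mid : measurable_fun [set: R] (EFin \o (@id R)).
  by apply/measurable_EFinP; exact: measurable_id.
have iid : lawU.-integrable setT (EFin \o id).
  exact: (@integrable_pushforward _ _ _ _ _ U mU P setT _ mid iU measurableT).
have iid' : lawZ.-integrable setT (EFin \o id).
  exact: (@integrable_pushforward _ _ _ _ _ Z mZ P setT _ mid iZ measurableT).
have E1 : (\int[lawU]_y y%:E = \int[P]_w (U w)%:E)%E.
  by rewrite /lawU /distribution integral_pushforward.
have E2 : (\int[lawZ]_y y%:E = \int[P]_w (Z w)%:E)%E.
  by rewrite /lawZ /distribution integral_pushforward.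
have UE := fineK (integrable_fin_num measurableT iU).
transitivity (fine (\int[lawZ]_x (x%:E * (fine (\int[P]_w (U w)%:E))%:E))%E).
  congr fine; apply: eq_integral => x _.
  rewrite -[LHS]/(\int[lawU]_y (x * y)%:E)%E.
  under eq_integral => y _ do rewrite EFinM.
  by rewrite integralZl// E1 UE.
by rewrite integralZr// E2 UE fineM//; exact: integrable_fin_num.
Qed.

End independent_product.

Section augmented_brownian.
Context d (T : measurableType d) (R : realType) (P : probability T R).
Variables (B : R -> {RV P >-> R}) (X0 : {RV P >-> R}).
Hypothesis P_complete : measure_is_complete P.
Hypothesis B_bm : brownian_motion B.
Hypothesis B_X0_indep :
  independent_systems P (sigma_of X0) (sigma_path (fun t => B t)).
Local Notation intg f := (P.-integrable setT (EFin \o f)).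

Let sgen (G : set_system T) A : G A -> <<s G >> A.
Proof. by move=> GA; exact: sub_gen_smallest. Qed.

Definition aug_gen (s : R) : set_system T :=
  sigma_of X0 `|` \bigcup_(u in `[0, s]) sigma_of (B u) `|` P.-negligible.

Definition aug s := augmented_filtration P X0 (fun t => B t) s.

Definition ameas s (f : T -> R) := sigma_of f `<=` aug s.

(** Gives access, for [aug s], to the closure properties of measurable functions. *)
Lemma ameasP s f :
  ameas s f <-> measurable_fun setT (f : g_sigma_algebraType (aug_gen s) -> R).
Proof.
split=> [mf _ Y mY|mf A [Y mY <-]]; last exact: mf.
by apply: mf; exists Y.
Qed.

(** Completeness of [P] is what makes the negligible generators measurable. *)
Lemma aug_measurable s A : aug s A -> measurable A.
Proof.
suff : aug s `<=` measurable by exact.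
apply: smallest_sub; first exact: sigma_algebra_measurable.
move=> {}A [[|[u _]]|/P_complete//] [Y mY <-].
- exact: measurable_funPT.
- exact: measurable_funPT.
Qed.

Lemma ameas_measurable s f : ameas s f -> measurable_fun setT f.
Proof. by move=> mf _ Y mY; apply: (@aug_measurable s); apply: mf; exists Y. Qed.

Lemma aug_mono s t : s <= t -> aug s `<=` aug t.
Proof.
move=> st; apply: sub_sigma_algebra2.
apply: setSU; apply: setUS => A [u /=]; rewrite in_itv/= => /andP[u0 us] uA.
by exists u => //=; rewrite in_itv/= u0 (le_trans us).
Qed.

Lemma ameas_mono s t f : s <= t -> ameas s f -> ameas t f.
Proof. by move=> st mf A /mf; exact: aug_mono. Qed.

Lemma ameas_B s u : 0 <= u <= s -> ameas s (B u).
Proof.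
by move=> us A ?; apply: sgen; left; right; exists u => //=; rewrite in_itv.
Qed.

Lemma ameas_incr s u v : 0 <= u <= s -> 0 <= v <= s ->
  ameas s (fun w => B v w - B u w).
Proof.
by move=> us vs; apply/ameasP/measurable_funB; apply/ameasP; exact: ameas_B.
Qed.

Lemma ameas_cst s c : ameas s (fun=> c).
Proof. by apply/ameasP; exact: measurable_cst. Qed.

Lemma ameasM s f g : ameas s f -> ameas s g -> ameas s (fun w => f w * g w).
Proof. by move=> /ameasP mf /ameasP mg; apply/ameasP/measurable_funM. Qed.

Lemma ameasD s f g : ameas s f -> ameas s g -> ameas s (fun w => f w + g w).
Proof. by move=> /ameasP mf /ameasP mg; apply/ameasP/measurable_funD. Qed.

Lemma ameas_comp s f (g : R -> R) : ameas s f -> measurable_fun setT g ->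
  ameas s (g \o f).
Proof. by move=> /ameasP mf mg; apply/ameasP; exact: measurableT_comp. Qed.

Lemma ameas_sum s n (f : nat -> T -> R) : (forall i, (i < n)%N -> ameas s (f i)) ->
  ameas s (fun w => \sum_(i < n) f i w).
Proof.
elim: n => [|n ih] mf.
  by under eq_fun do rewrite big_ord0; exact: ameas_cst.
under eq_fun do rewrite big_ord_recr/=.
apply: ameasD; last exact: mf.
by apply: ih => i ni; exact: mf (ltnW _).
Qed.

(** Two preimages of the same set differ by subsets of a null set, and the filtration contains all
    of these. Hence a process may be modified on a null event and stay adapted. *)
Lemma ameas_ae s f g : ameas s f -> {ae P, forall w, f w = g w} -> ameas s g.
Proof.
move=> mf [N [mN PN fgN]] A [Y mY <-]; rewrite setTI.
have sN A' : A' `<=` N -> aug s A'.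
  by move=> A'N; apply: sgen; right; exists N; split.
have -> : g @^-1` Y = (f @^-1` Y `\` (f @^-1` Y `&` N `\` g @^-1` Y)) `|`
    (g @^-1` Y `&` N `\` f @^-1` Y).
  apply/seteqP; split => w /=.
    move=> gw; have [fw|fw] := pselect (Y (f w)); first by left; split => // -[].
    right; split => //; split => //; apply: fgN => /= fg; apply: fw.
    by rewrite fg.
  move=> [[fw h]|[[]]//]; have [//|gw] := pselect (Y (g w)).
  exfalso; apply: h; split => //; split => //; apply: fgN => /= fg; apply: gw.
  by rewrite -fg.
have mm : forall C D, aug s C -> aug s D -> aug s (C `\` D).
  move=> C D; rewrite /aug => FC FD.
  exact: (@measurableD _ (g_sigma_algebraType (aug_gen s))).
apply: (@measurableU _ (g_sigma_algebraType (aug_gen s))).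
  apply: mm; first by apply: mf; exists Y => //; rewrite setTI.
  by apply: sN => w [[]].
by apply: sN => w [[]].
Qed.

Let path_gen : set_system T := \bigcup_(s in `[0, +oo[) sigma_of (B s).

(** Dynkin induction on the pi-system [Pi] of the sets [A0 & A1], with [A0] from [X0] and [A1] from
    the path up to [s], together with the negligible sets. Independence of [X0] from the whole path
    separates [A0] from both [A1] and the increment; independence of the increments then separates
    [A1] from the increment. For a negligible set both sides are 0. *)
Lemma independent_increment s t : 0 <= s -> s <= t ->
  independent_systems P (aug s) (sigma_of (B t \- B s)).
Proof.
move=> s0 st A C FA UC.
pose Pi : set_system T := [set D | (exists A0 A1, [/\ sigma_of X0 A0,
   natural_filtration (fun u => B u) s A1 & D = A0 `&` A1]) \/ P.-negligible D].
have X0T : sigma_of X0 setT by exists setT => //; rewrite setTI preimage_setT.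
have nfT : natural_filtration (fun u => B u) s setT.
  rewrite /natural_filtration.
  exact: (@measurableT _ (g_sigma_algebraType (\bigcup_(u in `[0, s]) sigma_of (B u)))).
have nf_sub A1 : natural_filtration (fun u => B u) s A1 -> sigma_path (fun t => B t) A1.
  suff : natural_filtration (fun u => B u) s `<=` sigma_path (fun t => B t) by exact.
  apply: sub_sigma_algebra2 => D [u].
  by rewrite /= in_itv/= => /andP[u0 _] uD; exists u => //=; rewrite in_itv/= u0.
have CS : sigma_path (fun t => B t) C.
  have mB u : 0 <= u -> measurable_fun setT (B u : g_sigma_algebraType path_gen -> R).
    move=> u0 _ Y mY; apply: sgen; exists u => //=; first by rewrite in_itv/= u0.
    by exists Y.
  have [Y mY <-] := UC.
  have mBB : measurable_fun setT (B t \- B s : g_sigma_algebraType path_gen -> R).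
    by apply: measurable_funB; apply: mB => //; exact: le_trans st.
  exact: mBB.
have mC : measurable C.
  have mBB : measurable_fun setT (B t \- B s) by apply: measurable_funB.
  by have [Y mY <-] := UC; exact: mBB.
have mX0 A0 : sigma_of X0 A0 -> measurable A0.
  by move=> [Y mY <-]; exact: measurable_funPT.
have mnf A1 : natural_filtration (fun u => B u) s A1 -> measurable A1.
  suff : natural_filtration (fun u => B u) s `<=` measurable by exact.
  apply: smallest_sub; first exact: sigma_algebra_measurable.
  move=> D [u _ [Y mY <-]].
  exact: measurable_funPT.
have augPi : aug s `<=` <<s Pi >>.
  apply: sub_sigma_algebra2 => D [[D0|[u us Du]]|D0]; last by right.
  - by left; exists D, setT; rewrite setIT.
  - left; exists setT, D; rewrite setTI; split => //.
    by apply: sgen; exists u.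
have PiI : setI_closed Pi.
  move=> D E [[A0 [A1 [hA0 hA1 ->]]]|D0] [[E0 [E1 [hE0 hE1 ->]]]|E0].
  - left; exists (A0 `&` E0), (A1 `&` E1); split; last by rewrite setIACA.
      move: hA0 hE0 => [Y mY <-] [Y' mY' <-]; exists (Y `&` Y'); first exact: measurableI.
      by rewrite !setTI preimage_setI.
    exact: (@measurableI _ (g_sigma_algebraType (\bigcup_(u in `[0, s]) sigma_of (B u)))).
  - by right; apply: negligibleS E0; exact: subIsetr.
  - by right; apply: negligibleS D0; exact: subIsetl.
  - by right; apply: negligibleS D0; exact: subIsetl.
suff H : forall D, <<s Pi >> D -> measurable D /\ P (D `&` C) = (P D * P C)%E.
  by have [] := H A (augPi _ FA).
have PCfin : P C \is a fin_num by exact: fin_num_measure.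
apply: (@dynkin_induction _ (g_sigma_algebraType Pi)) => //.
- by split => //; rewrite setTI probability_setT mul1e.
- move=> D [[A0 [A1 [hA0 hA1 ->]]]|D0].
    split; first by apply: measurableI; [exact: mX0|exact: mnf].
    have A1C : sigma_path (fun t => B t) (A1 `&` C).
      exact: (@measurableI _ (g_sigma_algebraType path_gen) _ _ (nf_sub _ hA1) CS).
    rewrite -setIA (B_X0_indep hA0 A1C) (bm_indep_incr B_bm s0 st hA1 UC).
    by rewrite muleA -(B_X0_indep hA0 (nf_sub _ hA1)).
  have mD : d.-measurable D by exact: P_complete.
  split => //.
  have PD0 : P D = 0 by apply/measure_negligible.
  rewrite PD0 mul0e; apply/measure_negligible; first exact: measurableI.
  by apply: negligibleS D0; exact: subIsetl.
- move=> D _ [mD PD]; split; first exact: measurableC.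
  have PDfin : P D \is a fin_num by exact: fin_num_measure.
  have -> : (P (~` D) = 1 - P D)%E by exact: probability_setC.
  have PD1 : (1 +? - P D)%E by rewrite fin_num_adde_defl// fin_numN.
  rewrite (muleBl PCfin PD1).
  rewrite mul1e -PD.
  rewrite setIC -setDE (measureD mC mD) ?ltey_eq ?PCfin//.
  by rewrite (setIC C).
- move=> F _ tF mF.
  have mFk k : d.-measurable (F k) by case: (mF k).
  split; first exact: bigcupT_measurable.
  rewrite setI_bigcupl measure_bigcup//=; last 2 first.
    by move=> k _; exact: measurableI.
    exact: trivIset_setIr.
  rewrite (@eq_eseriesr _ _ (fun k => (fine (P C))%:E * P (F k))%E); last first.
    by move=> k _; rewrite (mF k).2 muleC fineK.
  rewrite nneseriesZl; last by move=> k _; exact: measure_ge0.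
  by rewrite muleC measure_bigcup//= fineK.
Qed.

End augmented_brownian.

(** * Moments of Brownian increments with adapted weights *)

Section brownian_isometry.
Context d (T : measurableType d) (R : realType) (P : probability T R).
Variables (B : R -> {RV P >-> R}) (X0 : {RV P >-> R}).
Hypothesis P_complete : measure_is_complete P.
Hypothesis B_bm : brownian_motion B.
Hypothesis B_X0_indep :
  independent_systems P (sigma_of X0) (sigma_path (fun t => B t)).
Local Notation intg f := (P.-integrable setT (EFin \o f)).
Local Notation ameas := (ameas B X0).

Lemma intg_bounded (f : T -> R) C : measurable_fun setT f ->
  (forall w, `|f w| <= C) -> intg f.
Proof.
move=> mf fC; apply: (@rintegrable_le _ _ _ P setT measurableT _ (fun=> C)) => //.
exact: finite_measure_integrable_cst.
Qed.

Lemma intgM_bounded (f g : T -> R) C : measurable_fun setT f ->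
  (forall w, `|f w| <= C) -> intg g -> intg (fun w => f w * g w).
Proof.
move=> mf fC ig.
apply: (@rintegrable_le _ _ _ P setT measurableT _ (fun w => C * `|g w|)).
- by apply: measurable_funM => //; exact: rintegrable_measurable ig.
- by move=> w _; rewrite normrM ler_wpM2r.
- by apply: rintegrableZl => //; exact: integrable_norm ig.
Qed.

Section increment.
Variables s t : R.
Hypotheses (s0 : 0 <= s) (st : s <= t).
Let U w := B t w - B s w.

Let mU : measurable_fun setT U.
Proof. exact: measurable_funB. Qed.

Lemma increment_mgf (c : R) : s < t ->
  (\int[P]_w (expR (c * U w))%:E = (expR (c ^+ 2 * Num.sqrt (t - s) ^+ 2 / 2))%:E)%E.
Proof.
move=> lst; have sq0 : Num.sqrt (t - s) != 0.
  by rewrite gt_eqF// sqrtr_gt0 subr_gt0.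
rewrite -(normal_mgf c sq0).
have me : measurable_fun setT (fun x : R => (expR (c * x))%:E).
  apply/measurable_EFinP; apply: measurableT_comp; first exact: measurable_expR.
  exact: measurable_funM.
have mU' : measurable_fun setT (U : T -> measurableTypeR R) by exact: mU.
pose Um : {mfun T >-> measurableTypeR R} :=
  HB.pack (U : T -> measurableTypeR R) (isMeasurableFun.Build _ _ _ _ _ mU').
transitivity (\int[distribution P Um]_x (expR (c * x))%:E)%E.
  by rewrite /distribution (ge0_integral_pushforward mU').
apply: eq_measure_integral => A mA _; exact: (bm_gauss_incr B_bm s0 lst mA).
Qed.

Lemma increment_moments : [/\ intg U, intg (fun w => U w ^+ 2),
  intg (fun w => U w ^+ 4) & [/\ \int[P]_w U w = 0, \int[P]_w U w ^+ 2 = t - s &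
  \int[P]_w U w ^+ 4 <= 48 * expR 2^-1 * (t - s) ^+ 2]].
Proof.
move: (st); rewrite le_eqVlt => /predU1P[E|lst]; last first.
  have sq0 : 0 < Num.sqrt (t - s) by rewrite sqrtr_gt0 subr_gt0.
  have mgf c := increment_mgf c lst.
  split; [exact: gaussian_integrable mgf|exact: gaussian_integrable2 mgf|
          exact: gaussian_integrable4 mgf|split].
  - exact: gaussian_mean mgf.
  - by rewrite (gaussian_variance mU mgf) sqr_sqrtr// subr_ge0.
  - have := gaussian_fourth mU sq0 mgf.
    by rewrite (exprM _ 2 2) sqr_sqrtr// subr_ge0.
(* For [s = t] the law of the increment is not given by [bm_gauss_incr]. *)
have U0 : U = fun=> 0 by apply/funext => w; rewrite /U E subrr.
have i0 : intg (fun=> 0) by exact: finite_measure_integrable_cst.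
rewrite U0 E subrr !expr0n/= !Rintegral_probability_cst mulr0.
by split => //.
Qed.

Lemma increment_indep (Z : T -> R) (f : R -> R) : ameas s Z -> intg Z ->
  measurable_fun setT f -> intg (f \o U) ->
  intg (fun w => Z w * f (U w)) /\
  \int[P]_w (Z w * f (U w)) = (\int[P]_w Z w) * \int[P]_w f (U w).
Proof.
move=> mZ iZ mf iU.
have ind : independent_systems P (sigma_of Z) (sigma_of (f \o U)).
  move=> A C ZA [Y mY <-].
  apply: (independent_increment P_complete B_bm B_X0_indep s0 st); first exact: mZ.
  exists (f @^-1` Y) => //; rewrite -[X in measurable X]setTI; exact: mf.
have mZ' := ameas_measurable P_complete mZ.
have mfU : measurable_fun setT (f \o U) by exact: measurableT_comp.
split; first exact: (independent_integrableM mZ' mfU ind iZ iU).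
exact: (independent_RintegralM mZ' mfU ind iZ iU).
Qed.

Lemma increment_mean0 (Z : T -> R) : ameas s Z -> intg Z ->
  intg (fun w => Z w * U w) /\ \int[P]_w (Z w * U w) = 0.
Proof.
move=> mZ iZ; have [iU _ _ [EU _ _]] := increment_moments.
have [? ->] := increment_indep mZ iZ (@measurable_id _ _ setT) iU.
by rewrite EU mulr0.
Qed.

Lemma increment_sqr (Z : T -> R) : ameas s Z -> intg Z ->
  intg (fun w => Z w * U w ^+ 2) /\
  \int[P]_w (Z w * U w ^+ 2) = (\int[P]_w Z w) * (t - s).
Proof.
move=> mZ iZ; have [_ iU _ [_ EU _]] := increment_moments.
have [? E] := @increment_indep Z (fun x => x ^+ 2) mZ iZ (@exprn_measurable R setT 2) iU.
by rewrite E EU.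
Qed.

End increment.

(** The length of the intersection of ]a, b] and ]c, e]. *)
Definition overlap (a b c e : R) : R := Num.max 0 (Num.min b e - Num.max a c).

(** By symmetry [a <= c]. The part of [B b - B a] before [c] is known at [c], hence orthogonal to
    [B e - B c]. After [c], with [m] and [M] the smaller and the larger of [b] and [e], the
    increment from [m] to [M] has mean zero given what precedes, and only the square of the common
    increment [B m - B c] contributes. *)
Lemma increment_product (a b c e : R) (xi zeta : T -> R) (C C' : R) :
  0 <= a <= b -> 0 <= c <= e -> ameas a xi -> ameas c zeta ->
  (forall w, `|xi w| <= C) -> (forall w, `|zeta w| <= C') ->
  intg (fun w => xi w * (B b w - B a w) * (zeta w * (B e w - B c w))) /\
  \int[P]_w (xi w * (B b w - B a w) * (zeta w * (B e w - B c w))) =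
  \int[P]_w (xi w * zeta w * overlap a b c e).
Proof.
wlog ac : a b c e xi zeta C C' / a <= c.
  move=> H ab ce mxi mzeta xiC zetaC.
  case: (leP a c) => [/H|/ltW ca]; first exact.
  have [] := H c e a b zeta xi C' C ca ce ab mzeta mxi zetaC xiC.
  rewrite (_ : (fun _ => _) = fun w => xi w * (B b w - B a w) * (zeta w * (B e w - B c w))); last first.
    by apply/funext => w; rewrite mulrC.
  move=> ? ->; split => //; apply: eq_Rintegral => w _.
  by rewrite /overlap [Num.min e b]minC [Num.max c a]maxC (mulrC (zeta w)).
move=> /andP[a0 ab] /andP[c0 ce] mxi mzeta xiC zetaC.
have mxi' := ameas_measurable P_complete mxi.
have mzeta' := ameas_measurable P_complete mzeta.
have mxz : measurable_fun setT (fun w => xi w * zeta w) by exact: measurable_funM.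
have xzC w : `|xi w * zeta w| <= C * C'.
  by rewrite normrM ler_pM.
have mxic : ameas c xi by exact: ameas_mono mxi.
have mxzc : ameas c (fun w => xi w * zeta w) by exact: ameasM.
have ixz : intg (fun w => xi w * zeta w) by exact: intg_bounded xzC.
have part1 b' : a <= b' -> b' <= c ->
  intg (fun w => xi w * (B b' w - B a w) * (zeta w * (B e w - B c w))) /\
  \int[P]_w (xi w * (B b' w - B a w) * (zeta w * (B e w - B c w))) = 0.
  move=> ab' b'c.
  have [i1 _ _ _] := increment_moments a0 ab'.
  have mZ : ameas c (fun w => xi w * zeta w * (B b' w - B a w)).
    by apply: ameasM => //; apply: ameas_incr; rewrite ?a0 ?(le_trans a0 ab')//.
  have iZ : intg (fun w => xi w * zeta w * (B b' w - B a w)).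
    exact: intgM_bounded xzC i1.
  have [] := increment_mean0 c0 ce mZ iZ.
  by rewrite (_ : (fun _ => _) = fun w => xi w * (B b' w - B a w) * (zeta w * (B e w - B c w)));
    last by apply/funext => w; ring.
have ov0 : b <= c -> overlap a b c e = 0.
  move=> bc; rewrite /overlap max_l// subr_le0 (max_r ac) ge_min bc//.
case: (leP b c) => [bc|/ltW cb].
  have [i1 ->] := part1 b ab bc; split => //.
  by under eq_Rintegral do rewrite ov0// mulr0; rewrite Rintegral_probability_cst.
have [i1 E1] := part1 c ac (lexx c).
pose m := Num.min b e; pose M := Num.max b e.
have cm : c <= m by rewrite le_min cb ce.
have mM : m <= M by rewrite /m /M; case: (leP b e) => // /ltW.
have m0 : 0 <= m := le_trans c0 cm.
have [i2 E2] := increment_sqr c0 cm mxzc ixz.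
have [ib _ _ _] := increment_moments c0 cm.
have mZ : ameas m (fun w => xi w * zeta w * (B m w - B c w)).
  apply: ameasM; first exact: ameas_mono mxzc.
  by apply: ameas_incr; rewrite ?c0 ?m0 //=.
have iZ : intg (fun w => xi w * zeta w * (B m w - B c w)).
  exact: intgM_bounded xzC ib.
have [i3 E3] := increment_mean0 m0 mM mZ iZ.
rewrite (_ : (fun w => xi w * (B b w - B a w) * (zeta w * (B e w - B c w))) =
  (fun w => (xi w * (B c w - B a w) * (zeta w * (B e w - B c w))) +
  (xi w * zeta w * (B m w - B c w) ^+ 2 + xi w * zeta w * (B m w - B c w) * (B M w - B m w)))); last first.
  by apply/funext => w; rewrite /m /M; case: (leP b e) => _; ring.
have i23 := rintegrableD measurableT i2 i3.
split; first exact: rintegrableD.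
rewrite RintegralD// E1 add0r RintegralD// E2 E3 addr0 RintegralZr//.
by rewrite /overlap (max_r ac) -/m max_r// subr_ge0.
Qed.

End brownian_isometry.

(** * The isometry for simple processes *)

Section Rintegral_sum.
Context d (T : measurableType d) (R : realType).
Variables (mu : {measure set T -> \bar R}) (D : set T) (mD : measurable D).
Local Notation intg f := (mu.-integrable D (EFin \o f)).

Lemma Rintegral_sum n (f : nat -> T -> R) : (forall i, (i < n)%N -> intg (f i)) ->
  intg (fun x => \sum_(i < n) f i x) /\
  \int[mu]_(x in D) (\sum_(i < n) f i x) = \sum_(i < n) \int[mu]_(x in D) f i x.
Proof.
elim: n => [|n ih] fi.
  have E : (fun x => \sum_(i < 0) f i x) = fun=> 0.
    by apply/funext => x; rewrite big_ord0.
  split; first by rewrite E; exact: (integrable0 mu D).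
  rewrite big_ord0 (_ : (fun x => \sum_(i < 0) f i x) = fun=> 0)//.
  by rewrite /Rintegral integral0.
have [i1 E1] := ih (fun i (ni : (i < n)%N) => fi i (ltnW ni)).
have E : (fun x => \sum_(i < n.+1) f i x) = fun x => \sum_(i < n) f i x + f n x.
  by apply/funext => x; rewrite big_ord_recr.
have fn := fi n (ltnSn n).
rewrite E big_ord_recr/= -E1; split; first exact: rintegrableD.
by rewrite RintegralD.
Qed.

End Rintegral_sum.

Section elementary.
Context {R : realType}.
Notation leb := (@lebesgue_measure R).
Implicit Types (x a b : nat -> R) (s t p q u : R).

(** The intervals may overlap: a simple process is later extended by one more term on the whole of
    ]s, t]. *)
Definition elem n x a b u : R := \sum_(i < n) x i * \1_(`]a i, b i]) u.

Lemma measurable_elem n x a b : measurable_fun setT (elem n x a b).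
Proof.
rewrite /elem; elim: n => [|n ih].
  by under eq_fun do rewrite big_ord0; exact: measurable_cst.
under eq_fun do rewrite big_ord_recr/=.
by apply: measurable_funD => //; apply: measurable_funM.
Qed.

Lemma elem_bounded n x a b : exists C, forall u, `|elem n x a b u| <= C.
Proof.
exists (\sum_(i < n) `|x i|) => u; apply: (le_trans (ler_norm_sum _ _ _)).
apply: ler_sum => i _; rewrite normrM ler_piMr// indicE normr_nat.
by rewrite lern1; case: (_ \in _).
Qed.

Lemma tint_indic s t p q : s <= p -> q <= t ->
  leb.-integrable `[s, t] (EFin \o \1_(`]p, q])) /\
  tint (\1_(`]p, q])) s t = Num.max 0 (q - p).
Proof.
move=> sp qt; split.
  apply: (@itv_integrable _ _ _ _ 1); first exact: measurable_funTS.
  by move=> u _; rewrite indicE normr_nat lern1; case: (_ \in _).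
rewrite /tint /Rintegral integral_indic//.
rewrite (_ : _ `&` _ = `]p, q]%classic); last first.
  apply/seteqP; split=> [u []//|u] /=; rewrite !in_itv/= => /andP[pu uq].
  by rewrite pu uq (le_trans sp (ltW pu)) (le_trans uq).
rewrite /= lebesgue_measure_itv/= lte_fin.
case: ltP => pq /=; first by rewrite max_r// subr_ge0 ltW.
by rewrite max_l// subr_le0.
Qed.

Lemma tint_elem_sqr n x a b s t : (forall i, s <= a i) -> (forall i, b i <= t) ->
  tint (fun u => elem n x a b u ^+ 2) s t =
  \sum_(i < n) \sum_(j < n) x i * x j * overlap (a i) (b i) (a j) (b j).
Proof.
move=> sa bt.
pose f i j u : R := x i * x j * \1_(`]Num.max (a i) (a j), Num.min (b i) (b j)]) u.
have fi i j : leb.-integrable `[s, t] (EFin \o f i j).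
  by apply: rintegrableZl => //; apply: (tint_indic _ _).1;
    rewrite ?le_max ?ge_min ?sa ?bt.
transitivity (tint (fun u => \sum_(i < n) \sum_(j < n) f i j u) s t).
  apply: eq_Rintegral => u _; rewrite /elem expr2 big_distrlr/=.
  apply: eq_bigr => i _; apply: eq_bigr => j _; rewrite /f mulrACA; congr (_ * _).
  rewrite !indicE -natrM mulnb; congr (_%:R); congr nat_of_bool.
  rewrite !mem_setE !in_itv/= gt_max le_min.
  by case: (_ < u); case: (_ < u); case: (u <= _); case: (u <= _).
have S i : leb.-integrable `[s, t] (EFin \o (fun u => \sum_(j < n) f i j u)) /\
    tint (fun u => \sum_(j < n) f i j u) s t =
    \sum_(j < n) x i * x j * overlap (a i) (b i) (a j) (b j).
  have [i1 E1] := @Rintegral_sum _ _ _ leb `[s, t] (measurable_itv _) n (f i) (fun j _ => fi i j).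
  split => //; rewrite /tint E1; apply: eq_bigr => j _.
  rewrite /f RintegralZl//; last first.
    by apply: (tint_indic _ _).1; rewrite ?le_max ?ge_min ?sa ?bt.
  congr (_ * _); apply: (tint_indic _ _).2; by rewrite ?le_max ?ge_min ?sa ?bt.
have [_] := @Rintegral_sum _ _ _ leb `[s, t] (measurable_itv _) n
  (fun i u => \sum_(j < n) f i j u) (fun j _ => (S j).1).
by rewrite /tint => ->; apply: eq_bigr => i _; exact: (S i).2.
Qed.

Lemma tint_elem_disjoint n x a b s t : (forall i, s <= a i) -> (forall i, b i <= t) ->
  (forall i, a i <= b i) -> (forall i j, (i < j)%N -> b i <= a j) ->
  tint (fun u => elem n x a b u ^+ 2) s t = \sum_(i < n) x i ^+ 2 * (b i - a i).
Proof.
move=> sa bt ab dis; rewrite tint_elem_sqr//; apply: eq_bigr => i _.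
rewrite (bigD1 i)//= big1 ?addr0.
  by rewrite /overlap maxxx minxx max_r ?subr_ge0.
move=> j /eqP ji; rewrite /overlap max_l ?mulr0// subr_le0.
have [ij|ij] : (i < j)%N \/ (j < i)%N.
  by apply/orP; rewrite -neq_ltn eq_sym; apply/eqP => /val_inj.
  by rewrite (le_trans (y := b i)) ?ge_min ?lexx// le_max (dis _ _ ij) orbT.
by rewrite (le_trans (y := b j)) ?ge_min ?lexx ?orbT// le_max (dis _ _ ij).
Qed.

End elementary.

Section finite_isometry.
Context d (T : measurableType d) (R : realType) (P : probability T R).
Variables (B : R -> {RV P >-> R}) (X0 : {RV P >-> R}).
Hypothesis P_complete : measure_is_complete P.
Hypothesis B_bm : brownian_motion B.
Hypothesis B_X0_indep :
  independent_systems P (sigma_of X0) (sigma_path (fun t => B t)).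
Local Notation intg f := (P.-integrable setT (EFin \o f)).
Local Notation ameas := (ameas B X0).

Variables (n : nat) (xi : nat -> T -> R) (a b : nat -> R) (s t : R) (Y : T -> R).
Variables (C : nat -> R) (CY : R).
Hypotheses (s0 : 0 <= s) (sa : forall i, s <= a i) (ab : forall i, a i <= b i).
Hypotheses (bt : forall i, b i <= t) (mxi : forall i, ameas (a i) (xi i)).
Hypotheses (xiC : forall i w, `|xi i w| <= C i) (mY : ameas s Y).
Hypothesis YC : forall w, `|Y w| <= CY.

(** In the expanded square the double sum is given by [increment_product], and the cross terms with
    [Y] vanish because [Y w * xi i w] is known at [a i]. That [Y] costs exactly its own second
    moment is what later yields the martingale property without conditional expectations. *)
Lemma elementary_isometry :
  [/\ intg (fun w => ((\sum_(i < n) xi i w * (B (b i) w - B (a i) w)) - Y w) ^+ 2),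
   intg (fun w => tint (fun u => elem n (xi ^~ w) a b u ^+ 2) s t) &
  \int[P]_w ((\sum_(i < n) xi i w * (B (b i) w - B (a i) w)) - Y w) ^+ 2 =
  \int[P]_w Y w ^+ 2 +
  \int[P]_w tint (fun u => elem n (xi ^~ w) a b u ^+ 2) s t].
Proof.
have a0 i : 0 <= a i <= b i by rewrite (le_trans s0 (sa i)) ab.
pose p i w : R := xi i w * (B (b i) w - B (a i) w).
have H i j := increment_product P_complete B_bm B_X0_indep (a0 i) (a0 j) (@mxi i)
  (@mxi j) (xiC i) (xiC j).
have mxi' i := ameas_measurable P_complete (@mxi i).
have mY' := ameas_measurable P_complete mY.
pose ov i j := overlap (a i) (b i) (a j) (b j).
have io i j : intg (fun w => xi i w * xi j w * ov i j).
  apply: (@intg_bounded _ _ _ _ _ (C i * C j * `|ov i j|)).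
    by apply: measurable_funM => //; exact: measurable_funM.
  by move=> w; rewrite !normrM ler_wpM2r// ler_pM.
have [ipp Epp] := @Rintegral_sum _ _ _ P setT measurableT n
  (fun i w => \sum_(j < n) p i w * p j w)
  (fun i _ => (@Rintegral_sum _ _ _ P setT measurableT n
     (fun j w => p i w * p j w) (fun j _ => (H i j).1)).1).
have [ioo Eoo] := @Rintegral_sum _ _ _ P setT measurableT n
  (fun i w => \sum_(j < n) xi i w * xi j w * ov i j)
  (fun i _ => (@Rintegral_sum _ _ _ P setT measurableT n
     (fun j w => xi i w * xi j w * ov i j) (fun j _ => io i j)).1).
have tE : (fun w => tint (fun u => elem n (xi ^~ w) a b u ^+ 2) s t) =
    (fun w => \sum_(i < n) \sum_(j < n) xi i w * xi j w * ov i j).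
  by apply/funext => w; rewrite tint_elem_sqr.
have HY i : intg (fun w => Y w * p i w) /\ \int[P]_w (Y w * p i w) = 0.
  have mZ : ameas (a i) (fun w => Y w * xi i w).
    by apply: ameasM => //; exact: ameas_mono mY.
  have iZ : intg (fun w => Y w * xi i w).
    apply: (@intg_bounded _ _ _ _ _ (CY * C i)); first exact: measurable_funM.
    by move=> w; rewrite normrM ler_pM.
  have /andP[a0i abi] := a0 i.
  have [] := increment_mean0 P_complete B_bm B_X0_indep a0i abi mZ iZ.
  rewrite (_ : (fun w => Y w * xi i w * (B (b i) w - B (a i) w)) = fun w => Y w * p i w)//.
  by apply/funext => w; rewrite /p mulrA.
have [iYp EYp] := @Rintegral_sum _ _ _ P setT measurableT n
  (fun i w => Y w * p i w) (fun i _ => (HY i).1).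
have iYY : intg (fun w => Y w ^+ 2).
  apply: (@intg_bounded _ _ _ _ _ (CY ^+ 2)); first exact: measurable_funX.
  by move=> w; rewrite normrX lerXn2r ?nnegrE// (le_trans (normr_ge0 _) (YC w)).
have sE : (fun w => ((\sum_(i < n) xi i w * (B (b i) w - B (a i) w)) - Y w) ^+ 2) =
   (fun w => (\sum_(i < n) \sum_(j < n) p i w * p j w
    - 2 * \sum_(i < n) Y w * p i w) + Y w ^+ 2).
  apply/funext => w; rewrite -/(\sum_(i < n) p i w) sqrrB.
  rewrite {1}expr2 big_distrlr/= -mulr_sumr; congr (_ - _ + _).
  by rewrite -mulr_natl (mulrC (Y w)).
have i1 := rintegrableZl measurableT 2 iYp.
have i2 := rintegrableB measurableT ipp i1.
rewrite sE tE; split => //; first exact: rintegrableD.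
rewrite RintegralD// RintegralB// RintegralZl// EYp Epp Eoo addrC; congr (_ + _).
rewrite [X in 2 * X]big1 ?mulr0 ?subr0; last by move=> i _; exact: (HY i).2.
apply: eq_bigr => i _.
have [_ ->] := @Rintegral_sum _ _ _ P setT measurableT n
     (fun j w => p i w * p j w) (fun j _ => (H i j).1).
have [_ ->] := @Rintegral_sum _ _ _ P setT measurableT n
     (fun j w => xi i w * xi j w * ov i j) (fun j _ => io i j).
by apply: eq_bigr => j _; exact: (H i j).2.
Qed.

End finite_isometry.

(** * Jointly measurable processes *)

Section le_tint_open.
Context {R : realType}.
Notation leb := (@lebesgue_measure R).

Lemma le_tint_oc (f g : R -> R) s t : leb.-integrable `[s, t] (EFin \o f) ->
  leb.-integrable `[s, t] (EFin \o g) ->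
  (forall u, s < u <= t -> f u <= g u) -> tint f s t <= tint g s t.
Proof.
move=> fi gi fg.
have sub : `]s, t] `<=` `[s, t].
  by move=> u /=; rewrite !in_itv/= => /andP[/ltW -> ->].
have fi' : leb.-integrable `]s, t] (EFin \o f) by apply: integrableS fi.
have gi' : leb.-integrable `]s, t] (EFin \o g) by apply: integrableS gi.
rewrite /tint -!Rintegral_itv_obnd_cbnd//.
by apply: le_Rintegral => // u /=; rewrite in_itv/=; exact: fg.
Qed.

End le_tint_open.

Section joint_measurability.
Context d (T : measurableType d) (R : realType) (P : probability T R).
Notation leb := (@lebesgue_measure R).
Local Notation intg f := (P.-integrable setT (EFin \o f)).

Definition jointly_measurable (f : R -> T -> R) :=
  measurable_fun [set: measurableTypeR R * T] (fun p => f p.1 p.2).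

Lemma joint_section (f : R -> T -> R) u : jointly_measurable f -> measurable_fun setT (f u).
Proof.
by move=> mf; exact: (measurableT_comp mf (@pair1_measurable _ _ (measurableTypeR R) T u)).
Qed.

Lemma joint_path (f : R -> T -> R) w : jointly_measurable f -> measurable_fun setT (f ^~ w).
Proof.
by move=> mf; exact: (measurableT_comp mf (@pair2_measurable _ _ (measurableTypeR R) T w)).
Qed.

Lemma caratheodory_joint (f : R -> T -> R) : (forall u, measurable_fun setT (f u)) ->
  (forall w, continuous (f ^~ w)) -> jointly_measurable f.
Proof.
move=> mf cf.
pose g n (p : measurableTypeR R * T) : R :=
  f ((Num.floor (n.+1%:R * p.1))%:~R / n.+1%:R) p.2.
apply: (@measurable_fun_cvg _ _ R setT g) => //.
  move=> n _ Y mY; rewrite setTI.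
  pose S (k : int) : set (measurableTypeR R * T) :=
    [set u | Num.floor (n.+1%:R * u : R) = k] `*` (f (k%:~R / n.+1%:R) @^-1` Y).
  have -> : g n @^-1` Y = \bigcup_(i in [set: nat])
      (if unpickle i is Some k then S k else set0).
    apply/seteqP; split=> [[u w] /= Yg|[u w] [i _]].
      have [k kE] : exists k, Num.floor (n.+1%:R * u : R) = k by eexists.
      rewrite /g/= kE in Yg.
      by exists (pickle k); rewrite // pickleK; split.
    by case: (unpickle i) => // k [/= uk Yk]; rewrite /g/= uk.
  apply: bigcupT_measurable => i; case: unpickle => [k|//].
  apply: measurableX; last by rewrite -[X in measurable X]setTI; exact: mf.
  have -> : [set u | Num.floor (n.+1%:R * u : R) = k] =
      `[k%:~R / n.+1%:R, (k + 1)%:~R / n.+1%:R[%classic.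
    apply/seteqP; split => u /=; rewrite in_itv/= ler_pdivrMr// ltr_pdivlMr// (mulrC u).
      by move=> <-; exact: floor_itv.
    by move=> ?; apply/eqP; rewrite floor_eq.
  exact: measurable_itv.
move=> [u w] _ /=; rewrite /g/=.
have cu : ((Num.floor (n.+1%:R * u))%:~R / n.+1%:R : R) @[n --> \oo] --> u.
  apply: (@squeeze_cvgr _ _ _ _ (fun n => u - harmonic n) (fun=> u)).
  - apply: nearW => n; rewrite /harmonic/=.
    have n0 : 0 < n.+1%:R :> R by [].
    rewrite ler_pdivrMr// (mulrC u n.+1%:R) floor_le andbT ler_pdivlMr// mulrBl mulVf ?gt_eqF//.
    by rewrite lerBlDr (mulrC u) ltW// -intrD1 floorD1_gt.
  - have : u - harmonic n @[n --> \oo] --> (u - 0 : R).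
      by apply: cvgB; [exact: cvg_cst|exact: cvg_harmonic].
    by rewrite subr0.
  - exact: cvg_cst.
exact: (cvg_comp _ (f ^~ w) cu (cf w u)).
Qed.

(** No integrability of the paths is assumed: Tonelli's theorem is applied to the positive and the
    negative part separately. *)
Lemma measurable_tint (f : R -> T -> R) s t : jointly_measurable f ->
  measurable_fun setT (fun w => tint (f ^~ w) s t).
Proof.
move=> mf; rewrite /tint /Rintegral.
apply: measurableT_comp; first exact: fine_measurable.
pose g (p : measurableTypeR R * T) : \bar R := (f p.1 p.2 * \1_(`[s, t]) p.1)%:E.
have mg : measurable_fun setT g.
  apply/measurable_EFinP; apply: measurable_funM; first exact: mf.
  apply: measurableT_comp; last exact: measurable_fst.
  exact: measurable_indic.
rewrite (_ : (fun _ => _) = (fun w => \int[leb]_u (g^\+ (u, w)) - \int[leb]_u (g^\- (u, w)))%E).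
  apply: emeasurable_funB.
    exact: (measurable_fun_fubini_tonelli_G _ (measurable_funepos mg) (funepos_ge0 g)).
  exact: (measurable_fun_fubini_tonelli_G _ (measurable_funeneg mg) (funeneg_ge0 g)).
apply/funext => w; rewrite integral_mkcond.
transitivity (\int[leb]_u g (u, w))%E; last first.
  rewrite [LHS]integralE; congr (_ - _)%E; apply: eq_integral => u _.
    by rewrite !funeposE.
  by rewrite !funenegE.
apply: eq_integral => u _; rewrite /g patchE indicE/=.
by case: (_ \in _); rewrite ?mulr1 ?mulr0.
Qed.

(** Tonelli's theorem. The bound on the expectations is expressed with extended integrals, so that
    integrability of the time integral is part of the conclusion. *)
Lemma tint_expectation_le (f : R -> T -> R) (kappa : R -> R) s t :
  jointly_measurable f -> (forall u w, 0 <= f u w) ->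
  (forall w, leb.-integrable `[s, t] (EFin \o (f ^~ w))) ->
  leb.-integrable `[s, t] (EFin \o kappa) ->
  (forall u, s <= u <= t -> (\int[P]_w (f u w)%:E <= (kappa u)%:E)%E) ->
  intg (fun w => tint (f ^~ w) s t) /\
  \int[P]_w tint (f ^~ w) s t <= tint kappa s t.
Proof.
move=> mf f0 fi ki fk.
pose g (p : measurableTypeR R * T) : \bar R := (f p.1 p.2 * \1_(`[s, t]) p.1)%:E.
have mg : measurable_fun setT g.
  apply/measurable_EFinP; apply: measurable_funM; first exact: mf.
  apply: measurableT_comp; last exact: measurable_fst.
  exact: measurable_indic.
have g0 p : (0 <= g p)%E by rewrite lee_fin mulr_ge0.
have tE w : (tint (f ^~ w) s t)%:E = (\int[leb]_u g (u, w))%E.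
  rewrite /tint /Rintegral fineK; last exact: (integrable_fin_num _ (fi w)).
  rewrite integral_mkcond; apply: eq_integral => u _.
  by rewrite /g patchE indicE/=; case: (_ \in _); rewrite ?mulr1 ?mulr0.
have mt := @measurable_tint f s t mf.
have t0 w : 0 <= tint (f ^~ w) s t by apply: Rintegral_ge0 => u _.
have H : (\int[P]_w (tint (f ^~ w) s t)%:E <= (tint kappa s t)%:E)%E.
  under eq_integral do rewrite tE.
  have E : (\int[leb]_u \int[P]_w g (u, w) = \int[P]_w \int[leb]_u g (u, w))%E.
    exact: fubini_tonelli.
  rewrite -E.
  rewrite /tint /Rintegral fineK; last exact: (integrable_fin_num _ ki).
  rewrite [leRHS]integral_mkcond; apply: ge0_le_integral => //.
  - by move=> u _; exact: integral_ge0.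
  - exact: (measurable_fun_fubini_tonelli_F _ mg g0).
  - by apply/(measurable_restrictT _ _).1 => //; exact: measurable_int ki.
  move=> u _; rewrite patchE; case: ifPn.
    rewrite inE/= => su; apply: le_trans (fk _ su).
    have mfu := joint_section u mf.
    apply: ge0_le_integral => //.
    + rewrite /g/=; apply/measurable_EFinP; apply: measurable_funM => //.
    + exact/measurable_EFinP.
    by move=> w _; rewrite lee_fin ler_piMr// indicE lern1; case: (_ \in _).
  move=> su; rewrite (eq_integral (fun=> 0%E)) ?integral0// => w _.
  by rewrite /g/= indicE (negbTE su) mulr0.
split.
  apply/integrableP; split; first exact/measurable_EFinP.
  under eq_integral do rewrite /= ger0_norm//.
  by apply: le_lt_trans H _; rewrite ltry.
rewrite -lee_fin {1}/Rintegral fineK//.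
rewrite ge0_fin_numE; last by apply: integral_ge0 => w _; rewrite lee_fin.
by apply: le_lt_trans H _; rewrite ltry.
Qed.

End joint_measurability.

Lemma cvg_integral_nondecreasing d (T : measurableType d) (R : realType)
    (mu : {measure set T -> \bar R}) (g : nat -> T -> R) (f : T -> R) :
  (forall n, measurable_fun setT (g n)) -> (forall n x, 0 <= g n x) ->
  (forall x, {homo g ^~ x : m n / (m <= n)%N >-> m <= n}) ->
  (forall x, g n x @[n --> \oo] --> f x) ->
  (\int[mu]_x (g n x)%:E)%E @[n --> \oo] --> (\int[mu]_x (f x)%:E)%E.
Proof.
move=> mg g0 ndg cg.
have h1 n : measurable_fun setT (EFin \o g n) by exact/measurable_EFinP.
have h2 n x : setT x -> (0 <= (EFin \o g n) x)%E by rewrite lee_fin.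
have h3 x : setT x -> nondecreasing_seq ((fun n => EFin \o g n) ^~ x).
  by move=> _ m n mn; rewrite lee_fin ndg.
suff -> : (\int[mu]_x (f x)%:E = \int[mu]_x limn (fun n => (g n x)%:E))%E.
  exact: (cvg_monotone_convergence measurableT h1 h2 h3).
apply: eq_integral => x _; apply/esym/cvg_lim => //.
by apply/cvg_EFin; [exact: nearW|exact: cg].
Qed.

(** * Fatou's lemma for limits in probability *)

Section fatou_in_probability.
Context d (T : measurableType d) (R : realType) (P : probability T R).
Local Notation intg f := (P.-integrable setT (EFin \o f)).

(** The integrand is capped at [k]. Outside [E] it is close to [S' ^+ 2], and on [E] the cap costs
    at most k P(E), so no almost surely convergent subsequence is extracted; [k] then tends to
    infinity by monotone convergence. *)
Lemma fatou_in_probability (S : T -> R) (G : set T) (c : R) :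
  measurable_fun setT S -> measurable G ->
  (forall e, 0 < e -> exists S' E, [/\ intg (fun w => S' w ^+ 2), measurable E,
     (P E <= e%:E)%E, (forall w, G w -> ~ E w -> `|S' w - S w| <= e) &
     \int[P]_w S' w ^+ 2 <= c + e]) ->
  (\int[P]_w (S w ^+ 2 * \1_G w)%:E <= c%:E)%E.
Proof.
move=> mS mG H.
have mV : measurable_fun setT (fun w => S w ^+ 2 * \1_G w).
  by apply: measurable_funM; [exact: measurable_funX|exact: measurable_indic].
pose V k w : R := Num.min (S w ^+ 2 * \1_G w) k%:R.
have mVk k : measurable_fun setT (V k) by exact: measurable_minr.
have V0 k w : 0 <= V k w by rewrite le_min mulr_ge0 ?sqr_ge0// ler0n.
have Vk k w : V k w <= k%:R by rewrite ge_min lexx orbT.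
have iV k : intg (V k).
  by apply: (@intg_bounded _ _ _ P _ k%:R) => // w; rewrite ger0_norm.
have c0 : 0 <= c.
  apply/ler_addgt0Pr => e e0; have [S' [E [_ _ _ _]]] := H e e0.
  by apply: le_trans; apply: Rintegral_ge0 => w _; exact: sqr_ge0.
have Vle k : \int[P]_w V k w <= c.
  apply/ler_addgt0Pr => e e0.
  (* For q <= 1, (1 + q)(c + q) + q + q^2 + k q <= c + q M. *)
  pose M := c + 4 + k%:R.
  have M0 : 0 < M by have := ler0n R k; rewrite /M; move: c0; clear; lra.
  pose q := Num.min 1 (e / M).
  have q0 : 0 < q by rewrite lt_min ltr01/= divr_gt0.
  have q1 : q <= 1 by rewrite ge_min lexx.
  have qe : q * M <= e by rewrite -ler_pdivlMr// ge_min lexx orbT.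
  have [S' [E [iS' mE PE SS' ES']]] := H q q0.
  have iE : intg (\1_E : T -> R).
    apply: (@intg_bounded _ _ _ P _ 1); first exact: measurable_indic.
    by move=> w; rewrite indicE normr_nat lern1; case: (_ \in _).
  have i1 := rintegrableZl measurableT (1 + q) iS'.
  have i2 : intg (fun=> q + q ^+ 2) by exact: finite_measure_integrable_cst.
  have i3 := rintegrableZl measurableT k%:R iE.
  have i12 := rintegrableD measurableT i1 i2.
  have i123 := rintegrableD measurableT i12 i3.
  have : \int[P]_w V k w <= \int[P]_w ((1 + q) * S' w ^+ 2 + (q + q ^+ 2) + k%:R * \1_E w).
    apply: le_Rintegral => // w _; have sq := sqr_ge0 (S' w).
    have [Ew|nEw] := pselect (E w).
      rewrite indicE mem_set// mulr1 (le_trans (Vk k w))// lerDr.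
      have := sqr_ge0 q; have : 0 <= (1 + q) * S' w ^+ 2 by rewrite mulr_ge0// addr_ge0// ltW.
      by move: q0; clear; lra.
    rewrite indicE memNset// mulr0 addr0.
    rewrite (@le_trans _ _ (S w ^+ 2 * \1_G w)) ?ge_min ?lexx//.
    have [Gw|nGw] := pselect (G w); last first.
      rewrite indicE memNset// mulr0.
      have := sqr_ge0 q; have : 0 <= (1 + q) * S' w ^+ 2 by rewrite mulr_ge0// addr_ge0// ltW.
      by move: q0; clear; lra.
    rewrite indicE mem_set// mulr1.
    have := SS' w Gw nEw; rewrite ler_norml => /andP[h1 h2].
    set x := S' w in h1 h2 *; set y := S w in h1 h2 *.
    have D : (x - y) ^+ 2 <= q ^+ 2.
      by rewrite -real_normK ?num_real// lerXn2r ?nnegrE ?(ltW q0)// ler_norml h1.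
    (* Completing a square bounds the cross term; with |x - y| <= q this gives y^2 <= (1 + q) x^2 +
       q + q^2. *)
    have qx : 0 <= q * x ^+ 2 + 2 * x * (x - y) + (x - y) ^+ 2 / q.
      rewrite [leRHS](_ : _ = q * (x + (x - y) / q) ^+ 2).
        by rewrite mulr_ge0 ?sqr_ge0// ltW.
      by field; rewrite gt_eqF.
    have D2 : (x - y) ^+ 2 / q <= q.
      by rewrite ler_pdivrMr// -expr2.
    move: D D2 qx; set D' := _ / q; rewrite !expr2; clear; lra.
  move=> /le_trans; apply.
  rewrite RintegralD// RintegralD// RintegralZl// Rintegral_probability_cst RintegralZl//.
  have -> : \int[P]_w \1_E w = fine (P E).
    by rewrite /Rintegral integral_indic// setIT.
  have PE' : fine (P E) <= q.
    by rewrite -lee_fin fineK ?fin_num_measure.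
  have h1 : (1 + q) * \int[P]_w S' w ^+ 2 <= (1 + q) * (c + q).
    by rewrite ler_wpM2l// addr_ge0// ltW.
  have h2 : k%:R * fine (P E) <= k%:R * q by rewrite ler_wpM2l.
  have qq : q ^+ 2 <= q by rewrite expr2 ler_piMr// ltW.
  move: h1 h2 qe qq c0 q0; rewrite /M; clear; nra.
have cvgV : (\int[P]_w (V k w)%:E)%E @[k --> \oo] -->
    (\int[P]_w (S w ^+ 2 * \1_G w)%:E)%E.
  apply: cvg_integral_nondecreasing => //.
  - move=> w k l kl; rewrite /V le_min ge_min lexx/= ge_min.
    by rewrite ler_nat kl orbT.
  move=> w; apply: cvg_near_cst.
  near=> k; rewrite /V min_l//.
  near: k; exact: nbhs_infty_ger.
apply: (cvge_to_le cvgV); apply: nearW => k.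
by rewrite -[leLHS]fineK ?lee_fin ?Vle//; exact: integrable_fin_num (iV k).
Unshelve. all: by end_near. Qed.

End fatou_in_probability.

(** * The Ito isometry *)

(** If the whole sum exceeds [N], its last term is switched off and the sum is one term shorter;
    otherwise dropping terms only decreases it. *)
Lemma truncated_sum_le (R : realType) (c : nat -> R) N n : 0 <= N -> (forall i, 0 <= c i) ->
  \sum_(i < n) c i * ((\sum_(j < i.+1) c j) <= N)%R%:R <= N.
Proof.
move=> N0 c0; elim: n => [|n ih]; first by rewrite big_ord0.
have [le|gt] := leP (\sum_(j < n.+1) c j) N.
  apply: le_trans le; apply: ler_sum => i _; rewrite ler_piMr// lern1.
  by case: (_ <= _).
by rewrite big_ord_recr/= (lt_geF gt) mulr0 addr0.
Qed.

Section elem_integrable.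
Context {R : realType}.
Notation leb := (@lebesgue_measure R).

Lemma eq_tint_oc (f g : R -> R) s t : leb.-integrable `[s, t] (EFin \o f) ->
  leb.-integrable `[s, t] (EFin \o g) ->
  (forall u, s < u <= t -> f u = g u) -> tint f s t = tint g s t.
Proof.
move=> fi gi fg; apply/eqP; rewrite eq_le !le_tint_oc// => u su;
  by rewrite fg.
Qed.

Lemma elem_sqr_integrable n (x a b : nat -> R) s t :
  leb.-integrable `[s, t] (EFin \o (fun u => elem n x a b u ^+ 2)).
Proof.
have [C HC] := @elem_bounded R n x a b.
apply: (@itv_integrable _ _ _ _ (C ^+ 2)).
  by apply: measurable_funX; apply: measurable_funTS; exact: measurable_elem.
by move=> u _; rewrite normrX lerXn2r ?nnegrE//; exact: le_trans (HC 0).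
Qed.

End elem_integrable.

(** * Simple processes with bounded energy *)

Section energy_truncation.
Context d (T : measurableType d) (R : realType) (P : probability T R).
Variables (B : R -> {RV P >-> R}) (X0 : {RV P >-> R}).
Notation leb := (@lebesgue_measure R).
Hypothesis P_complete : measure_is_complete P.
Local Notation ameas := (ameas B X0).
Variables (phi : simple_process (augmented_filtration P X0 (fun t => B t))).
Variables (s t N : R).
Hypotheses (s0 : 0 <= s) (st : s <= t) (N0 : 0 <= N).

Let tm := sp_time phi.
Let n := sp_size phi.

(** Interval [i] clamped to [s, t]; it collapses to a point when it lies outside. *)
Definition spl i : R := Num.max s (Num.min (tm i) t).
Definition spr i : R := Num.max s (Num.min (tm i.+1) t).
Let cost i w : R := sp_val phi i w ^+ 2 * (Num.min (tm i.+1) t - Num.min (tm i) t).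
Let energy i w := \sum_(j < i.+1) cost j w.
(* Coefficient [i] is switched off once the energy spent up to the end of its
   interval exceeds [N]; this is known at time [tm i], since the energy is
   computed from [sp_val phi j] with [j <= i] only. *)
Definition spval_trunc i w : R :=
  if tm i <= t then sp_val phi i w * (energy i w <= N)%R%:R else 0.

Let tm0 i : 0 <= tm i. Proof. exact: sp_time_ge0. Qed.
Let tmS i : tm i <= tm i.+1. Proof. exact: (sp_time_nd phi (leqnSn i)). Qed.
Let minS i : Num.min (tm i) t <= Num.min (tm i.+1) t.
Proof. by rewrite le_min !ge_min tmS lexx orbT. Qed.

Let cost0 i w : 0 <= cost i w.
Proof. by rewrite mulr_ge0 ?sqr_ge0// subr_ge0. Qed.

Lemma spl_ge i : s <= spl i. Proof. by rewrite le_max lexx. Qed.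

Lemma spr_le i : spr i <= t. Proof. by rewrite ge_max st ge_min lexx orbT. Qed.

Lemma spl_le_spr i : spl i <= spr i.
Proof. by rewrite ge_max le_max lexx/= le_max minS orbT. Qed.

Lemma spr_le_spl i j : (i < j)%N -> spr i <= spl j.
Proof.
move=> ij; rewrite ge_max le_max lexx/= le_max le_min !ge_min lexx orbT andbT.
by rewrite (sp_time_nd phi ij) !orbT.
Qed.

Lemma ameas_spval i r : tm i <= r -> ameas r (sp_val phi i).
Proof. by move=> ir; apply: ameas_mono ir _; exact: sp_val_meas. Qed.

Let ameas_energy i : ameas (tm i) (energy i).
Proof.
apply: (@ameas_sum _ _ _ _ B X0 (tm i) i.+1 cost) => j ji.
have mv : ameas (tm i) (sp_val phi j) by apply: ameas_spval; exact: sp_time_nd.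
by apply: ameasM; [apply: ameasM|exact: ameas_cst].
Qed.

(** If [tm i <= t], the clamped left endpoint is not earlier than [tm i]. Otherwise it is, and the
    value 0 prescribed in that case keeps the coefficient adapted. *)
Lemma ameas_spval_trunc i : ameas (spl i) (spval_trunc i).
Proof.
rewrite /spval_trunc; case: leP => it; last exact: ameas_cst.
have il : tm i <= spl i by rewrite le_max le_min lexx it orbT.
apply: ameas_mono il _; apply: ameasM; first exact: ameas_spval.
apply/ameasP; have /ameasP mE := @ameas_energy i.
have mle := @measurable_fun_ler _ (g_sigma_algebraType (aug_gen B X0 (tm i))) R setT
   _ _ mE (@measurable_cst _ _ _ _ setT N).
exact: (@measurableT_comp _ _ _ _ _ _ (fun b : bool => b%:R : R) _ _ _ mle).
Qed.

Lemma spval_trunc_bounded : exists C : nat -> R, forall i w, `|spval_trunc i w| <= C i.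
Proof.
have [C HC] := choice (sp_val_bounded phi).
exists C => i w; apply: le_trans (HC i w).
rewrite /spval_trunc; case: ifP => _; last by rewrite normr0.
by rewrite normrM ler_piMr// normr_nat lern1; case: (_ <= _).
Qed.

(** Clamping at [s] only shortens the intervals, so the energy on [s, t] is at most the cost counted
    from time 0, which the truncation monitors. *)
Lemma spval_trunc_energy w :
  tint (fun u => elem n (spval_trunc ^~ w) spl spr u ^+ 2) s t <= N.
Proof.
rewrite tint_elem_disjoint; [|exact: spl_ge|exact: spr_le|exact: spl_le_spr|exact: spr_le_spl].
apply: le_trans (@truncated_sum_le R (cost ^~ w) N n N0 (cost0 ^~ w)).
apply: ler_sum => i _; rewrite /spval_trunc.
have e01 : 0 <= (energy i w <= N)%R%:R * cost i w by rewrite mulr_ge0.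
case: ifP => _; last by rewrite expr0n mul0r mulrC.
rewrite exprMn (_ : _%:R ^+ 2 = (energy i w <= N)%R%:R); last by case: (_ <= _); rewrite ?expr1n ?expr0n.
rewrite mulrAC ler_wpM2r// /cost ler_wpM2l ?sqr_ge0// /spl /spr.
have := minS i; move: (Num.min _ _) (Num.min _ _) => x y xy.
by case: (leP s x) => sx; case: (leP s y) => sy; lra.
Qed.

Let indicE_clamp i u : s < u <= t ->
  \1_(`]tm i, tm i.+1]) u = \1_(`]spl i, spr i]) u :> R.
Proof.
move=> /andP[su ut]; rewrite !indicE; congr (_%:R); congr nat_of_bool.
rewrite !mem_setE !in_itv/= /spl /spr gt_max su/= gt_min le_max le_min ut andbT.
by rewrite (leNgt u s) su/= [t < u]ltNge ut orbF.
Qed.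

Lemma sp_funE w u : s < u <= t ->
  sp_fun phi u w = elem n (sp_val phi ^~ w) spl spr u.
Proof. by move=> sut; apply: eq_bigr => i _; rewrite (indicE_clamp _ sut). Qed.

Lemma sp_integralE w : sp_integral phi (fun r => B r) t w - sp_integral phi (fun r => B r) s w =
  \sum_(i < n) sp_val phi i w * (B (spr i) w - B (spl i) w).
Proof.
rewrite -sumrB; apply: eq_bigr => i _; rewrite -mulrBr; congr (_ * _).
have H x : B (Num.min x t) w - B (Num.min x s) w = B (Num.max s (Num.min x t)) w - B s w.
  case: (leP x s) => xs.
    by rewrite (min_l (le_trans xs st)) (max_l xs) !subrr.
  by rewrite max_r ?le_min ?(ltW xs) ?st//.
by have := H (tm i.+1); have := H (tm i); rewrite /spl /spr; lra.
Qed.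

(* When the energy on [0, t] stays below [N] the truncation is inactive; the
   terms with [t < tm i] vanish since then [spl i = spr i]. *)
Lemma spval_trunc_inactive w (f : R -> R) : (tint (fun u => sp_fun phi u w ^+ 2) 0 t <= N) ->
  (forall u, elem n (spval_trunc ^~ w) spl spr u = elem n (sp_val phi ^~ w) spl spr u) /\
  \sum_(i < n) spval_trunc i w * (f (spr i) - f (spl i)) =
  \sum_(i < n) sp_val phi i w * (f (spr i) - f (spl i)).
Proof.
move=> EN.
have H i : (i < n)%N -> tm i <= t -> spval_trunc i w = sp_val phi i w.
  move=> ni it; rewrite /spval_trunc it.
  suff -> : energy i w <= N by rewrite mulr1.
  apply: le_trans EN.
  pose l i : R := Num.min (tm i) t; pose r i : R := Num.min (tm i.+1) t.
  have t0 : 0 <= t := le_trans s0 st.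
  have -> : tint (fun u => sp_fun phi u w ^+ 2) 0 t = \sum_(i < n) cost i w.
    rewrite -(@tint_elem_disjoint _ n (sp_val phi ^~ w) l r 0 t).
    - apply: eq_tint_oc; first exact: (@elem_sqr_integrable _ n (sp_val phi ^~ w) tm (fun i => tm i.+1)).
        exact: elem_sqr_integrable.
      move=> u /andP[u0 ut].
      congr (_ ^+ 2); apply: eq_bigr => k _; congr (_ * _).
      rewrite !indicE; congr (_%:R); congr nat_of_bool.
      rewrite !mem_setE !in_itv/= /l /r gt_min le_min ut andbT.
      by rewrite [t < u]ltNge ut orbF.
    - by move=> k; rewrite le_min tm0 t0.
    - by move=> k; rewrite ge_min lexx orbT.
    - exact: minS.
    - move=> k j kj; rewrite le_min !ge_min lexx orbT andbT.
      by rewrite (sp_time_nd phi kj).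
  rewrite /energy -!(big_mkord xpredT (cost ^~ w)).
  rewrite (big_cat_nat (n := i.+1) (p := n))//= lerDl.
  by apply: sumr_ge0.
have H' i : ~~ (tm i <= t) -> spl i = spr i.
  rewrite -ltNge => /ltW ti; rewrite /spl /spr !min_r//.
  exact: le_trans (tmS i).
split.
  move=> u; apply: eq_bigr => i _.
  have [it|it] := boolP (tm i <= t); first by rewrite H.
  by rewrite (H' _ it) set_itv_ge ?bnd_simp ?ltxx// indic0 !mulr0.
apply: eq_bigr => i _.
have [it|it] := boolP (tm i <= t); first by rewrite H.
by rewrite (H' _ it) subrr !mulr0.
Qed.

End energy_truncation.

Section sqr_ineq.
Context {R : realType}.
Implicit Types x y z : R.

Lemma sqrB_le x y : (x - y) ^+ 2 <= 2 * x ^+ 2 + 2 * y ^+ 2.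
Proof. by have := sqr_ge0 (x + y); nra. Qed.

Lemma sqr_le_sqrB x y : x ^+ 2 <= 2 * (x - y) ^+ 2 + 2 * y ^+ 2.
Proof. by have := sqr_ge0 (x - 2 * y); nra. Qed.

Lemma sqrB_le_trans x y z : (x - z) ^+ 2 <= 2 * (x - y) ^+ 2 + 2 * (y - z) ^+ 2.
Proof. by have := sqr_ge0 (x - y - (y - z)); nra. Qed.

End sqr_ineq.

Section tint_linear.
Context {R : realType}.
Notation leb := (@lebesgue_measure R).
Implicit Types f g : R -> R.

Lemma tintegrableD s t f g : leb.-integrable `[s, t] (EFin \o f) ->
  leb.-integrable `[s, t] (EFin \o g) ->
  leb.-integrable `[s, t] (EFin \o (fun u => f u + g u)).
Proof. exact: rintegrableD. Qed.

Lemma tintegrableZl s t c f : leb.-integrable `[s, t] (EFin \o f) ->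
  leb.-integrable `[s, t] (EFin \o (fun u => c * f u)).
Proof. exact: rintegrableZl. Qed.

Lemma tintD s t f g : leb.-integrable `[s, t] (EFin \o f) ->
  leb.-integrable `[s, t] (EFin \o g) ->
  tint (fun u => f u + g u) s t = tint f s t + tint g s t.
Proof. exact: RintegralD. Qed.

Lemma tintZl s t c f : leb.-integrable `[s, t] (EFin \o f) ->
  tint (fun u => c * f u) s t = c * tint f s t.
Proof. exact: RintegralZl. Qed.

End tint_linear.

Lemma measurable_set_ge d (T : measurableType d) (R : realType) (f : T -> R) c :
  measurable_fun setT f -> measurable [set w | c <= f w].
Proof.
move=> mf; rewrite (_ : [set _ | _] = setT `&` f @^-1` `[c, +oo[); last first.
  by rewrite setTI; apply/seteqP; split => w /=; rewrite in_itv/= andbT.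
exact: mf.
Qed.

Lemma measurable_set_le d (T : measurableType d) (R : realType) (f : T -> R) c :
  measurable_fun setT f -> measurable [set w | f w <= c].
Proof.
move=> mf; rewrite (_ : [set _ | _] = setT `&` f @^-1` `]-oo, c]); last first.
  by rewrite setTI; apply/seteqP; split => w /=; rewrite in_itv/=.
exact: mf.
Qed.

Lemma ereal_cvg0_le (R : realType) (x : nat -> \bar R) (q : R) :
  x n @[n --> \oo] --> 0%E -> 0 < q -> \forall n \near \oo, (x n <= q%:E)%E.
Proof.
move=> /fine_cvgP[xf xc] q0.
have xq := cvgr_le _ xc _ q0; near=> n.
rewrite -[leLHS]fineK ?lee_fin; last by near: n; exact: xf.
by near: n; exact: xq.
Unshelve. all: by end_near.
Qed.

Section indicator_expectation.
Context d (T : measurableType d) (R : realType) (P : probability T R).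
Local Notation intg f := (P.-integrable setT (EFin \o f)).

Lemma intg_indic (A : set T) : measurable A -> intg (\1_A : T -> R).
Proof.
move=> mA; apply: (@intg_bounded _ _ _ P _ 1); first exact: measurable_indic.
by move=> w; rewrite indicE normr_nat lern1; case: (_ \in _).
Qed.

Lemma Rintegral_indic (A : set T) : measurable A -> \int[P]_w (\1_A w : R) = fine (P A).
Proof. by move=> mA; rewrite /Rintegral integral_indic// setIT. Qed.

End indicator_expectation.

Section ito_bound.
Context d (T : measurableType d) (R : realType) (P : probability T R).
Variables (B : R -> {RV P >-> R}) (X0 : {RV P >-> R}).
Notation leb := (@lebesgue_measure R).
Hypothesis P_complete : measure_is_complete P.
Hypothesis B_bm : brownian_motion B.
Hypothesis B_X0_indep :
  independent_systems P (sigma_of X0) (sigma_path (fun t => B t)).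
Local Notation intg f := (P.-integrable setT (EFin \o f)).
Local Notation ameas := (ameas B X0).
Variables (H I : R -> T -> R).
Variable phi : nat -> simple_process (augmented_filtration P X0 (fun t => B t)).
Hypotheses (Hj : jointly_measurable H) (Hc : forall w, continuous (H ^~ w)).
Hypothesis mI : forall t, 0 <= t -> measurable_fun setT (I t).
Hypothesis phiH : forall t e : R, 0 <= t -> 0 < e ->
  P [set w | e <= tint (fun u => (sp_fun (phi n) u w - H u w) ^+ 2) 0 t]
    @[n --> \oo] --> 0%E.
Hypothesis phiI : forall t e : R, 0 <= t -> 0 < e ->
  P [set w | e <= `|sp_integral (phi n) (fun r => B r) t w - I t w|]
    @[n --> \oo] --> 0%E.

Lemma sp_val_measurable n i : measurable_fun setT (sp_val (phi n) i).
Proof.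
by apply: (@ameas_measurable _ _ _ _ B X0 P_complete (sp_time (phi n) i)); exact: sp_val_meas.
Qed.

Lemma sp_fun_joint n : jointly_measurable (sp_fun (phi n)).
Proof.
rewrite /jointly_measurable /sp_fun; elim: (sp_size _) => [|m ih].
  by under eq_fun do rewrite big_ord0; exact: measurable_cst.
under eq_fun do rewrite big_ord_recr/=.
apply: measurable_funD => //; apply: measurable_funM.
  by apply: measurableT_comp; [exact: sp_val_measurable|exact: measurable_snd].
by apply: measurableT_comp; [exact: measurable_indic|exact: measurable_fst].
Qed.

Lemma sp_integral_measurable n t : measurable_fun setT (sp_integral (phi n) (fun r => B r) t).
Proof.
rewrite /sp_integral; elim: (sp_size _) => [|m ih].
  by under eq_fun do rewrite big_ord0; exact: measurable_cst.
under eq_fun do rewrite big_ord_recr/=.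
apply: measurable_funD => //; apply: measurable_funM; first exact: sp_val_measurable.
exact: measurable_funB.
Qed.

Lemma path_sqr_integrable s t w : leb.-integrable `[s, t] (EFin \o (fun u => H u w ^+ 2)).
Proof.
apply: continuous_compact_integrable; first exact: segment_compact.
by apply: continuous_subspaceT => u; apply: cvgM; exact: Hc.
Qed.

Lemma path_diff_integrable s t w c :
  leb.-integrable `[s, t] (EFin \o (fun u => (H u w - c) ^+ 2)).
Proof.
apply: continuous_compact_integrable; first exact: segment_compact.
apply: continuous_subspaceT => u; apply: cvgM; apply: cvgB;
  by [exact: Hc|exact: cvg_cst].
Qed.

Lemma sp_diff_integrable s t w n :
  leb.-integrable `[s, t] (EFin \o (fun u => (sp_fun (phi n) u w - H u w) ^+ 2)).
Proof.
have i1 : leb.-integrable `[s, t] (EFin \o (fun u => sp_fun (phi n) u w ^+ 2)).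
  exact: (@elem_sqr_integrable _ (sp_size (phi n)) (sp_val (phi n) ^~ w)
    (sp_time (phi n)) (fun i => sp_time (phi n) i.+1)).
have i2 := tintegrableD (tintegrableZl 2 i1)
  (tintegrableZl 2 (@path_sqr_integrable s t w)).
apply: (@rintegrable_le _ _ _ leb `[s, t] _ _ _ _ _ i2) => //.
  apply: measurable_funX; apply: measurable_funB.
    by apply: measurable_funTS; apply: joint_path; exact: sp_fun_joint.
  by apply: measurable_funTS; exact: joint_path.
by move=> u _; rewrite ger0_norm ?sqr_ge0// sqrB_le.
Qed.

Variables (s t N : R) (Z Y : T -> R) (CZ CY : R).
Hypotheses (s0 : 0 <= s) (st : s <= t) (N0 : 0 <= N).
Hypotheses (mZ : ameas s Z) (mY : ameas s Y).
Hypotheses (ZC : forall w, `|Z w| <= CZ) (YC : forall w, `|Y w| <= CY).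

Let A w := tint (fun u => H u w ^+ 2) 0 t.
Let V w := tint (fun u => (H u w - Z w) ^+ 2) s t.
Let G := [set w | A w <= N].
(** Bounds the energy of (truncated process - [Z]) for every [w]: [2 * N + 2] is the truncation
    level used below, and [CZ ^+ 2 * (t - s)] accounts for [Z]. It also bounds [V] on [G]. *)
Let L := 2 * (2 * N + 2) + 2 * CZ ^+ 2 * (t - s).
Let t0 : 0 <= t. Proof. exact: le_trans s0 st. Qed.

Let mA : measurable_fun setT A.
Proof.
apply: (@measurable_tint _ _ _ (fun u w => H u w ^+ 2)).
exact: measurable_funX.
Qed.

Let mG : measurable G. Proof. exact: measurable_set_le. Qed.

Let mV : measurable_fun setT V.
Proof.
apply: (@measurable_tint _ _ _ (fun u w => (H u w - Z w) ^+ 2)).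
apply: measurable_funX; apply: measurable_funB; first exact: Hj.
apply: measurableT_comp; last exact: measurable_snd.
exact: (ameas_measurable P_complete mZ).
Qed.

Let V0 w : 0 <= V w.
Proof. by apply: Rintegral_ge0 => u _; exact: sqr_ge0. Qed.

Let Z2 w : Z w ^+ 2 <= CZ ^+ 2.
Proof.
rewrite -real_normK ?num_real// lerXn2r ?nnegrE//.
exact: le_trans (ZC w).
Qed.

Let tint_sub (f : R -> R) : (forall u, 0 <= f u) ->
  leb.-integrable `[0, t] (EFin \o f) -> tint f s t <= tint f 0 t.
Proof.
move=> f0 fi; rewrite (@tint_split _ f 0 s t)// lerDr.
by apply: Rintegral_ge0 => u _.
Qed.

Let cst_integrable c : leb.-integrable `[s, t] (EFin \o (fun=> c)).
Proof. by apply: (@itv_integrable _ _ _ _ `|c|). Qed.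

Let VG w : G w -> V w <= L.
Proof.
move=> Gw.
have i1 := tintegrableD (tintegrableZl 2 (@path_sqr_integrable s t w))
  (@cst_integrable (2 * Z w ^+ 2)).
have : V w <= 2 * A w + 2 * Z w ^+ 2 * (t - s).
  apply: le_trans (le_tint (@path_diff_integrable s t w (Z w)) i1 _) _.
    by move=> u _; exact: sqrB_le.
  rewrite tintD//; last exact: tintegrableZl (@path_sqr_integrable s t w).
  rewrite tintZl//; last exact: path_sqr_integrable.
  rewrite tint_cst//.
  rewrite lerD2r ler_wpM2l//; apply: tint_sub; last exact: path_sqr_integrable.
  by move=> u; exact: sqr_ge0.
move=> /le_trans; apply; rewrite /L.
have : Z w ^+ 2 * (t - s) <= CZ ^+ 2 * (t - s) by rewrite ler_wpM2r ?subr_ge0.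
have := N0; move: Gw; rewrite /G/= -!mulrA; lra.
Qed.

Let L0 : 0 <= L.
Proof.
have h : 0 <= CZ ^+ 2 * (t - s) by rewrite mulr_ge0 ?sqr_ge0 ?subr_ge0.
by rewrite /L -[X in _ + X]mulrA; have := N0; lra.
Qed.

Let iVG : intg (fun w => V w * \1_G w).
Proof.
apply: (@intg_bounded _ _ _ P _ L).
  by apply: measurable_funM => //; exact: measurable_indic.
move=> w; rewrite ger0_norm ?mulr_ge0//.
have [Gw|nGw] := pselect (G w); last by rewrite indicE memNset// mulr0.
by rewrite indicE mem_set// mulr1 VG.
Qed.

(** [S'] is the elementary integral of the truncated process minus [Z] on ]s, t], minus [Y], to
    which [elementary_isometry] applies. On [G], when the approximation error is below [e], the
    truncation is inactive and the energy is at most [2 * e + 2 * V]; elsewhere it is at most [L],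
    and the two exceptional probabilities appear. *)
Lemma ito_bound_approx n e : 0 < e <= 1 ->
  exists S' : T -> R, [/\ intg (fun w => S' w ^+ 2),
   (forall w, G w -> tint (fun u => (sp_fun (phi n) u w - H u w) ^+ 2) 0 t < e ->
     S' w = sp_integral (phi n) (fun r => B r) t w - sp_integral (phi n) (fun r => B r) s w
       - Z w * (B t w - B s w) - Y w) &
   \int[P]_w S' w ^+ 2 <= \int[P]_w Y w ^+ 2 + 2 * e + 2 * (\int[P]_w (V w * \1_G w))
     + L * fine (P (~` G)) + L * fine (P [set w | e <= tint (fun u => (sp_fun (phi n) u w - H u w) ^+ 2) 0 t])].
Proof.
move=> /andP[e0 e1].
set E1 := [set w | e <= _].
(* On [G] with error below [e <= 1], the energy of the simple process is at most twice the error
   plus twice that of [H], hence at most 2 + 2 N. *)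
pose N' := 2 * N + 2.
have N'0 : 0 <= N' by rewrite /N'; have := N0; lra.
pose m := sp_size (phi n).
(* Index [m] carries the additional coefficient [- Z] on ]s, t]. *)
pose xi i w := if (i < m)%N then spval_trunc (phi n) t N' i w else - Z w.
pose a i := if (i < m)%N then spl (phi n) s t i else s.
pose b i := if (i < m)%N then spr (phi n) s t i else t.
have [C0 HC0] := @spval_trunc_bounded _ _ _ P B X0 (phi n) t N'.
pose C i := if (i < m)%N then C0 i else CZ.
have sa i : s <= a i by rewrite /a; case: ifP => // _; exact: spl_ge.
have ab i : a i <= b i by rewrite /a /b; case: ifP => // _; exact: spl_le_spr.
have bt i : b i <= t by rewrite /b; case: ifP => // _; exact: spr_le.
have mxi i : ameas (a i) (xi i).
  rewrite /a /xi; case: ifP => _; first exact: ameas_spval_trunc.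
  by apply: (@ameas_comp _ _ _ _ B X0 s Z -%R).
have xiC i w : `|xi i w| <= C i.
  by rewrite /xi /C; case: ifP => _; [exact: HC0|rewrite normrN].
have [iS iW ES] := elementary_isometry P_complete B_bm B_X0_indep m.+1 s0 sa ab bt mxi xiC mY YC.
have elemE w u : elem m.+1 (xi ^~ w) a b u =
    elem m (spval_trunc (phi n) t N' ^~ w) (spl (phi n) s t) (spr (phi n) s t) u
    - Z w * \1_(`]s, t]) u.
  rewrite /elem big_ord_recr/= /xi /a /b ltnn mulNr; congr (_ - _).
  by apply: eq_bigr => i _; rewrite ltn_ord.
have sumE w : \sum_(i < m.+1) xi i w * (B (b i) w - B (a i) w) =
    \sum_(i < m) spval_trunc (phi n) t N' i w * (B (spr (phi n) s t i) w - B (spl (phi n) s t i) w)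
    - Z w * (B t w - B s w).
  rewrite big_ord_recr/= /xi /a /b ltnn mulNr; congr (_ - _).
  by apply: eq_bigr => i _; rewrite ltn_ord.
have inactive w : G w -> ~ E1 w -> tint (fun u => sp_fun (phi n) u w ^+ 2) 0 t <= N'.
  move=> Gw /negP; rewrite -ltNge => E1w.
  have i1 := tintegrableD
    (tintegrableZl 2 (@sp_diff_integrable 0 t w n))
    (tintegrableZl 2 (@path_sqr_integrable 0 t w)).
  apply: le_trans (le_tint _ i1 _) _.
  - exact: (@elem_sqr_integrable _ (sp_size (phi n)) (sp_val (phi n) ^~ w)
      (sp_time (phi n)) (fun i => sp_time (phi n) i.+1)).
  - by move=> u _; exact: sqr_le_sqrB.
  rewrite tintD//; [|exact: tintegrableZl (@sp_diff_integrable 0 t w n)|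
    exact: tintegrableZl (@path_sqr_integrable 0 t w)].
  rewrite !tintZl//; [|exact: path_sqr_integrable|exact: sp_diff_integrable].
  move: Gw E1w; rewrite /G /A /N'/=; have := e1; lra.
exists (fun w => (\sum_(i < m.+1) xi i w * (B (b i) w - B (a i) w)) - Y w); split => //.
- move=> w Gw Ew; rewrite sumE; congr (_ - _ - _).
  have nE1 : ~ E1 w by rewrite /E1/=; apply/negP; rewrite -ltNge.
  have [_ ->] := spval_trunc_inactive s0 st (fun r => B r w) (inactive w Gw nE1).
  by rewrite sp_integralE.
rewrite ES -!addrA lerD2l.
have mE1 : measurable E1.
  apply: measurable_set_ge.
  apply: (@measurable_tint _ _ _ (fun u w => (sp_fun (phi n) u w - H u w) ^+ 2)).
  by apply: measurable_funX; apply: measurable_funB; [exact: sp_fun_joint|exact: Hj].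
have iG := intg_indic P (measurableC mG).
have iE1 := intg_indic P mE1.
have i2 : intg (fun=> 2 * e) by exact: finite_measure_integrable_cst.
have i3 := rintegrableZl measurableT 2 iVG.
have i4 := rintegrableZl measurableT L iG.
have i5 := rintegrableZl measurableT L iE1.
have i45 := rintegrableD measurableT i4 i5.
have i345 := rintegrableD measurableT i3 i45.
have i2345 := rintegrableD measurableT i2 i345.
have -> : 2 * e + (2 * (\int[P]_w (V w * \1_G w)) + (L * fine (P (~` G)) + L * fine (P E1))) =
   \int[P]_w (2 * e + (2 * (V w * \1_G w) + (L * \1_(~` G) w + L * \1_E1 w))).
  rewrite RintegralD// Rintegral_probability_cst RintegralD// RintegralD//.
  by rewrite !RintegralZl// !Rintegral_indic//; exact: measurableC.
apply: le_Rintegral => // w _.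
set tr := elem m (spval_trunc (phi n) t N' ^~ w) (spl (phi n) s t) (spr (phi n) s t) in elemE *.
have iel : leb.-integrable `[s, t] (EFin \o (fun u => elem m.+1 (xi ^~ w) a b u ^+ 2)).
  exact: elem_sqr_integrable.
(* On the good event the integrand is compared with [H]; on the complement, of small probability,
   only the bound [L] is used. *)
have [[Gw nE1]|bad] := pselect (G w /\ ~ E1 w).
  rewrite [\1_G w]indicE [\1_(~` G) w]indicE [\1_E1 w]indicE (mem_set Gw) (memNset nE1).
  rewrite memNset; last by move=> /(_ Gw).
  rewrite mulr1 !mulr0 !addr0.
  have [trE _] := spval_trunc_inactive s0 st (fun r => B r w) (inactive w Gw nE1).
  have i6 := tintegrableD
    (tintegrableZl 2 (@sp_diff_integrable s t w n))
    (tintegrableZl 2 (@path_diff_integrable s t w (Z w))).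
  apply: le_trans (le_tint_oc iel i6 _) _.
    move=> u su; rewrite elemE trE -sp_funE// indicE mem_set; last by rewrite /= in_itv.
    by rewrite mulr1; exact: sqrB_le_trans.
  rewrite tintD//; [|exact: tintegrableZl (@sp_diff_integrable s t w n)|
    exact: tintegrableZl (@path_diff_integrable s t w (Z w))].
  rewrite !tintZl//; [|exact: path_diff_integrable|exact: sp_diff_integrable].
  rewrite lerD2r ler_wpM2l//.
  apply: (@le_trans _ _ (tint (fun u => (sp_fun (phi n) u w - H u w) ^+ 2) 0 t)).
    by apply: tint_sub; [move=> u; exact: sqr_ge0|exact: sp_diff_integrable].
  by rewrite ltW// ltNge; apply/negP.
have : tint (fun u => elem m.+1 (xi ^~ w) a b u ^+ 2) s t <= L.
  have i7 := tintegrableD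
    (tintegrableZl 2 (@elem_sqr_integrable R m
      (spval_trunc (phi n) t N' ^~ w) (spl (phi n) s t) (spr (phi n) s t) s t))
    (@cst_integrable (2 * CZ ^+ 2)).
  apply: le_trans (le_tint iel i7 _) _.
    move=> u _; rewrite elemE -/tr.
    have z2 : (Z w * \1_`]s, t] u) ^+ 2 <= CZ ^+ 2.
      have i1 : (\1_`]s, t] u : R) <= 1 by rewrite indicE lern1; case: (_ \in _).
      apply: le_trans (Z2 w); rewrite exprMn; apply: ler_piMr; first exact: sqr_ge0.
      by rewrite expr_le1.
    by apply: (le_trans (sqrB_le _ _)); rewrite lerD2l ler_wpM2l.
  rewrite tintD//; last exact: tintegrableZl (elem_sqr_integrable _ _ _ _ _ _).
  rewrite tintZl//; last exact: elem_sqr_integrable.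
  rewrite tint_cst//.
  rewrite /L lerD2r ler_wpM2l//; exact: spval_trunc_energy.
have i01 (D : set T) : 0 <= \1_D w :> R by [].
have : L <= L * \1_(~` G) w + L * \1_E1 w.
  rewrite -mulrDr ler_peMr//.
  have [Gw|nGw] := pselect (G w).
    have E1w : E1 w by apply: contrapT => nE1; exact: bad.
    by rewrite [\1_E1 w]indicE mem_set// lerDr.
  by rewrite [\1_(~` G) w]indicE mem_set// lerDl.
have : 0 <= 2 * (V w * \1_G w) by rewrite !mulr_ge0.
lra.
Qed.

End ito_bound.

Lemma truncated_bound_arith (R : realFieldType) (x y m N : R) :
  x <= m -> N * y <= m -> 0 <= y <= 1 ->
  2 * x + 2 * (2 * N + 2) * y <= 6 * m + 4.
Proof. by move=> h1 h2 /andP[h3 h4]; nra. Qed.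

Section ito_isometry.
Context d (T : measurableType d) (R : realType) (P : probability T R).
Variables (B : R -> {RV P >-> R}) (X0 : {RV P >-> R}).
Notation leb := (@lebesgue_measure R).
Hypothesis P_complete : measure_is_complete P.
Hypothesis B_bm : brownian_motion B.
Hypothesis B_X0_indep :
  independent_systems P (sigma_of X0) (sigma_path (fun t => B t)).
Local Notation intg f := (P.-integrable setT (EFin \o f)).
Local Notation ameas := (ameas B X0).
Variables (H I : R -> T -> R).
Variable phi : nat -> simple_process (augmented_filtration P X0 (fun t => B t)).
Hypotheses (Hj : jointly_measurable H) (Hc : forall w, continuous (H ^~ w)).
Hypothesis mI : forall t, 0 <= t -> measurable_fun setT (I t).
Hypothesis phiH : forall t e : R, 0 <= t -> 0 < e ->
  P [set w | e <= tint (fun u => (sp_fun (phi n) u w - H u w) ^+ 2) 0 t]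
    @[n --> \oo] --> 0%E.
Hypothesis phiI : forall t e : R, 0 <= t -> 0 < e ->
  P [set w | e <= `|sp_integral (phi n) (fun r => B r) t w - I t w|]
    @[n --> \oo] --> 0%E.


Let ito_bound_approx' := ito_bound_approx P_complete B_bm B_X0_indep phi Hj Hc.

(** The isometry survives as an inequality: the factor 2 comes from passing through [H] in (phi_n -
    Z)^2, and the last term pays for the event where the energy exceeds [N]. The coefficient of the
    second moment of [Y] remains 1. *)
Lemma ito_bound (s t N : R) (Z Y : T -> R) (CZ CY : R) (G : set T) (V : T -> R) :
  0 <= s -> s <= t -> 0 <= N -> ameas s Z -> ameas s Y ->
  (forall w, `|Z w| <= CZ) -> (forall w, `|Y w| <= CY) ->
  G = [set w | tint (fun u => H u w ^+ 2) 0 t <= N] ->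
  V = (fun w => tint (fun u => (H u w - Z w) ^+ 2) s t) ->
  (\int[P]_w ((I t w - I s w - Z w * (B t w - B s w) - Y w) ^+ 2 * \1_G w)%:E <=
   (\int[P]_w Y w ^+ 2 + 2 * (\int[P]_w (V w * \1_G w))
    + (2 * (2 * N + 2) + 2 * CZ ^+ 2 * (t - s)) * fine (P (~` G)))%:E)%E.
Proof.
move=> s0 st N0 mZ mY ZC YC -> -> {G V}; set L := (2 * (2 * N + 2) + _).
set G := [set w | _].
have t0 := le_trans s0 st.
have mZ' := ameas_measurable P_complete mZ.
have mY' := ameas_measurable P_complete mY.
have mA : measurable_fun setT (fun w => tint (fun u => H u w ^+ 2) 0 t).
  apply: (@measurable_tint _ _ _ (fun u w => H u w ^+ 2)).
  exact: measurable_funX.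
apply: fatou_in_probability; [| |move=> e e0].
- apply: measurable_funB => //; apply: measurable_funB.
    by apply: measurable_funB; exact: mI.
  by apply: measurable_funM => //; exact: measurable_funB.
- exact: measurable_set_le.
have L0 : 0 <= L.
  have h : 0 <= CZ ^+ 2 * (t - s) by rewrite mulr_ge0 ?sqr_ge0 ?subr_ge0.
  by rewrite /L -[X in _ + X]mulrA; lra.
pose e1 := Num.min 1 (e / 4).
have e10 : 0 < e1 by rewrite lt_min ltr01/= divr_gt0.
have e11 : e1 <= 1 by rewrite ge_min lexx.
have e14 : e1 <= e / 4 by rewrite ge_min lexx orbT.
(* Three exceptional events of probability at most [q] must add up to at most [e], and [L * q] must
   stay below [e / 2]; the other half is spent on [2 * e1]. *)
pose q := Num.min (e / 3) (e / (2 * (L + 1))).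
have L10 : 0 < 2 * (L + 1) by rewrite mulr_gt0// ltr_wpDl.
have q0 : 0 < q by rewrite lt_min !divr_gt0.
have q3 : q <= e / 3 by rewrite ge_min lexx.
have qL : q * (2 * (L + 1)) <= e by rewrite -ler_pdivlMr// ge_min lexx orbT.
have e2 : 0 < e / 2 by rewrite divr_gt0.
have n1 := ereal_cvg0_le (phiH t0 e10) q0.
have n2 := ereal_cvg0_le (phiI t0 e2) q0.
have n3 := ereal_cvg0_le (phiI s0 e2) q0.
have [n [[P1 P2] P3]] := filter_ex (filterI (filterI n1 n2) n3).
have [|S' [iS SE ES]] := @ito_bound_approx' s t N Z Y CZ CY s0 st N0 mZ mY ZC YC n e1.
  by rewrite e10.
set E1 := [set w | _] in P1 ES; set E2 := [set w | _] in P2; set E3 := [set w | _] in P3.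
have mE1 : measurable E1.
  apply: measurable_set_ge.
  apply: (@measurable_tint _ _ _ (fun u w => (sp_fun (phi n) u w - H u w) ^+ 2)).
  apply: measurable_funX; apply: measurable_funB; last exact: Hj.
  exact: sp_fun_joint.
have mSI r : 0 <= r -> measurable_fun setT (fun w => `|sp_integral (phi n) (fun r => B r) r w - I r w|).
  move=> r0; apply: measurableT_comp => //; apply: measurable_funB; last exact: mI.
  exact: sp_integral_measurable.
have mE2 : measurable E2 by apply: measurable_set_ge; exact: mSI.
have mE3 : measurable E3 by apply: measurable_set_ge; exact: mSI.
exists S', (E1 `|` E2 `|` E3); split => //.
- by apply: measurableU => //; exact: measurableU.
- apply: (@le_trans _ _ (P E1 + P E2 + P E3)%E).
    apply: (le_trans (measureU2 _ _ _)) => //; first exact: measurableU.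
    by rewrite leeD2r// measureU2.
  apply: (@le_trans _ _ (q%:E + q%:E + q%:E)%E); first by apply: leeD => //; exact: leeD.
  by rewrite -!EFinD lee_fin; lra.
- move=> w Gw nE.
  have nE1 : ~ E1 w by move=> h; apply: nE; left; left.
  have nE2 : ~ E2 w by move=> h; apply: nE; left; right.
  have nE3 : ~ E3 w by move=> h; apply: nE; right.
  rewrite SE//; last by rewrite ltNge; apply/negP.
  move: nE2 nE3; rewrite /E2 /E3/= => /negP; rewrite -ltNge => h2 /negP; rewrite -ltNge => h3.
  set x := sp_integral _ _ t w in h2 *; set y := sp_integral _ _ s w in h3 *.
  have -> : x - y - Z w * (B t w - B s w) - Y w - (I t w - I s w - Z w * (B t w - B s w) - Y w)
     = (x - I t w) - (y - I s w) by ring.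
  by apply: (le_trans (ler_normB _ _)); lra.
apply: (le_trans ES).
have : L * fine (P E1) <= e / 2.
  have P1' : fine (P E1) <= q by rewrite -lee_fin fineK// fin_num_measure.
  apply: (@le_trans _ _ (L * q)); first by rewrite ler_wpM2l.
  by have : 0 <= q by [exact: ltW]; lra.
rewrite -/G -/L.
lra.
Qed.

Let A t w := tint (fun u => H u w ^+ 2) 0 t.

Let A0 t w : 0 <= A t w.
Proof. by apply: Rintegral_ge0 => u _; exact: sqr_ge0. Qed.

Let mA t : measurable_fun setT (A t).
Proof.
apply: (@measurable_tint _ _ _ (fun u w => H u w ^+ 2)).
exact: measurable_funX.
Qed.

Let ameas0 s : ameas s (fun=> 0). Proof. exact: ameas_cst. Qed.

(** The cost (4 N + 4) P(A > N) is absorbed by Markov's inequality in the form N 1_{A > N} <= min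
    (A, N), whence 6 = 2 + 4. The right-hand side is finite in advance, as Gronwall's inequality
    requires. *)
Lemma ito_truncated_bound (t N : R) : 0 <= t -> 0 <= N ->
  (\int[P]_w ((I t w - I 0 w) ^+ 2 * \1_[set w | (A t w <= N)%R] w)%:E <=
   (6 * (\int[P]_w Num.min (A t w) N) + 4)%:E)%E.
Proof.
move=> t0 N0.
have n0 (w : T) : `|(0 : R)| <= 0 by rewrite normr0.
have := @ito_bound 0 t N (fun=> 0) (fun=> 0) 0 0 _ _ (lexx 0) t0 N0
  (@ameas0 0) (@ameas0 0) n0 n0 erefl erefl.
under [X in (X <= _)%E -> _]eq_integral do rewrite mul0r !subr0.
move=> /le_trans; apply.
set G := [set w | _].
have mG : measurable G by apply: measurable_set_le; exact: mA.
have mmin : measurable_fun setT (fun w => Num.min (A t w) N) by exact: measurable_minr.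
have imin : intg (fun w => Num.min (A t w) N).
  apply: (@intg_bounded _ _ _ P _ N) => // w.
  by rewrite ger0_norm ?le_min ?A0 ?N0// ge_min lexx orbT.
rewrite lee_fin expr0n/= !mulr0 mul0r addr0 Rintegral_probability_cst add0r.
have h1 : \int[P]_w (tint (fun u => (H u w - 0) ^+ 2) 0 t * \1_G w) <= \int[P]_w Num.min (A t w) N.
  have E w : tint (fun u => (H u w - 0) ^+ 2) 0 t = A t w.
    by apply: eq_Rintegral => u _; rewrite subr0.
  under eq_Rintegral do rewrite E.
  have le w : A t w * \1_G w <= Num.min (A t w) N.
    rewrite indicE; have [Gw|nG] := pselect (G w).
      by rewrite mem_set// mulr1 le_min lexx.
    by rewrite memNset// mulr0 le_min A0.
  apply: le_Rintegral => //.
  apply: (@rintegrable_le _ _ _ P setT measurableT _ _ _ _ imin).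
    by apply: measurable_funM => //; exact: measurable_indic.
  by move=> w _; rewrite ger0_norm ?mulr_ge0.
have h2 : N * fine (P (~` G)) <= \int[P]_w Num.min (A t w) N.
  rewrite -Rintegral_indic; last exact: measurableC.
  have iG := intg_indic P (measurableC mG).
  rewrite -RintegralZl//; apply: le_Rintegral => //.
    exact: rintegrableZl.
  move=> w _; rewrite indicE; have [Gw|nG] := pselect (G w).
    by rewrite memNset ?mulr0 ?le_min ?A0// => /(_ Gw).
  rewrite mem_set// mulr1 le_min lexx andbT ltW// ltNge; exact/negP.
have h3 : 0 <= fine (P (~` G)) <= 1.
  rewrite fine_ge0//= -lee_fin fineK ?fin_num_measure//; last exact: measurableC.
  by apply: probability_le1; exact: measurableC.
exact: truncated_bound_arith h1 h2 h3.
Qed.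

Section square_integrable.
Variables (t : R).
Hypotheses (t0 : 0 <= t) (iA : intg (A t)).

(** With [N = k] tending to infinity the penalty disappears, because k P(A > k) is at most the
    integral of [A] over A > k, a tail of an integrable variable. *)
Lemma ito_L2 (s : R) (Z Y : T -> R) (CZ CY : R) :
  0 <= s -> s <= t -> ameas s Z -> ameas s Y ->
  (forall w, `|Z w| <= CZ) -> (forall w, `|Y w| <= CY) ->
  [/\ intg (fun w => tint (fun u => (H u w - Z w) ^+ 2) s t),
   intg (fun w => (I t w - I s w - Z w * (B t w - B s w) - Y w) ^+ 2) &
   \int[P]_w (I t w - I s w - Z w * (B t w - B s w) - Y w) ^+ 2 <=
   \int[P]_w Y w ^+ 2 + 2 * (\int[P]_w tint (fun u => (H u w - Z w) ^+ 2) s t)].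
Proof.
move=> s0 st mZ mY ZC YC.
pose V w := tint (fun u => (H u w - Z w) ^+ 2) s t.
have mZ' := ameas_measurable P_complete mZ.
have mY' := ameas_measurable P_complete mY.
have V0 w : 0 <= V w by apply: Rintegral_ge0 => u _; exact: sqr_ge0.
have mV : measurable_fun setT V.
  apply: (@measurable_tint _ _ _ (fun u w => (H u w - Z w) ^+ 2)).
  apply: measurable_funX; apply: measurable_funB; first exact: Hj.
  by apply: measurableT_comp => //; exact: measurable_snd.
have iV : intg V.
  have ic : intg (fun=> 2 * CZ ^+ 2 * (t - s)) by exact: finite_measure_integrable_cst.
  apply: rintegrable_le (rintegrableD measurableT (rintegrableZl measurableT 2 iA) ic) => //.
  move=> w _; rewrite (ger0_norm (V0 w)).
  have ci : leb.-integrable `[s, t] (EFin \o (fun=> 2 * Z w ^+ 2)).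
    by apply: (@itv_integrable _ _ _ _ `|2 * Z w ^+ 2|).
  have i1 := tintegrableD (tintegrableZl 2 (path_sqr_integrable Hc s t w)) ci.
  apply: (le_trans (le_tint (path_diff_integrable Hc s t w (Z w)) i1 _)).
    by move=> u _; exact: sqrB_le.
  rewrite tintD//; last exact: tintegrableZl (path_sqr_integrable Hc s t w).
  rewrite tintZl ?tint_cst//; last exact: path_sqr_integrable.
  apply: lerD.
    rewrite ler_wpM2l// /A (@tint_split _ _ 0 s t)//; last exact: path_sqr_integrable.
    by rewrite lerDr; apply: Rintegral_ge0 => u _; exact: sqr_ge0.
  rewrite ler_wpM2r ?subr_ge0// ler_wpM2l// -real_normK ?num_real// lerXn2r ?nnegrE//.
  exact: le_trans (ZC w).
pose F w := (I t w - I s w - Z w * (B t w - B s w) - Y w) ^+ 2.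
have mF : measurable_fun setT F.
  apply: measurable_funX; apply: measurable_funB => //; apply: measurable_funB.
    by apply: measurable_funB; exact: mI.
  by apply: measurable_funM => //; exact: measurable_funB.
pose G (k : nat) := [set w | A t w <= k%:R].
have mG k : measurable (G k) by apply: measurable_set_le; exact: mA.
pose c := 2 * CZ ^+ 2 * (t - s).
have c0 : 0 <= c by rewrite /c mulr_ge0 ?subr_ge0// mulr_ge0 ?sqr_ge0.
have H1 : (\int[P]_w (F w * \1_(G k) w)%:E)%E @[k --> \oo] --> (\int[P]_w (F w)%:E)%E.
  apply: cvg_integral_nondecreasing.
  - by move=> k; apply: measurable_funM => //; exact: measurable_indic.
  - by move=> k w; rewrite mulr_ge0 ?sqr_ge0.
  - move=> w k l kl; rewrite ler_wpM2l ?sqr_ge0// !indicE ler_nat.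
    have [Gk|nGk] := pselect (G k w); last by rewrite memNset.
    by rewrite !mem_set// /G/= (le_trans Gk)// ler_nat.
  move=> w; apply: cvg_near_cst; near=> k.
  rewrite indicE mem_set ?mulr1// /G/=.
  by near: k; exact: nbhs_infty_ger.
have tail : \int[P]_w (A t w * \1_(~` G k) w) @[k --> \oo] --> (0 : R).
  have mAk k : measurable_fun setT (fun w => A t w * \1_(~` G k) w).
    by apply: measurable_funM => //; apply: measurable_indic; exact: measurableC.
  have [||_] := @Rintegral_dct _ _ _ P setT measurableT
     (fun k w => A t w * \1_(~` G k) w) (fun=> 0) (A t) mAk (@measurable_cst _ _ _ _ setT (0 : R)) iA.
  - by move=> k w _; rewrite ger0_norm ?mulr_ge0// ler_piMr// indicE lern1; case: (_ \in _).
  - apply: aeW => w _; apply: cvg_near_cst; near=> k.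
    rewrite indicE memNset ?mulr0// => h; apply: h; rewrite /G/=.
    by near: k; exact: nbhs_infty_ger.
  by rewrite Rintegral_probability_cst.
have iAG k : intg (fun w => A t w * \1_(~` G k) w).
  apply: rintegrable_le iA => //.
    by apply: measurable_funM => //; apply: measurable_indic; exact: measurableC.
  by move=> w _; rewrite ger0_norm ?mulr_ge0// ler_piMr// indicE lern1; case: (_ \in _).
have main : (\int[P]_w (F w)%:E <= (\int[P]_w Y w ^+ 2 + 2 * (\int[P]_w V w))%:E)%E.
  apply/lee_addgt0Pr => e e0; rewrite -EFinD.
  apply: (cvge_to_le H1).
  (* For k >= 1 the penalty factor 4 k + 4 + c is at most (8 + c) k. *)
  have e1 : 0 < e / (8 + c) by rewrite divr_gt0// ltr_wpDr.
  have T1 := cvgr_lt _ tail _ e1.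
  near=> k.
  have k1 : (1 <= k%:R :> R) by near: k; exact: nbhs_infty_ger.
  have tk : \int[P]_w (A t w * \1_(~` G k) w) < e / (8 + c) by near: k; exact: T1.
  apply: (le_trans (@ito_bound s t k%:R Z Y CZ CY (G k) V s0 st (ler0n R k) mZ mY ZC YC erefl erefl)).
  rewrite lee_fin -/(G k) -/c -addrA -addrA lerD2l.
  apply: lerD.
    rewrite ler_wpM2l//; apply: le_Rintegral => //.
      apply: rintegrable_le iV => //.
        by apply: measurable_funM => //; exact: measurable_indic.
      by move=> w _; rewrite ger0_norm ?mulr_ge0 ?V0// ler_piMr ?V0// indicE lern1; case: (_ \in _).
    by move=> w _; rewrite ler_piMr ?V0// indicE lern1; case: (_ \in _).
  have kP : k%:R * fine (P (~` G k)) <= \int[P]_w (A t w * \1_(~` G k) w).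
    rewrite -Rintegral_indic; last exact: measurableC.
    have iG := intg_indic P (measurableC (mG k)).
    rewrite -RintegralZl//; apply: le_Rintegral => //; first exact: rintegrableZl.
    move=> w _; rewrite indicE; have [Gw|nG] := pselect (G k w).
      by rewrite memNset ?mulr0// => /(_ Gw).
    by rewrite mem_set// !mulr1 ltW// ltNge; exact/negP.
  have p0 : 0 <= fine (P (~` G k)) by rewrite fine_ge0.
  have pk : fine (P (~` G k)) <= k%:R * fine (P (~` G k)) by rewrite ler_peMl.
  have := ltW tk; rewrite ler_pdivlMr ?ltr_wpDr// => tk'.
  apply: le_trans tk'.
  rewrite mulrC; have : fine (P (~` G k)) * c <= (\int[P]_w (A t w * \1_(~` G k) w)) * c.
    by rewrite ler_wpM2r// (le_trans pk).
  by move: kP pk; rewrite -/c; set x := \int[P]_w _; set y := fine _; nra.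
have F0 w : 0 <= F w by exact: sqr_ge0.
have iF : intg F.
  apply/integrableP; split; first exact/measurable_EFinP.
  under eq_integral do rewrite /= ger0_norm//.
  by apply: le_lt_trans main _; rewrite ltry.
split => //; rewrite -lee_fin {1}/Rintegral fineK//.
exact: integrable_fin_num iF.
Unshelve. all: by end_near. Qed.

(** Apply [ito_L2] to [c * Y] for every real [c]. The terms in c^2 cancel after expanding the
    square, leaving - 2 c E[Y (I_t - I_s)] <= K for all [c], which forces the expectation to
    vanish. *)
Lemma ito_martingale (s : R) (Y : T -> R) (CY : R) :
  0 <= s -> s <= t -> ameas s Y -> (forall w, `|Y w| <= CY) ->
  intg (fun w => Y w * (I t w - I s w)) /\ \int[P]_w (Y w * (I t w - I s w)) = 0.
Proof.
move=> s0 st mY YC.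
have mY' := ameas_measurable P_complete mY.
pose D w := I t w - I s w.
have mD : measurable_fun setT D by apply: measurable_funB; apply: mI.
have iY2 : intg (fun w => Y w ^+ 2).
  apply: (@intg_bounded _ _ _ P _ (CY ^+ 2)); first exact: measurable_funX.
  move=> w; rewrite normrX lerXn2r ?nnegrE//; exact: le_trans (YC w).
have H1 c : intg (fun w => (D w - c * Y w) ^+ 2) /\
   \int[P]_w (D w - c * Y w) ^+ 2 <= c ^+ 2 * (\int[P]_w Y w ^+ 2)
     + 2 * (\int[P]_w tint (fun u => (H u w - 0) ^+ 2) s t).
  have mcY : ameas s (fun w => c * Y w) by apply: ameasM => //; exact: ameas_cst.
  have cYC w : `|c * Y w| <= `|c| * CY by rewrite normrM ler_wpM2l.
  have n0 (w : T) : `|(0 : R)| <= 0 by rewrite normr0.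
  have [_ i1 h1] := @ito_L2 s (fun=> 0) (fun w => c * Y w) 0 (`|c| * CY) s0 st (@ameas0 s) mcY
    n0 cYC.
  have E : (fun w => (I t w - I s w - 0 * (B t w - B s w) - c * Y w) ^+ 2) =
     (fun w => (D w - c * Y w) ^+ 2).
    by apply/funext => w; rewrite mul0r subr0.
  rewrite E in i1 h1; split => //; apply: (le_trans h1); rewrite lerD2r.
  by under eq_Rintegral do rewrite exprMn; rewrite RintegralZl.
set K := 2 * _ in H1.
have iD2 : intg (fun w => D w ^+ 2).
  by have [+ _] := H1 0; congr (_ _); congr (_ \o _); apply/funext => w; rewrite mul0r subr0.
have iYD : intg (fun w => Y w * D w).
  apply: rintegrable_le (rintegrableD measurableT iY2 iD2) => //; first exact: measurable_funM.
  move=> w _; rewrite normrM.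
  rewrite -[Y w ^+ 2]real_normK ?num_real// -[D w ^+ 2]real_normK ?num_real//.
  have := sqr_ge0 (`|Y w| - `|D w|); have := normr_ge0 (Y w); have := normr_ge0 (D w).
  by move: (`|Y w|) (`|D w|) => x y; nra.
split => //; set x := \int[P]_w _.
have D20 : 0 <= \int[P]_w D w ^+ 2 by apply: Rintegral_ge0 => w _; exact: sqr_ge0.
have lin c : - 2 * c * x <= K.
  have [i1] := H1 c.
  have i2 := rintegrableZl measurableT (- 2 * c) iYD.
  have i3 := rintegrableZl measurableT (c ^+ 2) iY2.
  have i23 := rintegrableD measurableT i2 i3.
  have -> : \int[P]_w (D w - c * Y w) ^+ 2 =
     \int[P]_w (D w ^+ 2 + (- 2 * c * (Y w * D w) + c ^+ 2 * Y w ^+ 2)).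
    by apply: eq_Rintegral => w _; ring.
  rewrite RintegralD// RintegralD// !RintegralZl// -/x.
  by move: D20; set z := \int[P]_w (D w ^+ 2); set y := c ^+ 2 * _; lra.
apply/eqP; apply/negPn/negP => x0.
(* This value of [c] turns the bound into K + 1 <= K. *)
have := lin (- (K + 1) / (2 * x)).
rewrite (_ : - 2 * (- (K + 1) / (2 * x)) * x = K + 1); first lra.
by field.
Qed.

End square_integrable.

End ito_isometry.

(** * Primitives of paths and Gronwall's inequality *)

Section time_integral_bounds.
Context {R : realType}.
Notation leb := (@lebesgue_measure R).
Implicit Types (f : R -> R) (s t : R).

Lemma continuous_itv_integrable f s t : continuous f -> leb.-integrable `[s, t] (EFin \o f).
Proof.
move=> fc; apply: continuous_compact_integrable; first exact: segment_compact.
exact: continuous_subspaceT.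
Qed.

Lemma tint_ge0 f s t : (forall u, s <= u <= t -> 0 <= f u) -> 0 <= tint f s t.
Proof. by move=> f0; apply: Rintegral_ge0 => u /=; rewrite in_itv/=; exact: f0. Qed.

Lemma le_tint_cst f s t c : s <= t -> leb.-integrable `[s, t] (EFin \o f) ->
  (forall u, s <= u <= t -> f u <= c) -> tint f s t <= c * (t - s).
Proof.
move=> st fi fc; rewrite -tint_cst//; apply: le_tint => //.
by apply: (@itv_integrable _ _ _ _ `|c|).
Qed.

(** Cauchy-Schwarz, from the nonnegativity of the integral of (f - m)^2 with [m] the mean of [f]. *)
Lemma tint_sqr_le f s t : s <= t -> leb.-integrable `[s, t] (EFin \o f) ->
  leb.-integrable `[s, t] (EFin \o (fun u => f u ^+ 2)) ->
  tint f s t ^+ 2 <= (t - s) * tint (fun u => f u ^+ 2) s t.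
Proof.
rewrite le_eqVlt => /predU1P[<- _ _|st fi f2i].
  by rewrite subrr mul0r /tint set_itv1 Rintegral_set1 expr0n.
have ts : 0 < t - s by rewrite subr_gt0.
pose m := tint f s t / (t - s).
have ci : leb.-integrable `[s, t] (EFin \o (fun=> m ^+ 2)).
  by apply: (@itv_integrable _ _ _ _ `|m ^+ 2|).
have fmi := tintegrableZl (- 2 * m) fi.
have : 0 <= tint (fun u => f u ^+ 2 + (- 2 * m * f u + m ^+ 2)) s t.
  apply: tint_ge0 => u _.
  by rewrite (_ : _ + _ = (f u - m) ^+ 2) ?sqr_ge0//; ring.
rewrite tintD//; last exact: tintegrableD.
rewrite tintD// tintZl// tint_cst; last exact: ltW.
have mE : m * (t - s) = tint f s t by rewrite /m divfK ?gt_eqF.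
set x := tint f s t in mE *; set y := tint _ s t => H.
have : 0 <= (t - s) * (y + (- 2 * m * x + m ^+ 2 * (t - s))) by rewrite mulr_ge0// ltW.
rewrite -mE (_ : _ * (y + _) = (t - s) * y - (m * (t - s)) ^+ 2); last by ring.
by rewrite subr_ge0.
Qed.

Lemma tint_empty f s t : t < s -> tint f s t = 0.
Proof. by move=> ts; rewrite /tint set_itv_ge ?Rintegral_set0// bnd_simp -ltNge. Qed.

Lemma tint_continuous f : continuous f -> continuous (fun t => tint f 0 t).
Proof.
move=> fc r; apply/cvgrPdist_lt => e e0.
have [d d0 Hd] := continuous_lim_eps (fc r) (@ltr01 R).
pose M := `|f r| + 1.
have M0 : 0 < M by rewrite ltr_wpDl.
have fM u : `|u - r| < d -> `|f u| <= M.
  move=> /Hd /ltW; rewrite /M -lerBlDl; apply: le_trans.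
  exact: lerB_dist.
have H u v : u <= v -> `|u - r| < d -> `|v - r| < d ->
    `|tint f 0 v - tint f 0 u| <= M * (v - u).
  move=> uv ur vr.
  have fuv x : u <= x <= v -> `|f x| <= M.
    move=> /andP[ux xv]; apply: fM; move: ur vr; rewrite !ltr_norml; lra.
  have [u0|u0] := leP 0 u.
    rewrite (@tint_split _ f 0 u v)//; last exact: continuous_itv_integrable.
    rewrite addrC addKr.
    have := @tint_diff_le _ f u v 0 M uv; rewrite mul0r subr0; apply.
      by apply: measurable_funTS; exact: continuous_measurable_fun.
    by move=> x /fuv; rewrite subr0.
  rewrite (tint_empty _ u0) subr0; have [v0|v0] := leP 0 v; last first.
    by rewrite (tint_empty _ v0) normr0 mulr_ge0 ?subr_ge0// ltW.
  have := @tint_diff_le _ f 0 v 0 M v0; rewrite mul0r subr0 => /(_ _ _)/le_trans; apply.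
  - by apply: measurable_funTS; exact: continuous_measurable_fun.
  - by move=> x /andP[x0 xv]; rewrite subr0 fuv// xv (le_trans (ltW u0)).
  by rewrite subr0 ler_wpM2l ?(ltW M0)//; move: u0; clear; lra.
near=> v.
have vd : `|v - r| < d.
  by near: v; exists d => //= v /=; rewrite distrC.
have ve : `|v - r| < e / M.
  by near: v; exists (e / M) => /=; [rewrite divr_gt0|move=> v /=; rewrite distrC].
have rr : `|r - r| < d by rewrite subrr normr0.
rewrite ltr_pdivlMr// in ve.
have [rv|/ltW vr] := leP r v.
  rewrite distrC; apply: le_lt_trans (H r v rv rr vd) _.
  by rewrite mulrC; rewrite ger0_norm ?subr_ge0 in ve.
apply: le_lt_trans (H v r vr vd rr) _.
by rewrite mulrC; rewrite ler0_norm ?subr_le0 ?opprB in ve.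
Unshelve. all: by end_near. Qed.

Lemma tint_nondecreasing f s t : (forall u, 0 <= f u) -> continuous f -> s <= t ->
  tint f 0 s <= tint f 0 t.
Proof.
move=> f0 fc st; have [s0|s0] := leP 0 s; last by rewrite tint_empty// tint_ge0.
rewrite (@tint_split _ f 0 s t)//; last exact: continuous_itv_integrable.
by rewrite lerDl tint_ge0.
Qed.

Lemma truncated_primitive_integrable f N s t : (forall u, 0 <= f u) -> continuous f ->
  leb.-integrable `[s, t] (EFin \o (fun u => f u * (tint f 0 u <= N)%R%:R)).
Proof.
move=> f0 fc; apply: (@rintegrable_le _ _ _ leb `[s, t] _ _ f) => //.
- apply: measurable_funTS; apply: measurable_funM; first exact: continuous_measurable_fun.
  rewrite (_ : (fun _ => _) = \1_[set u | tint f 0 u <= N]).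
    apply: measurable_indic; apply: measurable_set_le.
    by apply: continuous_measurable_fun; exact: tint_continuous.
  by apply/funext => u; rewrite indicE mem_setE.
- move=> u _; rewrite normrM ger0_norm// ler_piMr// normr_nat lern1.
  by case: (_ <= _).
- exact: continuous_itv_integrable.
Qed.

(** If the primitive exceeds [N] by time [t], it takes the value [N] at some [r], and up to [r] the
    indicator is 1. After integration over [w], this bounds E[min (Lambda_t, N)] by a time integral
    of expectations localised by Lambda_u <= N. *)
Lemma truncated_primitive_le f N t : (forall u, 0 <= f u) -> continuous f ->
  0 <= t -> 0 <= N ->
  Num.min (tint f 0 t) N <= tint (fun u => f u * (tint f 0 u <= N)%R%:R) 0 t.
Proof.
move=> f0 fc t0 N0; pose L u := tint f 0 u.
have below r : 0 <= r -> L r <= N ->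
    L r = tint (fun u => f u * (L u <= N)%R%:R) 0 r.
  move=> r0 Lr; apply: eq_Rintegral => u; rewrite inE/= in_itv/= => /andP[u0 ur].
  by rewrite (le_trans _ Lr) ?mulr1// tint_nondecreasing.
have [LN|NL] := leP (L t) N; first by rewrite -/(L t) -below// min_l.
have [r] : exists2 r, r \in `[0, t] & L r = N.
  apply: IVT => //; first by apply: continuous_subspaceT; exact: tint_continuous.
  have L0 : L 0 = 0 by rewrite /L /tint set_itv1 Rintegral_set1.
  by rewrite L0 ge_min N0/= le_max (ltW NL) orbT.
rewrite in_itv/= => /andP[r0 rt] Lr.
rewrite (@tint_split _ _ 0 r t)//; last exact: truncated_primitive_integrable.
rewrite -[leLHS]Lr [leLHS]below ?Lr// lerDl.
by apply: tint_ge0 => u _; rewrite mulr_ge0.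
Qed.

Lemma nondecreasing_itv_integrable (u : R -> R) s t : {homo u : x y / x <= y} ->
  leb.-integrable `[s, t] (EFin \o u).
Proof.
move=> und; apply: (@itv_integrable _ _ _ _ (`|u s| + `|u t|)).
  by apply: nondecreasing_measurable => //; move=> x y _ _; exact: und.
move=> x /andP[sx xt]; have := und _ _ sx; have := und _ _ xt.
have := ler_norm (u t); have := ler_norm (- u s); rewrite normrN ler_norml.
by have := normr_ge0 (u s); have := normr_ge0 (u t); lra.
Qed.

(* Gronwall's inequality for monotone functions, by steps of length [1 / 2C]. *)
Lemma gronwall_nondecreasing (C T : R) : 0 < C -> exists B : R,
  forall u : R -> R, {homo u : x y / x <= y} -> (forall x, 0 <= u x) ->
  (forall t, 0 <= t <= T -> u t <= tint (fun x => C * (1 + u x)) 0 t) ->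
  forall t, 0 <= t <= T -> u t <= B.
Proof.
move=> C0; pose h := (2 * C)^-1.
have h0 : 0 < h by rewrite invr_gt0 mulr_gt0.
suff H k : exists B : R, forall u : R -> R, {homo u : x y / x <= y} ->
    (forall x, 0 <= u x) ->
    (forall t, 0 <= t <= T -> u t <= tint (fun x => C * (1 + u x)) 0 t) ->
    forall t, 0 <= t <= T -> t <= k%:R * h -> u t <= B.
  have [B HB] := H (Num.bound `|T / h|).
  exists B => u und u0 uT t tT; apply: (HB u) => //.
  have /andP[_ tT'] := tT; apply: (le_trans tT').
  rewrite -ler_pdivrMr//; apply: (le_trans (ler_norm _)).
  by apply: ltW; apply: archi_boundP.
elim: k => [|k [B HB]].
  exists 0 => u und u0 uT t /andP[t0 tT] tk.
  have -> : t = 0 by apply: le_anti; rewrite t0 andbT (le_trans tk)// mul0r.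
  have := uT 0; rewrite lexx (le_trans t0 tT) => /(_ isT) /le_trans; apply.
  by rewrite /tint set_itv1 Rintegral_set1.
pose a := k%:R * h.
have a0 : 0 <= a by rewrite mulr_ge0// ltW.
(* On [a, a + h] monotonicity bounds the integral by C h (1 + u t), and C h = 1 / 2 lets half of
   [u t] be absorbed on the left. *)
exists (`|B| + 2 * (1 + C * a * (1 + `|B|))) => u und u0 uT t /andP[t0 tT] tk.
have B1 := ler_norm B.
have pos : 0 <= C * a * (1 + `|B|).
  by apply: mulr_ge0; [apply: mulr_ge0 => //; exact: ltW|exact: addr_ge0].
have [ta|at'] := leP t a.
  have := HB u und u0 uT t; rewrite t0 tT => /(_ isT ta) uB; lra.
have at2 := ltW at'.
have uB : u a <= B by apply: (HB u) => //; rewrite a0 (le_trans at2 tT).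
have := uT t; rewrite t0 tT => /(_ isT).
have und' : {homo (fun x => C * (1 + u x)) : x y / x <= y}.
  by move=> x y xy; rewrite ler_wpM2l ?(ltW C0)// lerD2l und.
rewrite (@tint_split _ _ 0 a t)//; last exact: nondecreasing_itv_integrable.
have i1 : tint (fun x => C * (1 + u x)) 0 a <= C * (1 + u a) * (a - 0).
  apply: le_tint_cst => //; first exact: nondecreasing_itv_integrable.
  by move=> x /andP[_ xa]; exact: und'.
have i2 : tint (fun x => C * (1 + u x)) a t <= C * (1 + u t) * (t - a).
  apply: le_tint_cst => //; first exact: nondecreasing_itv_integrable.
  by move=> x /andP[_ xa]; exact: und'.
have i3 : C * (1 + u t) * (t - a) <= (1 + u t) / 2.
  have : t - a <= h by rewrite /a; move: tk; rewrite -natr1 mulrDl mul1r; lra.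
  have Cu : 0 <= C * (1 + u t) by apply: mulr_ge0; [exact: ltW|exact: addr_ge0].
  move=> /(ler_wpM2l Cu) /le_trans; apply.
  by rewrite le_eqVlt; apply/orP; left; apply/eqP; rewrite /h; field; rewrite gt_eqF.
have i4 : C * (1 + u a) * (a - 0) <= C * a * (1 + `|B|).
  rewrite subr0 mulrAC; apply: ler_wpM2l; first by apply: mulr_ge0 => //; exact: ltW.
  by rewrite lerD2l (le_trans uB).
by move: i1 i2 i3 i4 (u0 t) (normr_ge0 B); lra.
Qed.

End time_integral_bounds.

(** * A priori moments *)

Lemma sqr_add4_le (R : realFieldType) (x y z k : R) :
  (x + y + z + k) ^+ 2 <= 4 * (x ^+ 2 + y ^+ 2 + z ^+ 2 + k ^+ 2).
Proof.
have := sqr_ge0 (x - y); have := sqr_ge0 (x - z); have := sqr_ge0 (x - k).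
have := sqr_ge0 (y - z); have := sqr_ge0 (y - k); have := sqr_ge0 (z - k).
nra.
Qed.

Section lipschitz_growth.
Context {R : realType} (f : R -> R) (L : R).
Hypotheses (L0 : 0 <= L) (f_lip : forall x y, `|f x - f y| <= L * `|x - y|).

Lemma lipschitz_continuous : continuous f.
Proof.
have L1 : 0 < L + 1 by rewrite ltr_wpDl.
move=> x; apply/cvgrPdist_lt => e e0; near=> y.
apply: le_lt_trans (f_lip _ _) _.
have yx : `|x - y| < e / (L + 1).
  near: y; exists (e / (L + 1)) => //=; by rewrite divr_gt0.
rewrite ltr_pdivlMr// in yx; apply: le_lt_trans yx.
by rewrite mulrC ler_wpM2l// lerDl.
Unshelve. all: by end_near. Qed.

Lemma lipschitz_sqr x y : (f x - f y) ^+ 2 <= L ^+ 2 * (x - y) ^+ 2.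
Proof.
rewrite -[leLHS]real_normK ?num_real// -exprMn -[leRHS]real_normK ?num_real//.
rewrite lerXn2r ?nnegrE// normrM (ger0_norm L0); exact: f_lip.
Qed.

Lemma lipschitz_growth c : 2 * f 0 ^+ 2 + 2 * L ^+ 2 <= c -> forall x, f x ^+ 2 <= c * (1 + x ^+ 2).
Proof.
move=> cL x; have := lipschitz_sqr x 0; rewrite subr0 => H.
have := sqr_le_sqrB (f x) (f 0).
have := sqr_ge0 x; have := sqr_ge0 (f 0); have := sqr_ge0 L.
move: H cL; move: (f x) (f 0) => fx f0; nra.
Qed.

End lipschitz_growth.

Section a_priori.
Context d (T : measurableType d) (R : realType) (P : probability T R).
Variables (B : R -> {RV P >-> R}) (X0 : {RV P >-> R}).
Notation leb := (@lebesgue_measure R).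
Hypothesis P_complete : measure_is_complete P.
Hypothesis B_bm : brownian_motion B.
Hypothesis B_X0_indep :
  independent_systems P (sigma_of X0) (sigma_path (fun t => B t)).
Local Notation intg f := (P.-integrable setT (EFin \o f)).
Local Notation ameas := (ameas B X0).
Variables (X I : R -> T -> R) (K b sigma : R -> R) (Lip : R).
Variable phi : nat -> simple_process (augmented_filtration P X0 (fun t => B t)).
Hypotheses (Xc : forall w, continuous (X ^~ w)) (Xm : forall u, measurable_fun setT (X u)).
Hypothesis Xa : forall u, 0 <= u -> ameas u (X u).
Hypothesis Knd : {homo K : x y / x <= y}.
Hypothesis Lip0 : 0 <= Lip.
Hypothesis b_lip : forall x y, `|b x - b y| <= Lip * `|x - y|.
Hypothesis sigma_lip : forall x y, `|sigma x - sigma y| <= Lip * `|x - y|.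
Hypothesis mI : forall t, 0 <= t -> measurable_fun setT (I t).
Hypothesis phiH : forall t e : R, 0 <= t -> 0 < e ->
  P [set w | e <= tint (fun u => (sp_fun (phi n) u w - sigma (X u w)) ^+ 2) 0 t]
    @[n --> \oo] --> 0%E.
Hypothesis phiI : forall t e : R, 0 <= t -> 0 < e ->
  P [set w | e <= `|sp_integral (phi n) (fun r => B r) t w - I t w|]
    @[n --> \oo] --> 0%E.
Hypothesis X_eq : {ae P, forall w, forall t, 0 <= t ->
  X t w = X0 w + tint (fun u => b (X u w)) 0 t + I t w + K t}.
Hypothesis iX0 : intg (fun w => X0 w ^+ 2).

Let c : R := 2 * b 0 ^+ 2 + 2 * sigma 0 ^+ 2 + 2 * Lip ^+ 2 + 1.

Let c_ge1 : 1 <= c.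
Proof.
have := sqr_ge0 (b 0); have := sqr_ge0 (sigma 0); have := sqr_ge0 Lip.
by rewrite /c; lra.
Qed.

Let c_gt0 : 0 < c. Proof. exact: lt_le_trans ltr01 c_ge1. Qed.

Let b_growth x : b x ^+ 2 <= c * (1 + x ^+ 2).
Proof.
apply: (lipschitz_growth Lip0 b_lip); rewrite /c.
by have := sqr_ge0 (sigma 0); lra.
Qed.

Let sigma_growth x : sigma x ^+ 2 <= c * (1 + x ^+ 2).
Proof.
apply: (lipschitz_growth Lip0 sigma_lip); rewrite /c.
by have := sqr_ge0 (b 0); lra.
Qed.

Lemma drift_continuous w : continuous (fun u => b (X u w)).
Proof.
by move=> u; apply: (cvg_comp _ _ (@Xc w u)); exact: (lipschitz_continuous Lip0 b_lip).
Qed.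

Lemma diffusion_continuous w : continuous (fun u => sigma (X u w)).
Proof.
by move=> u; apply: (cvg_comp _ _ (@Xc w u)); exact: (lipschitz_continuous Lip0 sigma_lip).
Qed.

Lemma X_joint : jointly_measurable X.
Proof. exact: caratheodory_joint. Qed.

Lemma drift_joint : jointly_measurable (fun u w => b (X u w)).
Proof.
apply: measurableT_comp X_joint; apply: continuous_measurable_fun.
exact: (lipschitz_continuous Lip0 b_lip).
Qed.

Lemma diffusion_joint : jointly_measurable (fun u w => sigma (X u w)).
Proof.
apply: measurableT_comp X_joint; apply: continuous_measurable_fun.
exact: (lipschitz_continuous Lip0 sigma_lip).
Qed.

(** The definition of the integral does not prescribe its value at 0; it follows from the elementary
    integrals, all of which vanish at time 0. *)
Lemma I0_ae0 : {ae P, forall w, I 0 w = 0}.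
Proof.
have mI0 : measurable_fun setT (fun w => `|I 0 w|) by apply: measurableT_comp => //; exact: mI.
have Pe e : 0 < e -> P [set w | e <= `|I 0 w|] = 0%E.
  move=> e0.
  have S0 n w : sp_integral (phi n) (fun r => B r) 0 w = 0.
    rewrite /sp_integral big1// => i _.
    by rewrite !min_r ?sp_time_ge0// subrr mulr0.
  have E : (fun n => P [set w | e <= `|sp_integral (phi n) (fun r => B r) 0 w - I 0 w|])
      = fun=> P [set w | e <= `|I 0 w|].
    by apply/funext => n; congr (P _); apply/seteqP; split => w /=; rewrite S0 sub0r normrN.
  have := @phiI 0 e (lexx 0) e0; rewrite E => /(@cvg_lim _ (@ereal_hausdorff R)).
  by rewrite lim_cst.
exists (\bigcup_k [set w | k.+1%:R^-1 <= `|I 0 w|]); split.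
- by apply: bigcupT_measurable => k; exact: measurable_set_ge.
- have mk k : measurable [set w | k.+1%:R^-1 <= `|I 0 w|] by exact: measurable_set_ge.
  apply/measure_negligible; first exact: bigcupT_measurable.
  by apply: negligible_bigcup => k; apply/negligibleP => //; exact: Pe.
move=> w /= /eqP I0; rewrite -normr_gt0 in I0.
exists (Num.bound (`|I 0 w|^-1)) => //=.
rewrite -[leRHS]invrK lef_pV2 ?posrE ?invr_gt0//.
apply: (@le_trans _ _ (Num.bound (`|I 0 w|^-1))%:R); last by rewrite ler_nat.
by apply: ltW; apply: archi_boundP; rewrite invr_ge0.
Qed.

(** By linear growth, [c * Lam] dominates the energies of both the drift and the diffusion
    coefficient. *)
Let Lam t w : R := tint (fun u => 1 + X u w ^+ 2) 0 t.

Let g_continuous w : continuous (fun u => 1 + X u w ^+ 2).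
Proof.
move=> u; apply: cvgD; first exact: cvg_cst.
by apply: cvgM; exact: Xc.
Qed.

Let g_ge0 w u : 0 <= 1 + X u w ^+ 2.
Proof. by rewrite addr_ge0// sqr_ge0. Qed.

Let g_joint : jointly_measurable (fun u w => 1 + X u w ^+ 2).
Proof.
rewrite /jointly_measurable; apply: measurable_funD; first exact: measurable_cst.
by apply: measurable_funX; exact: X_joint.
Qed.

Let mLam t : measurable_fun setT (Lam t).
Proof. exact: measurable_tint g_joint. Qed.

Let Lam_joint : jointly_measurable Lam.
Proof.
apply: caratheodory_joint; first exact: mLam.
by move=> w; apply: tint_continuous; exact: g_continuous.
Qed.

Let Lam_ge0 t w : 0 <= Lam t w.
Proof. by apply: tint_ge0 => u _; exact: g_ge0. Qed.

Let growth_le_Lam (f : R -> R) t w : continuous (fun u => f (X u w)) ->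
  (forall x, f x ^+ 2 <= c * (1 + x ^+ 2)) ->
  tint (fun u => f (X u w) ^+ 2) 0 t <= c * Lam t w.
Proof.
move=> fc fg; rewrite -tintZl; last exact: continuous_itv_integrable.
apply: le_tint => //.
- by apply: continuous_itv_integrable => u; apply: cvgM; exact: fc.
- by apply: tintegrableZl; exact: continuous_itv_integrable.
Qed.

Let u_ N t : R := \int[P]_w Num.min (Lam t w) N.

Let imin N t : 0 <= N -> intg (fun w => Num.min (Lam t w) N).
Proof.
move=> N0; apply: (@intg_bounded _ _ _ P _ N); first exact: measurable_minr.
by move=> w; rewrite ger0_norm ?le_min ?Lam_ge0 ?N0// ge_min lexx orbT.
Qed.

Variable tmax : R.
Hypothesis tmax0 : 0 <= tmax.

Let Kmax : R := `|K 0| + `|K tmax|.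

Let K_le t : 0 <= t <= tmax -> K t ^+ 2 <= Kmax ^+ 2.
Proof.
move=> /andP[t0 tt]; rewrite -real_normK ?num_real// lerXn2r ?nnegrE ?addr_ge0//.
have := Knd t0; have := Knd tt; rewrite ler_norml /Kmax.
have := ler_norm (K tmax); have := ler_norm (- K 0); rewrite normrN.
by have := normr_ge0 (K 0); have := normr_ge0 (K tmax); lra.
Qed.

Let EX0 : R := \int[P]_w X0 w ^+ 2.
(** The outer 4 comes from squaring a sum of four terms, the inner 4 and the 6 from
    [ito_truncated_bound], and [tmax] from the Cauchy-Schwarz bound on the drift. *)
Let C1 : R := 1 + 4 * (EX0 + Kmax ^+ 2 + 4 + (tmax + 6) * c).

Let EX0_ge0 : 0 <= EX0.
Proof. by apply: Rintegral_ge0 => w _; exact: sqr_ge0. Qed.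

Let C1_gt0 : 0 < C1.
Proof.
have := EX0_ge0; have := sqr_ge0 Kmax; have : 0 <= (tmax + 6) * c.
  by rewrite mulr_ge0 ?(ltW c_gt0)// addr_ge0.
by rewrite /C1; lra.
Qed.

(** Where [Lam t w <= N] the diffusion energy is at most [c * N], so the squared integral is
    dominated by [F2], which [ito_truncated_bound] controls, and the drift contributes at most
    [tmax * c * Lam t w]. The term [K t] is deterministic and bounded through its values at 0 and
    [tmax]. The bound involves only the truncated expectation [u_ N t]. *)
Let truncated_moment N t : 0 <= N -> 0 <= t <= tmax ->
  (\int[P]_w ((1 + X t w ^+ 2) * (Lam t w <= N)%R%:R)%:E <= (C1 * (1 + u_ N t))%:E)%E.
Proof.
move=> N0 /andP[t0 tt].
pose D w := I t w - I 0 w.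
pose A w := tint (fun u => sigma (X u w) ^+ 2) 0 t.
have cN0 : 0 <= c * N by rewrite mulr_ge0// ltW.
have mA : measurable_fun setT A.
  apply: (@measurable_tint _ _ _ (fun u w => sigma (X u w) ^+ 2)).
  by apply: measurable_funX; exact: diffusion_joint.
have mG : measurable [set w | A w <= c * N] by exact: measurable_set_le.
have mD : measurable_fun setT D by apply: measurable_funB; apply: mI.
have mX0 : measurable_fun setT X0 by [].
have Abound := @ito_truncated_bound _ _ _ _ B X0 P_complete B_bm B_X0_indep _ _ phi
  diffusion_joint diffusion_continuous mI phiH phiI t (c * N) t0 cN0.
pose F1 w : R := X0 w ^+ 2.
pose F2 w : R := D w ^+ 2 * \1_[set w | (A w <= c * N)%R] w.
pose F3 w : R := Num.min (Lam t w) N.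
have F30 w : 0 <= F3 w by rewrite le_min Lam_ge0.
have mF2 : measurable_fun setT F2.
  by apply: measurable_funM; [exact: measurable_funX|exact: measurable_indic].
have F20 w : 0 <= F2 w by rewrite mulr_ge0 ?sqr_ge0.
have EA : \int[P]_w Num.min (A w) (c * N) <= c * u_ N t.
  have i2 := rintegrableZl measurableT c (@imin N t N0).
  rewrite /u_ -RintegralZl//; last exact: imin.
  have le w : Num.min (A w) (c * N) <= c * Num.min (Lam t w) N.
    have := @growth_le_Lam sigma t w (@diffusion_continuous w) sigma_growth.
    rewrite -/(A w) => AL.
    by have [_|_] := leP (Lam t w) N; rewrite ge_min ?AL ?lexx ?orbT.
  have A0 w : 0 <= A w by apply: tint_ge0 => u _; exact: sqr_ge0.
  apply: le_Rintegral => //.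
  apply: rintegrable_le i2 => //; first exact: measurable_minr.
  by move=> w _; rewrite ger0_norm// le_min A0.
have i2 : intg F2.
  apply/integrableP; split; first exact/measurable_EFinP.
  under eq_integral do rewrite /= ger0_norm ?F20//.
  by apply: le_lt_trans Abound _; rewrite ltry.
have EF2 : \int[P]_w F2 w <= 6 * c * u_ N t + 4.
  rewrite -lee_fin {1}/Rintegral fineK; last exact: integrable_fin_num i2.
  by apply: (le_trans Abound); rewrite lee_fin lerD2r -mulrA ler_wpM2l.
have i3 := @imin N t N0.
have i1 : intg (fun w => 1 + 4 * (F1 w + Kmax ^+ 2 + F2 w + tmax * c * F3 w)).
  have ic : intg (fun=> 1) by exact: finite_measure_integrable_cst.
  have iK : intg (fun=> Kmax ^+ 2) by exact: finite_measure_integrable_cst.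
  apply: rintegrableD => //; apply: rintegrableZl => //; apply: rintegrableD => //.
    by apply: rintegrableD => //; exact: rintegrableD.
  exact: rintegrableZl.
have mL : measurable_fun setT (fun w => (1 + X t w ^+ 2) * (Lam t w <= N)%R%:R).
  apply: measurable_funM; first by apply: measurable_funD => //; exact: measurable_funX.
  rewrite (_ : (fun _ => _) = \1_[set w | Lam t w <= N]).
    by apply: measurable_indic; apply: measurable_set_le; exact: mLam.
  by apply/funext => w; rewrite indicE mem_setE.
apply: (@le_trans _ _ (\int[P]_w (1 + 4 * (F1 w + Kmax ^+ 2 + F2 w + tmax * c * F3 w))%:E)%E).
  apply: ae_ge0_le_integral => //.
  - by move=> w _; rewrite lee_fin mulr_ge0.
  - exact/measurable_EFinP.
  - move=> w _; rewrite lee_fin addr_ge0// mulr_ge0// addr_ge0//.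
      by rewrite !addr_ge0// sqr_ge0.
    by rewrite !mulr_ge0// ltW.
  - exact: measurable_int i1.
  have := I0_ae0; have := X_eq; apply: filterS2 => w Xw I0w _.
  rewrite lee_fin.
  have rhs0 : 0 <= F1 w + Kmax ^+ 2 + F2 w + tmax * c * F3 w.
    by rewrite !addr_ge0 ?sqr_ge0// ?mulr_ge0// ?(ltW c_gt0).
  have [LN|] := boolP (Lam t w <= N); last by move=> _; rewrite mulr0 addr_ge0// mulr_ge0.
  rewrite mulr1 lerD2l.
  have F2E : F2 w = I t w ^+ 2.
    rewrite /F2 /D I0w subr0 indicE mem_set ?mulr1//=.
    apply: (le_trans (@growth_le_Lam sigma t w (@diffusion_continuous w) sigma_growth)).
    by rewrite ler_pM2l.
  have F3E : F3 w = Lam t w by rewrite /F3 min_l.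
  set bt := tint (fun u => b (X u w)) 0 t.
  have bt2 : bt ^+ 2 <= tmax * c * F3 w.
    have bc := @drift_continuous w.
    apply: (le_trans (tint_sqr_le t0 (continuous_itv_integrable _ _ bc) _)).
      by apply: continuous_itv_integrable => u; apply: cvgM; exact: bc.
    rewrite subr0 F3E -mulrA; apply: ler_pM => //.
      by apply: tint_ge0 => u _; exact: sqr_ge0.
    exact: growth_le_Lam.
  rewrite Xw// -/bt F2E.
  have := @K_le t; rewrite t0 tt => /(_ isT) Kt.
  apply: le_trans (sqr_add4_le _ _ _ _) _; rewrite /F1.
  by move: bt2 Kt; rewrite -/bt; set x := tmax * c * _; lra.
rewrite -[leLHS]fineK; last exact: integrable_fin_num i1.
rewrite lee_fin -/(Rintegral P setT (fun w => 1 + 4 * (F1 w + Kmax ^+ 2 + F2 w + tmax * c * F3 w))).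
have ic : intg (fun=> 1) by exact: finite_measure_integrable_cst.
have iK : intg (fun=> Kmax ^+ 2) by exact: finite_measure_integrable_cst.
have i1K := rintegrableD measurableT iX0 iK.
have i1K2 := rintegrableD measurableT i1K i2.
have i3c := rintegrableZl measurableT (tmax * c) i3.
have iall := rintegrableD measurableT i1K2 i3c.
have iall4 := rintegrableZl measurableT 4 iall.
rewrite RintegralD// Rintegral_probability_cst RintegralZl// RintegralD// RintegralD//.
rewrite RintegralD// Rintegral_probability_cst RintegralZl// -/EX0 -/(u_ N t).
have u0 : 0 <= u_ N t by apply: Rintegral_ge0 => w _; exact: F30.
have cu : 0 <= c * u_ N t by rewrite mulr_ge0// ltW.
have tc : 0 <= tmax * c by rewrite mulr_ge0// ltW.
have k2 := sqr_ge0 Kmax.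
have h1 : 0 <= EX0 * u_ N t by exact: mulr_ge0.
have h2 : 0 <= Kmax ^+ 2 * u_ N t by exact: mulr_ge0.
by rewrite /C1; move: EF2 c_gt0; set x := \int[P]_w F2 w; lra.
Qed.

(** Gronwall's inequality is applied to [u_ N] for each [N]; its bound depends only on [C1] and
    [tmax]. Since [Lam t w] is finite, the localising indicator increases to 1 with [N], and
    monotone convergence removes it. *)
Lemma moment_bound : exists2 C, 0 <= C & forall t, 0 <= t <= tmax ->
  intg (fun w => X t w ^+ 2) /\ \int[P]_w X t w ^+ 2 <= C.
Proof.
have [Bd HB] := @gronwall_nondecreasing R C1 tmax C1_gt0.
have u0 N t : 0 <= N -> 0 <= u_ N t.
  by move=> N0; apply: Rintegral_ge0 => w _; rewrite le_min Lam_ge0.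
have und N : 0 <= N -> {homo u_ N : x y / x <= y}.
  move=> N0 x y xy; apply: le_Rintegral; [by []|exact: imin|exact: imin|].
  move=> w _; rewrite le_min !ge_min lexx orbT andbT.
  by rewrite tint_nondecreasing.
have uB N t : 0 <= N -> 0 <= t <= tmax -> u_ N t <= Bd.
  move=> N0; apply: HB; [exact: und|by move=> x; exact: u0|move=> {}t /andP[t0 tt]].
  pose f u w := (1 + X u w ^+ 2) * (Lam u w <= N)%R%:R.
  have jf : jointly_measurable f.
    rewrite /jointly_measurable; apply: measurable_funM; first exact: g_joint.
    rewrite (_ : (fun _ => _) = \1_[set p : measurableTypeR R * T | (Lam p.1 p.2 <= N)%R]).
      by apply: measurable_indic; apply: measurable_set_le; exact: Lam_joint.
    by apply/funext => p; rewrite indicE mem_setE.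
  have f0 u w : 0 <= f u w by rewrite mulr_ge0.
  have fi w : leb.-integrable `[0, t] (EFin \o f ^~ w).
    exact: (truncated_primitive_integrable N 0 t (g_ge0 w) (@g_continuous w)).
  have ki : leb.-integrable `[0, t] (EFin \o (fun u => C1 * (1 + u_ N u))).
    apply: nondecreasing_itv_integrable => x y xy.
    by apply: ler_wpM2l; [exact: ltW C1_gt0|rewrite lerD2l; exact: und].
  have fk u : 0 <= u <= t -> (\int[P]_w (f u w)%:E <= (C1 * (1 + u_ N u))%:E)%E.
    by move=> /andP[u0' ut]; apply: truncated_moment; rewrite ?u0'//= (le_trans ut).
  have [i1 h1] := @tint_expectation_le _ _ _ P f (fun u => C1 * (1 + u_ N u)) 0 t jf f0 fi ki fk.
  apply: le_trans h1; apply: le_Rintegral => //; first exact: imin.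
  move=> w _; exact: (truncated_primitive_le (g_ge0 w) (@g_continuous w) t0 N0).
exists (C1 * (1 + `|Bd|)); first by rewrite mulr_ge0 ?(ltW C1_gt0)// addr_ge0.
move=> t tt.
have mX2 : measurable_fun setT (fun w => X t w ^+ 2) by exact: measurable_funX.
pose g (n : nat) w := (1 + X t w ^+ 2) * (Lam t w <= n%:R)%R%:R.
have gb : (\int[P]_w (1 + X t w ^+ 2)%:E <= (C1 * (1 + `|Bd|))%:E)%E.
  have : (\int[P]_w (g n w)%:E)%E @[n --> \oo] --> (\int[P]_w (1 + X t w ^+ 2)%:E)%E.
    apply: cvg_integral_nondecreasing.
  - move=> n; apply: measurable_funM; first by apply: measurable_funD => //.
    rewrite (_ : (fun _ => _) = \1_[set w | Lam t w <= n%:R]).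
      by apply: measurable_indic; apply: measurable_set_le; exact: mLam.
    by apply/funext => w; rewrite indicE mem_setE.
  - by move=> n w; rewrite mulr_ge0.
  - move=> w k n kn; apply: ler_wpM2l => //; rewrite ler_nat.
    have [/= k1|_] := boolP (Lam t w <= k%:R); last by case: (_ <= _).
    by rewrite (le_trans k1) ?ler_nat.
  - move=> w; apply: cvg_near_cst; near=> n.
    rewrite /g (_ : (_ <= _) = true) ?mulr1//.
    by near: n; exact: nbhs_infty_ger.
  move=> cg; rewrite -(cvg_lim (@ereal_hausdorff R) cg); apply: lime_le.
    by apply/cvg_ex; eexists; exact: cg.
  apply: nearW => n; apply: le_trans (truncated_moment (ler0n _ n) tt) _.
  rewrite lee_fin ler_wpM2l ?(ltW C1_gt0)// lerD2l.
  exact: le_trans (uB _ _ (ler0n _ n) tt) (ler_norm _).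
have i1 : intg (fun w => 1 + X t w ^+ 2).
  apply/integrableP; split; first by apply/measurable_EFinP; exact: measurable_funD.
  under eq_integral do rewrite /= ger0_norm//.
  by apply: le_lt_trans gb _; rewrite ltry.
have i2 : intg (fun w => X t w ^+ 2).
  apply: rintegrable_le i1 => // w _.
  by rewrite ger0_norm ?sqr_ge0// lerDr.
split => //.
apply: (@le_trans _ _ (\int[P]_w (1 + X t w ^+ 2))).
  by apply: le_Rintegral => // w _; rewrite lerDr.
by rewrite -lee_fin {1}/Rintegral fineK//; exact: integrable_fin_num i1.
Unshelve. all: by end_near. Qed.

End a_priori.

Lemma max0_continuous (R : realType) : continuous (fun t : R => Num.max t 0).
Proof.
rewrite (_ : (fun _ => _) = fun t => (t + `|t|) / 2); last first.
  by apply/funext => t; case: (ltrgt0P t) => [t0|t0|->]; lra.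
move=> t; apply: cvgM; last exact: cvg_cst.
by apply: cvgD; [exact: cvg_id|apply: cvg_norm; exact: cvg_id].
Qed.

(** * Increments of the solution in mean square *)

Section mean_square.
Context d (T : measurableType d) (R : realType) (P : probability T R).
Variables (B : R -> {RV P >-> R}) (X0 : {RV P >-> R}).
Notation leb := (@lebesgue_measure R).
Hypothesis P_complete : measure_is_complete P.
Hypothesis B_bm : brownian_motion B.
Hypothesis B_X0_indep :
  independent_systems P (sigma_of X0) (sigma_path (fun t => B t)).
Local Notation intg f := (P.-integrable setT (EFin \o f)).
Local Notation ameas := (ameas B X0).
Variables (X I : R -> T -> R) (K b sigma : R -> R) (Lip : R).
Variable phi : nat -> simple_process (augmented_filtration P X0 (fun t => B t)).
Hypotheses (Xc : forall w, continuous (X ^~ w)) (Xm : forall u, measurable_fun setT (X u)).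
Hypothesis Xa : forall u, 0 <= u -> ameas u (X u).
Hypothesis Knd : {homo K : x y / x <= y}.
Hypothesis Lip0 : 0 <= Lip.
Hypothesis b_lip : forall x y, `|b x - b y| <= Lip * `|x - y|.
Hypothesis sigma_lip : forall x y, `|sigma x - sigma y| <= Lip * `|x - y|.
Hypothesis mI : forall t, 0 <= t -> measurable_fun setT (I t).
Hypothesis phiH : forall t e : R, 0 <= t -> 0 < e ->
  P [set w | e <= tint (fun u => (sp_fun (phi n) u w - sigma (X u w)) ^+ 2) 0 t]
    @[n --> \oo] --> 0%E.
Hypothesis phiI : forall t e : R, 0 <= t -> 0 < e ->
  P [set w | e <= `|sp_integral (phi n) (fun r => B r) t w - I t w|]
    @[n --> \oo] --> 0%E.
Hypothesis X_eq : forall w t, 0 <= t ->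
  X t w = X0 w + tint (fun u => b (X u w)) 0 t + I t w + K t.
Hypothesis iX0 : intg (fun w => X0 w ^+ 2).

Hypothesis Kc : continuous K.
Hypothesis X_neg : forall u, X u = X (Num.max u 0).

Let moment_bound := moment_bound P_complete B_bm B_X0_indep Xc Xm Knd Lip0
  b_lip sigma_lip mI phiH phiI (aeW _ X_eq) iX0.

Lemma X_sqr_integrable u : intg (fun w => X u w ^+ 2).
Proof.
rewrite X_neg; have [|C _] := @moment_bound (Num.max u 0); first by rewrite le_max lexx orbT.
by move=> /(_ (Num.max u 0)); rewrite le_max !lexx orbT => -[].
Qed.

Lemma time_integral_sqr_bound (f : R -> R) tmax : 0 <= tmax ->
  (forall x y, `|f x - f y| <= Lip * `|x - y|) ->
  exists2 C, 0 <= C & forall s t, 0 <= s -> s <= t -> t <= tmax ->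
    intg (fun w => tint (fun u => f (X u w) ^+ 2) s t) /\
    \int[P]_w tint (fun u => f (X u w) ^+ 2) s t <= C * (t - s).
Proof.
move=> tmax0 f_lip; have [C C0 HC] := moment_bound tmax0.
pose c := 2 * f 0 ^+ 2 + 2 * Lip ^+ 2.
have c0 : 0 <= c by rewrite addr_ge0// mulr_ge0// sqr_ge0.
have fg := lipschitz_growth Lip0 f_lip (lexx c).
have fc := lipschitz_continuous Lip0 f_lip.
exists (c * (1 + C)) => [|s t s0 st tt]; first by rewrite mulr_ge0// addr_ge0.
rewrite -tint_cst//; apply: tint_expectation_le.
- apply: measurable_funX; apply: measurableT_comp (X_joint Xc Xm).
  exact: continuous_measurable_fun.
- by move=> u w; exact: sqr_ge0.
- move=> w; apply: continuous_itv_integrable => u.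
  by apply: cvgM; apply: (cvg_comp _ _ (@Xc w u)); exact: fc.
- by apply: (@itv_integrable _ _ _ _ `|c * (1 + C)|).
move=> u /andP[su ut]; have [|iX EX] := HC u; first by rewrite (le_trans s0)// (le_trans ut).
have i1 : intg (fun w => c * (1 + X u w ^+ 2)).
  by apply: rintegrableZl => //; apply: rintegrableD => //; exact: finite_measure_integrable_cst.
have mf : measurable_fun setT (fun w => f (X u w) ^+ 2).
  by apply: measurable_funX; apply: measurableT_comp => //; exact: continuous_measurable_fun.
have i2 : intg (fun w => f (X u w) ^+ 2).
  by apply: rintegrable_le i1 => // w _; rewrite ger0_norm ?sqr_ge0.
rewrite -[leLHS]fineK; last exact: integrable_fin_num i2.
rewrite lee_fin; apply: le_trans (le_Rintegral _ i2 i1 _) _ => //.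
have ic : intg (fun=> 1) by exact: finite_measure_integrable_cst.
rewrite RintegralZl//; last exact: rintegrableD.
by rewrite RintegralD// Rintegral_probability_cst ler_wpM2l// lerD2l.
Qed.

Lemma diffusion_sqr_integrable t : 0 <= t ->
  intg (fun w => tint (fun u => sigma (X u w) ^+ 2) 0 t).
Proof.
by move=> t0; have [C _ /(_ 0 t (lexx 0) t0 (lexx t))[]] := time_integral_sqr_bound t0 sigma_lip.
Qed.

Let ito_L2 t (t0 : 0 <= t) := ito_L2 P_complete B_bm B_X0_indep
  (diffusion_joint Xc Xm Lip0 sigma_lip) (diffusion_continuous Xc Lip0 sigma_lip)
  mI phiH phiI t0 (diffusion_sqr_integrable t0).

Lemma martingale_part_sqr tmax : 0 <= tmax ->
  exists2 C, 0 <= C & forall s t, 0 <= s -> s <= t -> t <= tmax ->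
    intg (fun w => (I t w - I s w) ^+ 2) /\
    \int[P]_w (I t w - I s w) ^+ 2 <= C * (t - s).
Proof.
move=> tmax0; have [C C0 HC] := time_integral_sqr_bound tmax0 sigma_lip.
exists (2 * C) => [|s t s0 st tt]; first exact: mulr_ge0.
have z0 (w : T) : `|cst (0 : R) w| <= 0 :> R by rewrite normr0.
have [_ i1 h] := @ito_L2 t (le_trans s0 st) s (cst 0) (cst 0) 0 0 s0 st
  (@ameas_cst _ _ _ _ B X0 s 0) (@ameas_cst _ _ _ _ B X0 s 0) z0 z0.
have E0 : (fun w => (I t w - I s w - cst 0 w * (B t w - B s w) - cst 0 w) ^+ 2)
    = fun w => (I t w - I s w) ^+ 2.
  by apply/funext => w; rewrite /= mul0r !subr0.
have E1 : (fun w => tint (fun u => (sigma (X u w) - cst 0 w) ^+ 2) s t)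
    = fun w => tint (fun u => sigma (X u w) ^+ 2) s t.
  by apply/funext => w; congr (tint _ s t); apply/funext => u; rewrite subr0.
have E2 : \int[P]_w (cst 0 w : R) ^+ 2 = 0.
  by rewrite -[RHS](Rintegral_probability_cst P 0); apply: eq_Rintegral => w _; rewrite expr0n.
rewrite E0 in i1 h; rewrite E1 E2 add0r in h; split => //.
apply: (le_trans h); rewrite -mulrA ler_pM2l//.
by have [_] := HC s t s0 st tt.
Qed.

(** Drift and martingale part contribute O(t - s). The increment of [K] stays as a separate term,
    squared, since nothing yet relates it to [t - s]. *)
Lemma mean_square_increment tmax : 0 <= tmax ->
  exists2 C, 0 <= C & forall s t, 0 <= s -> s <= t -> t <= tmax ->
    intg (fun w => (X t w - X s w) ^+ 2) /\
    \int[P]_w (X t w - X s w) ^+ 2 <= C * ((t - s) + (K t - K s) ^+ 2).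
Proof.
move=> tmax0; have [Cb Cb0 Hb] := time_integral_sqr_bound tmax0 b_lip.
have [CI CI0 HI] := martingale_part_sqr tmax0.
exists (4 * (tmax * Cb + CI + 1)) => [|s t s0 st tt].
  by rewrite mulr_ge0// !addr_ge0// mulr_ge0.
have [ib Eb] := Hb s t s0 st tt; have [iI EI] := HI s t s0 st tt.
have t0 := le_trans s0 st.
have bi s' t' w : leb.-integrable `[s', t'] (EFin \o (fun u => b (X u w))).
  by apply: continuous_itv_integrable; exact: drift_continuous Xc Lip0 b_lip w.
have b2i s' t' w : leb.-integrable `[s', t'] (EFin \o (fun u => b (X u w) ^+ 2)).
  apply: continuous_itv_integrable => u.
  by apply: cvgM; exact: (drift_continuous Xc Lip0 b_lip (w := w)).
have le w : (X t w - X s w) ^+ 2 <= 4 * (((t - s) * tint (fun u => b (X u w) ^+ 2) s t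
    + (I t w - I s w) ^+ 2) + (K t - K s) ^+ 2).
  have -> : X t w - X s w = tint (fun u => b (X u w)) s t + (I t w - I s w)
      + (K t - K s) + 0.
    by rewrite !X_eq// (@tint_split _ _ 0 s t)//; ring.
  apply: le_trans (sqr_add4_le _ _ _ _) _; rewrite ler_pM2l// expr0n/= addr0 !lerD2r.
  exact: tint_sqr_le.
have ic : intg (fun=> (K t - K s) ^+ 2) by exact: finite_measure_integrable_cst.
have i0 := rintegrableZl measurableT (t - s) ib.
have i1 := rintegrableD measurableT i0 iI.
have i2 := rintegrableD measurableT i1 ic.
have i3 := rintegrableZl measurableT 4 i2.
have i4 : intg (fun w => (X t w - X s w) ^+ 2).
  apply: rintegrable_le i3 => //; first by apply: measurable_funX; exact: measurable_funB.
  by move=> w _; rewrite ger0_norm ?sqr_ge0.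
split => //; apply: (le_trans (le_Rintegral _ i4 i3 _)) => //.
rewrite RintegralZl// RintegralD// RintegralD// Rintegral_probability_cst RintegralZl//.
rewrite -mulrA ler_pM2l//.
have ts0 : 0 <= t - s by rewrite subr_ge0.
have k0 := sqr_ge0 (K t - K s).
have h1 : (t - s) * \int[P]_w tint (fun u => b (X u w) ^+ 2) s t <= tmax * (Cb * (t - s)).
  apply: ler_pM => //; last by rewrite lerBlDr (le_trans tt)// lerDl.
  by apply: Rintegral_ge0 => w _; apply: tint_ge0 => u _; exact: sqr_ge0.
have h2 : 0 <= tmax * Cb * (K t - K s) ^+ 2 by apply: mulr_ge0 => //; exact: mulr_ge0.
have h3 : 0 <= CI * (K t - K s) ^+ 2 by exact: mulr_ge0.
apply: (@le_trans _ _ (tmax * (Cb * (t - s)) + CI * (t - s) + (K t - K s) ^+ 2)).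
  by rewrite lerD2r; exact: lerD.
rewrite -subr_ge0 (_ : _ - _ = tmax * Cb * (K t - K s) ^+ 2 + CI * (K t - K s) ^+ 2 + (t - s)).
  by rewrite addr_ge0// addr_ge0.
by ring.
Qed.

Lemma mean_square_cvg s :
  \int[P]_w (X t w - X s w) ^+ 2 @[t --> s] --> (0 : R).
Proof.
pose p (t : R) : R := Num.max t 0.
have p0 t : 0 <= p t by rewrite le_max lexx orbT.
have [C C0 HC] := mean_square_increment (addr_ge0 (p0 s) (@ler01 R)).
pose F t := C * (`|p t - p s| + (K (p t) - K (p s)) ^+ 2).
have pc : continuous p := @max0_continuous R.
have Fc : F t @[t --> s] --> F s.
  apply: cvgM; first exact: cvg_cst.
  apply: cvgD; first by apply: cvg_norm; apply: cvgB; [exact: pc|exact: cvg_cst].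
  by apply: cvgM; apply: cvgB; try exact: cvg_cst; apply: (cvg_comp _ _ (pc s)); exact: Kc.
have F0 : F s = 0 by rewrite /F !subrr normr0 expr0n/= addr0 mulr0.
rewrite F0 in Fc.
apply: (squeeze_cvgr _ (cvg_cst _) Fc); near=> t.
have tt : p t <= p s + 1.
  near: t; apply: cvgr_le (pc s) _ _; by rewrite ltrDl.
rewrite Rintegral_ge0 ?andTb//=; last by move=> w _; exact: sqr_ge0.
rewrite (X_neg t) (X_neg s) -/(p t) -/(p s) /F.
have [pst|/ltW pts] := leP (p s) (p t).
  by rewrite (@ger0_norm _ (p t - p s)) ?subr_ge0//; have [] := HC (p s) (p t) (p0 s) pst tt.
rewrite distrC (@ger0_norm _ (p s - p t)) ?subr_ge0//.
have [|_ h] := HC (p t) (p s) (p0 t) pts; first by rewrite lerDl.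
rewrite -(sqrrN (K _ - _)) opprB; apply: le_trans h.
by under eq_Rintegral do rewrite -sqrrN opprB.
Unshelve. all: by end_near. Qed.

End mean_square.

(** * Continuity in time of expectations under quadratic growth *)

Section expectation_continuity.
Context d (T : measurableType d) (R : realType) (P : probability T R).
Local Notation intg f := (P.-integrable setT (EFin \o f)).
Variable X : R -> T -> R.
Hypotheses (Xc : forall w, continuous (X ^~ w)) (Xm : forall u, measurable_fun setT (X u)).
Hypothesis iX : forall u, intg (fun w => X u w ^+ 2).
Hypothesis X_cvg : forall s, \int[P]_w (X t w - X s w) ^+ 2 @[t --> s] --> (0 : R).
Variables (F : R -> R) (C : R).
Hypotheses (Fc : continuous F) (F_growth : forall x, `|F x| <= C * (1 + x ^+ 2)).

Let C0 : 0 <= C.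
Proof.
by have := F_growth 0; rewrite expr0n addr0 mulr1; apply: le_trans.
Qed.

Let mF u : measurable_fun setT (fun w => F (X u w)).
Proof. by apply: measurableT_comp => //; exact: continuous_measurable_fun. Qed.

Lemma growth_integrable u : intg (fun w => F (X u w)).
Proof.
have i1 : intg (fun w => C * (1 + X u w ^+ 2)).
  by apply: rintegrableZl => //; apply: rintegrableD => //; exact: finite_measure_integrable_cst.
exact: rintegrable_le i1.
Qed.

(* Dominated convergence applies to the part of [|F (X t) - F (X s)|] exceeding
   [2 C (X t - X s)^2], whose expectation vanishes in the limit. *)
Lemma growth_expectation_continuous : continuous (fun t => \int[P]_w F (X t w)).
Proof.
move=> s; apply: (@cvg_nbhsP R R^o _ _ _).2 => v vs.
have Vs := (@cvg_nbhsP R R^o _ _ _).1 (X_cvg s) v vs.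
pose Q n w := (X (v n) w - X s w) ^+ 2.
pose Y n w := Num.max (`|F (X (v n) w) - F (X s w)| - 2 * C * Q n w) 0.
(* By (X (v n))^2 <= 2 Q n + 2 (X s)^2, subtracting [2 * C * Q n] removes the dependence on
   [X (v n)] from the growth bound. *)
pose G w := C * (2 + 3 * X s w ^+ 2).
have mQ n : measurable_fun setT (Q n) by apply: measurable_funX; exact: measurable_funB.
have iG : intg G.
  apply: rintegrableZl => //; apply: rintegrableD => //.
    exact: finite_measure_integrable_cst.
  exact: rintegrableZl.
have iQ n : intg (Q n).
  apply: (@rintegrable_le _ _ _ P setT measurableT _
      (fun w => 2 * X (v n) w ^+ 2 + 2 * X s w ^+ 2)) => //.
    by move=> w _; rewrite ger0_norm ?sqr_ge0//; exact: sqrB_le.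
  by apply: rintegrableD => //; exact: rintegrableZl.
have mD n : measurable_fun setT (fun w => `|F (X (v n) w) - F (X s w)|).
  by apply: measurableT_comp => //; exact: measurable_funB.
have mY n : measurable_fun setT (Y n).
  apply: measurable_maxr => //; apply: measurable_funB => //.
  exact: measurable_funM.
have Y0 n w : 0 <= Y n w by rewrite le_max lexx orbT.
have G0 w : 0 <= G w by rewrite mulr_ge0// addr_ge0// mulr_ge0// sqr_ge0.
have YG n w : setT w -> `|Y n w| <= G w.
  move=> _; rewrite ger0_norm// ge_max G0 andbT lerBlDr.
  apply: (le_trans (ler_normB _ _)).
  apply: (le_trans (lerD (F_growth _) (F_growth _))).
  rewrite -mulrDr /G (_ : 2 * C * Q n w = C * (2 * Q n w)); last by ring.
  rewrite -mulrDr ler_wpM2l//.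
  have := sqr_le_sqrB (X (v n) w) (X s w); rewrite -/(Q n w).
  lra.
have Yc w : Y n w @[n --> \oo] --> (0 : R).
  have c1 : X (v n) w @[n --> \oo] --> X s w := (@cvg_nbhsP R R^o _ _ _).1 (@Xc w s) v vs.
  have c2 : F (X (v n) w) @[n --> \oo] --> F (X s w) by apply: (cvg_comp _ _ c1); exact: Fc.
  have c3 : `|F (X (v n) w) - F (X s w)| @[n --> \oo] --> (0 : R).
    have : `|F (X (v n) w) - F (X s w)| @[n --> \oo] --> `|F (X s w) - F (X s w)|.
      by apply: cvg_norm; apply: cvgB => //; exact: cvg_cst.
    by rewrite subrr normr0.
  apply: (squeeze_cvgr _ (cvg_cst _) c3); apply: nearW => n.
  by rewrite Y0/= ge_max normr_ge0 andbT lerBlDr lerDl mulr_ge0 ?sqr_ge0// mulr_ge0.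
have [_ EY] := @Rintegral_dct _ _ _ P setT measurableT Y (cst 0) G mY
  (@measurable_cst _ _ _ _ setT (0 : R)) iG YG (aeW _ (fun w _ => Yc w)).
rewrite Rintegral_probability_cst in EY.
have iY n : intg (Y n) by apply: rintegrable_le iG => //; exact: YG.
have lim0 : \int[P]_w Y n w + 2 * C * \int[P]_w Q n w @[n --> \oo] --> (0 : R).
  have Vs' : 2 * C * \int[P]_w Q n w @[n --> \oo] --> 2 * C * (0 : R).
    exact: cvgMl_tmp Vs.
  by have EV := cvgD EY Vs'; rewrite mulr0 addr0 in EV; exact: EV.
apply/cvgrPdist_le => e e0; have /cvgrPdist_le/(_ e e0) := lim0.
apply: filterS => n; rewrite sub0r normrN => he.
rewrite distrC -RintegralB//; try exact: growth_integrable.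
apply: le_trans (le_trans (ler_norm _) he).
have iD : intg (fun w => F (X (v n) w) - F (X s w)).
  by apply: rintegrableB => //; exact: growth_integrable.
apply: (le_trans (le_normr_Rintegral measurableT iD)).
have iZ := rintegrableZl measurableT (2 * C) (iQ n).
rewrite -RintegralZl// -RintegralD//; apply: le_Rintegral => //.
- have := integrable_norm iD; exact: eq_integrable.
- exact: rintegrableD.
by move=> w _; rewrite /Y -lerBlDr le_max lexx.
Qed.

End expectation_continuity.

(** * Second order expansion *)

Section taylor.
Context {R : realType}.
Implicit Types (f df h : R -> R) (x y : R).

Lemma measurable_inv : measurable_fun setT (fun x : R => x^-1).
Proof.
rewrite -(setUv [set (0 : R)]); apply/measurable_funU => //; first exact: measurableC.
split; first exact: measurable_fun_set1.
apply: open_continuous_measurable_fun.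
  by rewrite openC; apply: accessible_closed_set1; apply: hausdorff_accessible; exact: Rhausdorff.
by move=> x; rewrite inE/= => /eqP x0; apply: cvgV => //; exact: cvg_id.
Qed.

Lemma mean_value f df x y : (forall z, is_derive z (1 : R) f (df z)) ->
  exists2 c, `|c - x| <= `|y - x| & f y - f x = df c * (y - x).
Proof.
move=> fdf; have fc : continuous f by move=> z; exact/differentiable_continuous/derivable1_diffP.
have [xy|/ltW yx] := leP x y.
  have [c cxy E] := MVT_segment xy (fun z _ => fdf z) (continuous_subspaceT fc).
  exists c => //; move: cxy; rewrite in_itv/= => /andP[xc cy].
  by rewrite !ger0_norm ?subr_ge0// lerD2r.
have [c cxy E] := MVT_segment yx (fun z _ => fdf z) (continuous_subspaceT fc).
exists c; last by rewrite -opprB E -mulrN opprB.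
move: cxy; rewrite in_itv/= => /andP[xc cy].
by rewrite !ler0_norm ?subr_le0// lerN2 lerD2r.
Qed.

Lemma derivative_lipschitz f C : (forall z, derivable f z 1) ->
  (forall z, `|derive1 f z| <= C) -> forall x y, `|f x - f y| <= C * `|x - y|.
Proof.
move=> df fC x y.
have [z|c _ ->] := @mean_value f (derive1 f) y x.
  by rewrite derive1E; exact: derivableP.
by rewrite normrM ler_wpM2r.
Qed.

Definition taylor2_remainder h x y : R :=
  h y - h x - derive1 h x * (y - x) - 2^-1 * derive1n 2 h x * (y - x) ^+ 2.

(** Two applications of the mean value theorem: to [h] minus its Taylor polynomial, and to the
    derivative of that difference, whose slope is the oscillation of [h'']. *)
Lemma taylor2_remainder_le h x y e :
  (forall z, derivable h z 1) -> (forall z, derivable (derive1 h) z 1) ->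
  (forall z, `|z - x| <= `|y - x| -> `|derive1n 2 h z - derive1n 2 h x| <= e) ->
  `|taylor2_remainder h x y| <= e * (y - x) ^+ 2.
Proof.
move=> h1 h2 he; set k1 := derive1 h x; set k2 := derive1n 2 h x.
pose k z := h z - k1 * z - 2^-1 * k2 * (z - x) ^+ 2.
pose k' z := derive1 h z - k1 - k2 * (z - x).
pose j z := derive1 h z - k2 * z.
have jd z : is_derive z (1 : R) j (derive1n 2 h z - k2).
  have d1 : is_derive z (1 : R) (derive1 h) (derive1n 2 h z).
    by rewrite /= derive1E; exact: derivableP.
  rewrite /j; apply: is_derive_eq; rewrite ?scaler0 ?add0r.
  by rewrite -[in RHS](mulr1 k2).
have kd z : is_derive z (1 : R) k (k' z).
  have d1 : is_derive z (1 : R) h (derive1 h z) by rewrite derive1E; exact: derivableP.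
  rewrite /k; apply: is_derive_eq; rewrite /k' /GRing.scale/=; lra.
have [c cx E] := mean_value x y kd.
have [c' c'x E'] := mean_value x c jd.
have -> : taylor2_remainder h x y = (derive1n 2 h c' - k2) * (c - x) * (y - x).
  rewrite -E' (_ : j c - j x = k' c); last by rewrite /j /k' /k1; ring.
  by rewrite -E /taylor2_remainder /k /k1 /k2; ring.
rewrite !normrM -[(y - x) ^+ 2](ger0_norm (sqr_ge0 _)) normrX expr2 mulrA.
apply: ler_wpM2r => //; apply: ler_pM => //.
by apply: he; exact: le_trans cx.
Qed.

(** Takes the value 0 at [y = x], the inverse of 0 being 0, so that [taylor2E] also holds there. *)
Definition taylor2_quotient h x y : R := taylor2_remainder h x y / (y - x) ^+ 2.

Lemma taylor2E h x y :
  h y - h x = derive1 h x * (y - x)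
    + (2^-1 * derive1n 2 h x + taylor2_quotient h x y) * (y - x) ^+ 2.
Proof.
have [->|yx] := eqVneq y x; first by rewrite !subrr expr0n/= !mulr0 addr0.
rewrite /taylor2_quotient mulrDl divfK ?expf_neq0 ?subr_eq0// /taylor2_remainder.
by ring.
Qed.

Section quotient.
Variables (h : R -> R) (C : R).
Hypothesis h_C2 : twice_continuously_differentiable h.
Hypothesis h2_bounded : forall x, `|derive1n 2 h x| <= C.

Lemma taylor2_quotient_bounded x y : `|taylor2_quotient h x y| <= 2 * C.
Proof.
have [h1 h2 _] := h_C2.
have [->|yx] := eqVneq y x.
  rewrite /taylor2_quotient subrr expr0n/= invr0 mulr0 normr0 mulr_ge0//.
  exact: le_trans (h2_bounded 0).
rewrite /taylor2_quotient normrM normrV ?unitfE ?expf_neq0 ?subr_eq0//.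
rewrite (ger0_norm (sqr_ge0 _)) ler_pdivrMr ?exprn_even_gt0 ?subr_eq0//.
apply: (taylor2_remainder_le h1 h2) => z _.
apply: (le_trans (ler_normB _ _)); rewrite mulrDl mul1r.
by apply: lerD; exact: h2_bounded.
Qed.

Lemma taylor2_quotient_cvg x : taylor2_quotient h x y @[y --> x] --> (0 : R).
Proof.
have [h1 h2 h3] := h_C2.
apply/cvgrPdist_le => e e0.
have [r r0 Hr] := continuous_lim_eps (h3 x) e0.
near=> y; rewrite sub0r normrN.
have yr : `|y - x| < r.
  by near: y; exists r => //= y /=; rewrite distrC.
have [->|yx] := eqVneq y x.
  by rewrite /taylor2_quotient subrr expr0n/= invr0 mulr0 normr0 ltW.
rewrite /taylor2_quotient normrM normrV ?unitfE ?expf_neq0 ?subr_eq0//.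
rewrite (ger0_norm (sqr_ge0 _)) ler_pdivrMr ?exprn_even_gt0 ?subr_eq0//.
apply: (taylor2_remainder_le h1 h2) => z zy; apply: ltW; apply: Hr.
exact: le_lt_trans yr.
Unshelve. all: by end_near. Qed.

Lemma measurable_taylor2_quotient d (T : measurableType d) (X Y : T -> R) :
  measurable_fun setT X -> measurable_fun setT Y ->
  measurable_fun setT (fun w => taylor2_quotient h (X w) (Y w)).
Proof.
move=> mX mY; have [h1 h2 h3] := h_C2.
have c0 : continuous h by move=> z; exact/differentiable_continuous/derivable1_diffP.
have c1 : continuous (derive1 h) by move=> z; exact/differentiable_continuous/derivable1_diffP.
have mh (f : R -> R) Z : continuous f -> measurable_fun setT Z ->
    measurable_fun setT (fun w : T => f (Z w)).
  by move=> fc mZ; apply: measurableT_comp => //; exact: continuous_measurable_fun.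
have mYX : measurable_fun setT (fun w => Y w - X w) by exact: measurable_funB.
apply: measurable_funM; last first.
  by apply: measurableT_comp; [exact: measurable_inv|exact: measurable_funX].
apply: measurable_funB; last first.
  apply: measurable_funM; last exact: measurable_funX.
  by apply: measurable_funM => //; exact: mh.
apply: measurable_funB; first by apply: measurable_funB; exact: mh.
by apply: measurable_funM => //; exact: mh.
Qed.

(** The quotient is bounded and tends to 0 along each continuous path. Continuity of [h''] gives no
    rate, and none is claimed. *)
Lemma taylor2_quotient_L2_cvg d (T : measurableType d) (P : probability T R)
    (X : R -> T -> R) s : (forall w, continuous (X ^~ w)) ->
  (forall u, measurable_fun setT (X u)) ->
  \int[P]_w taylor2_quotient h (X s w) (X t w) ^+ 2 @[t --> s] --> (0 : R).
Proof.
move=> Xc Xm; apply: (@cvg_nbhsP R R^o _ _ _).2 => v vs.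
pose W n w := taylor2_quotient h (X s w) (X (v n) w) ^+ 2.
have mW n : measurable_fun setT (W n).
  by apply: measurable_funX; exact: measurable_taylor2_quotient.
have Wc w : W n w @[n --> \oo] --> (0 : R).
  have c1 : X (v n) w @[n --> \oo] --> X s w := (@cvg_nbhsP R R^o _ _ _).1 (@Xc w s) v vs.
  have c2 : taylor2_quotient h (X s w) (X (v n) w) @[n --> \oo] --> (0 : R).
    by apply: (cvg_comp _ _ c1); exact: taylor2_quotient_cvg.
  by have H := cvgM c2 c2; rewrite mulr0 in H; exact: H.
have Wb n w : setT w -> `|W n w| <= (2 * C) ^+ 2.
  move=> _; rewrite normrX lerXn2r ?nnegrE//; last exact: taylor2_quotient_bounded.
  exact: le_trans (taylor2_quotient_bounded 0 0).
have ic : P.-integrable setT (EFin \o (fun=> (2 * C) ^+ 2)).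
  exact: finite_measure_integrable_cst.
have [_] := @Rintegral_dct _ _ _ P setT measurableT W (cst 0) (fun=> (2 * C) ^+ 2) mW
  (@measurable_cst _ _ _ _ setT (0 : R)) ic Wb (aeW _ (fun w _ => Wc w)).
by rewrite Rintegral_probability_cst.
Qed.

End quotient.
End taylor.

Section expansion_arithmetic.
Context {R : realFieldType}.
Implicit Types e x y z : R.

Lemma norm_le_amgm e x : 0 < e -> `|x| <= 2^-1 * (e + e^-1 * x ^+ 2).
Proof.
move=> e0; rewrite -(@ler_pM2l _ (2 * e)) ?mulr_gt0//.
rewrite (_ : 2 * e * (2^-1 * _) = e ^+ 2 + x ^+ 2); last by field; rewrite gt_eqF.
rewrite -subr_ge0 -[x ^+ 2]real_normK ?num_real//.
by rewrite (_ : _ - _ = (e - `|x|) ^+ 2) ?sqr_ge0//; ring.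
Qed.

Lemma norm_mul_le_amgm e x y : 0 < e -> `|2 * (x * y)| <= e * x ^+ 2 + e^-1 * y ^+ 2.
Proof.
move=> e0; rewrite -(ler_pM2l e0) -{1}(gtr0_norm e0) -normrM.
rewrite (_ : e * (e * _ + _) = (e * x) ^+ 2 + y ^+ 2); last by field; rewrite gt_eqF.
have h1 := sqr_ge0 (e * x - y); have h2 := sqr_ge0 (e * x + y).
by rewrite ler_norml; apply/andP; split; move: h1 h2; rewrite !expr2; lra.
Qed.

(** An increment of [X] is written [z * u + r], with [u] the Brownian increment. The cross term is
    split with weight [e]. The Taylor correction [q] is multiplied by [u ^+ 2], and the weight
    [c / dt] balances the expectation of [u ^+ 4], of order dt^2; this is where [z] has to be
    bounded by [L]. *)
Lemma second_order_arith (e c dt L V k q z u r C : R) :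
  0 < e -> 0 < c -> 0 < dt -> `|V| <= 3 * C -> V = k + q -> z ^+ 2 <= L ^+ 2 ->
  `|V * (z * u + r) ^+ 2 - k * z ^+ 2 * u ^+ 2| <=
  3 * C * (e * (z ^+ 2 * u ^+ 2) + (1 + e^-1) * r ^+ 2) +
  L ^+ 2 / 2 * (c * dt^-1 * u ^+ 4 + c^-1 * dt * q ^+ 2).
Proof.
move=> e0 c0 dt0 VC VE zL.
have -> : V * (z * u + r) ^+ 2 - k * z ^+ 2 * u ^+ 2 =
    V * (2 * (z * u * r) + r ^+ 2) + z ^+ 2 * (q * u ^+ 2) by rewrite VE; ring.
apply: (le_trans (ler_normD _ _)); apply: lerD.
  rewrite normrM; apply: ler_pM => //; apply: (le_trans (ler_normD _ _)).
  rewrite (ger0_norm (sqr_ge0 r)) (_ : (1 + e^-1) * r ^+ 2 = e^-1 * r ^+ 2 + r ^+ 2); last by ring.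
  rewrite addrA lerD2r.
  by rewrite -exprMn; exact: norm_mul_le_amgm.
rewrite normrM (ger0_norm (sqr_ge0 z)) -mulrA; apply: ler_pM => //; first exact: sqr_ge0.
have cd : 0 < c * dt^-1 by rewrite divr_gt0.
have := norm_mul_le_amgm (u ^+ 2) q cd.
rewrite normrM (ger0_norm (ler0n _ 2)) (mulrC (u ^+ 2) q) -exprM invfM invrK => H.
by rewrite ler_pdivlMl.
Qed.

End expansion_arithmetic.

Lemma lipschitz_norm_growth (R : realFieldType) (f : R -> R) (C : R) :
  (forall x y, `|f x - f y| <= C * `|x - y|) ->
  forall x, `|f x| <= (`|f 0| + C) * (1 + x ^+ 2).
Proof.
move=> fC x; have hd := fC x 0; rewrite subr0 in hd.
have C0 : 0 <= C by have := le_trans (normr_ge0 _) (fC 1 0); rewrite subr0 normr1 mulr1.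
have := norm_le_amgm x (@ltr01 R); rewrite invr1 mul1r => xa.
have x2 := sqr_ge0 x.
have h3 : C * `|x| <= C * (1 + x ^+ 2) by rewrite ler_wpM2l//; lra.
have h4 : 0 <= `|f 0| * x ^+ 2 by exact: mulr_ge0.
have := ler_normD (f x - f 0) (f 0); rewrite subrK; move: hd h3 h4; lra.
Qed.

(** * Expansion of the expectation of [h] over one time step *)

Section local_expansion.
Context d (T : measurableType d) (R : realType) (P : probability T R).
Variables (B : R -> {RV P >-> R}) (X0 : {RV P >-> R}).
Notation leb := (@lebesgue_measure R).
Hypothesis P_complete : measure_is_complete P.
Hypothesis B_bm : brownian_motion B.
Hypothesis B_X0_indep :
  independent_systems P (sigma_of X0) (sigma_path (fun t => B t)).
Local Notation intg f := (P.-integrable setT (EFin \o f)).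
Local Notation ameas := (ameas B X0).
Variables (X I : R -> T -> R) (K b sigma : R -> R) (Lip : R).
Variable phi : nat -> simple_process (augmented_filtration P X0 (fun t => B t)).
Hypotheses (Xc : forall w, continuous (X ^~ w)) (Xm : forall u, measurable_fun setT (X u)).
Hypothesis Xa : forall u, 0 <= u -> ameas u (X u).
Hypothesis Knd : {homo K : x y / x <= y}.
Hypothesis Lip0 : 0 <= Lip.
Hypothesis b_lip : forall x y, `|b x - b y| <= Lip * `|x - y|.
Hypothesis sigma_lip : forall x y, `|sigma x - sigma y| <= Lip * `|x - y|.
Hypothesis mI : forall t, 0 <= t -> measurable_fun setT (I t).
Hypothesis phiH : forall t e : R, 0 <= t -> 0 < e ->
  P [set w | e <= tint (fun u => (sp_fun (phi n) u w - sigma (X u w)) ^+ 2) 0 t]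
    @[n --> \oo] --> 0%E.
Hypothesis phiI : forall t e : R, 0 <= t -> 0 < e ->
  P [set w | e <= `|sp_integral (phi n) (fun r => B r) t w - I t w|]
    @[n --> \oo] --> 0%E.
Hypothesis X_eq : forall w t, 0 <= t ->
  X t w = X0 w + tint (fun u => b (X u w)) 0 t + I t w + K t.
Hypothesis iX0 : intg (fun w => X0 w ^+ 2).

Hypothesis Kc : continuous K.
Hypothesis X_neg : forall u, X u = X (Num.max u 0).

Variables (h : R -> R) (Ch : R).
Hypothesis h_C2 : twice_continuously_differentiable h.
Hypothesis h1_bounded : forall x, `|derive1 h x| <= Ch.
Hypothesis h2_bounded : forall x, `|derive1n 2 h x| <= Ch.
Variables (s t : R).
Hypotheses (s0 : 0 <= s) (st : s < t).

Let st' : s <= t := ltW st.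
Let t0 : 0 <= t := le_trans s0 st'.
Let dt : R := t - s.
Let dK : R := K t - K s.
Let dt0 : 0 < dt. Proof. by rewrite subr_gt0. Qed.
Let dK0 : 0 <= dK. Proof. by rewrite subr_ge0 Knd. Qed.
Let Ch0 : 0 <= Ch. Proof. exact: le_trans (h1_bounded 0). Qed.

Variables (C2 Cb : R).
Hypothesis C20 : 0 <= C2.
Hypothesis incr : forall u, s <= u -> u <= t -> intg (fun w => (X u w - X s w) ^+ 2) /\
  \int[P]_w (X u w - X s w) ^+ 2 <= C2 * ((u - s) + (K u - K s) ^+ 2).
Hypothesis drift_sqr : intg (fun w => tint (fun u => b (X u w) ^+ 2) s t) /\
  \int[P]_w tint (fun u => b (X u w) ^+ 2) s t <= Cb * dt.

Let iX := X_sqr_integrable P_complete B_bm B_X0_indep Xc Xm Knd Lip0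
  b_lip sigma_lip mI phiH phiI X_eq iX0 X_neg.

Let J w := tint (fun u => (X u w - X s w) ^+ 2) s t.

Let path_incr_integrable w : leb.-integrable `[s, t] (EFin \o (fun u => (X u w - X s w) ^+ 2)).
Proof.
apply: continuous_itv_integrable => u.
by apply: cvgM; apply: cvgB; by [exact: Xc|exact: cvg_cst].
Qed.

Let EJ : intg J /\ \int[P]_w J w <= C2 * (dt + dK ^+ 2) * dt.
Proof.
rewrite -tint_cst//; apply: tint_expectation_le.
- apply: measurable_funX; apply: measurable_funB; first exact: (X_joint Xc Xm).
  by apply: measurableT_comp => //; exact: measurable_snd.
- by move=> u w; exact: sqr_ge0.
- exact: path_incr_integrable.
- by apply: (@itv_integrable _ _ _ _ `|C2 * (dt + dK ^+ 2)|).
move=> u /andP[su ut]; have [i1 h1] := incr su ut.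
rewrite -[leLHS]fineK; last exact: integrable_fin_num i1.
rewrite lee_fin; apply: (le_trans h1); rewrite ler_wpM2l//; apply: lerD.
  by rewrite lerD2r.
by rewrite lerXn2r ?nnegrE ?subr_ge0 ?Knd// lerD2r Knd.
Qed.

Let J0 w : 0 <= J w.
Proof. by apply: tint_ge0 => u _; exact: sqr_ge0. Qed.

Let sig w := sigma (X s w).

Let msig : measurable_fun setT sig.
Proof.
apply: measurableT_comp => //; apply: continuous_measurable_fun.
exact: (lipschitz_continuous Lip0 sigma_lip).
Qed.

Let isig : intg (fun w => sig w ^+ 2).
Proof.
pose c := 2 * sigma 0 ^+ 2 + 2 * Lip ^+ 2.
apply: (@rintegrable_le _ _ _ P setT measurableT _ (fun w => c * (1 + X s w ^+ 2))).
- exact: measurable_funX.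
- move=> w _; rewrite ger0_norm ?sqr_ge0//.
  by have := lipschitz_growth Lip0 sigma_lip (lexx c) (X s w).
by apply: rintegrableZl => //; apply: rintegrableD => //; exact: finite_measure_integrable_cst.
Qed.

Variable L : R.
Hypothesis L0 : 0 <= L.

(** [sig] is only known to be square integrable, whereas [ito_L2] and the term in [U w ^+ 4] ask for
    a bounded coefficient. Cutting to 0, instead of clamping, makes [Z w] either [sig w] or 0. *)
Let Z w := sig w * (`|sig w| <= L)%R%:R.
Let U w := B t w - B s w.
Let zeta := \int[P]_w (sig w - Z w) ^+ 2.

Let Z_bounded w : `|Z w| <= L.
Proof.
rewrite /Z; have [sL|_] := boolP (`|sig w| <= L); first by rewrite mulr1.
by rewrite mulr0 normr0.
Qed.

Let Z_le w : Z w ^+ 2 <= sig w ^+ 2.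
Proof.
rewrite /Z; case: (`|sig w| <= L); first by rewrite mulr1.
by rewrite mulr0 expr0n/= sqr_ge0.
Qed.

Let Z_ameas : ameas s Z.
Proof.
apply: (@ameas_comp _ _ _ _ _ _ _ _ (fun x => sigma x * (`|sigma x| <= L)%R%:R) (Xa s0)).
have ms : measurable_fun setT sigma.
  by apply: continuous_measurable_fun; exact: (lipschitz_continuous Lip0 sigma_lip).
apply: measurable_funM => //.
rewrite (_ : (fun _ => _) = \1_[set x | `|sigma x| <= L]).
  by apply: measurable_indic; apply: measurable_set_le; exact: measurableT_comp.
by apply/funext => x; rewrite indicE mem_setE.
Qed.

Let mZ : measurable_fun setT Z := ameas_measurable P_complete Z_ameas.

Let izeta : intg (fun w => (sig w - Z w) ^+ 2).
Proof.
apply: rintegrable_le isig => //; first by apply: measurable_funX; exact: measurable_funB.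
move=> w _; rewrite ger0_norm ?sqr_ge0// /Z; case: (`|sig w| <= L); last by rewrite mulr0 subr0.
by rewrite mulr1 subrr expr0n/= sqr_ge0.
Qed.

Let Res w := X t w - X s w - Z w * U w.

Let mU : measurable_fun setT U.
Proof. exact: measurable_funB. Qed.

Let mRes : measurable_fun setT Res.
Proof.
apply: measurable_funB; first exact: measurable_funB.
exact: measurable_funM.
Qed.

(** The residual consists of the drift, the integral minus [Z w * U w], and the increment of [K]. In
    the bound every term is negligible with respect to [dt + dK] except the multiple of [dt * zeta],
    which is made small through [L]. *)
Lemma residual_sqr : intg (fun w => Res w ^+ 2) /\
  \int[P]_w Res w ^+ 2 <= 4 * (dt * (Cb * dt) +
     2 * (2 * Lip ^+ 2 * (C2 * (dt + dK ^+ 2) * dt) + 2 * dt * zeta) + dK ^+ 2).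
Proof.
have [iJ hJ] := EJ; have [ib hb] := drift_sqr.
have z0 (w : T) : `|cst (0 : R) w| <= 0 :> R by rewrite normr0.
have [i1 i2 h2] := ito_L2 P_complete B_bm B_X0_indep
  (diffusion_joint Xc Xm Lip0 sigma_lip) (diffusion_continuous Xc Lip0 sigma_lip)
  mI phiH phiI t0 (diffusion_sqr_integrable P_complete B_bm B_X0_indep Xc Xm Knd Lip0
  b_lip sigma_lip mI phiH phiI X_eq iX0 t0) s0 st' Z_ameas (@ameas_cst _ _ _ _ B X0 s 0) Z_bounded z0.
have E0 : (fun w => (I t w - I s w - Z w * (B t w - B s w) - cst 0 w) ^+ 2)
    = fun w => (I t w - I s w - Z w * U w) ^+ 2.
  by apply/funext => w; rewrite /= subr0.
have E2 : \int[P]_w (cst 0 w : R) ^+ 2 = 0.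
  by rewrite -[RHS](Rintegral_probability_cst P 0); apply: eq_Rintegral => w _; rewrite expr0n.
rewrite E0 in i2 h2; rewrite E2 add0r in h2.
have i3 := rintegrableD measurableT (rintegrableZl measurableT (2 * Lip ^+ 2) iJ)
  (rintegrableZl measurableT (2 * dt) izeta).
have h3 : \int[P]_w tint (fun u => (sigma (X u w) - Z w) ^+ 2) s t <=
    2 * Lip ^+ 2 * (C2 * (dt + dK ^+ 2) * dt) + 2 * dt * zeta.
  apply: (le_trans (le_Rintegral _ i1 i3 _)) => //.
    move=> w _.
    have j1 := tintegrableZl (2 * Lip ^+ 2) (path_incr_integrable w).
    have j2 : leb.-integrable `[s, t] (EFin \o (fun=> 2 * (sig w - Z w) ^+ 2)).
      by apply: (@itv_integrable _ _ _ _ `|2 * (sig w - Z w) ^+ 2|).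
    apply: (le_trans (le_tint _ (tintegrableD j1 j2) _)).
    - apply: continuous_itv_integrable => u.
      by apply: cvgM; apply: cvgB; by [exact: (diffusion_continuous Xc Lip0 sigma_lip)|exact: cvg_cst].
    - move=> u _; apply: (le_trans (sqrB_le_trans _ (sig w) _)); rewrite lerD2r.
      rewrite -[leRHS]mulrA ler_pM2l//; exact: (lipschitz_sqr Lip0 sigma_lip).
    rewrite tintD// tintZl; last exact: path_incr_integrable.
    rewrite tint_cst// lerD2l [leLHS]mulrAC lexx//.
  rewrite RintegralD//; [|exact: rintegrableZl|exact: rintegrableZl].
  by rewrite RintegralZl// RintegralZl// lerD2r ler_wpM2l// mulr_ge0// sqr_ge0.
have bi s' t' w : leb.-integrable `[s', t'] (EFin \o (fun u => b (X u w))).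
  by apply: continuous_itv_integrable; exact: drift_continuous Xc Lip0 b_lip w.
have b2i s' t' w : leb.-integrable `[s', t'] (EFin \o (fun u => b (X u w) ^+ 2)).
  apply: continuous_itv_integrable => u.
  by apply: cvgM; exact: (drift_continuous Xc Lip0 b_lip (w := w)).
have le w : Res w ^+ 2 <= 4 * ((dt * tint (fun u => b (X u w) ^+ 2) s t
    + (I t w - I s w - Z w * U w) ^+ 2) + dK ^+ 2).
  have -> : Res w = tint (fun u => b (X u w)) s t + (I t w - I s w - Z w * U w) + dK + 0.
    by rewrite /Res !X_eq// (@tint_split _ _ 0 s t)// /dK; ring.
  apply: le_trans (sqr_add4_le _ _ _ _) _; rewrite ler_pM2l// expr0n/= addr0 !lerD2r.
  exact: tint_sqr_le.
have ic : intg (fun=> dK ^+ 2) by exact: finite_measure_integrable_cst.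
have k0 := rintegrableZl measurableT dt ib.
have k1 := rintegrableD measurableT k0 i2.
have k2 := rintegrableD measurableT k1 ic.
have k3 := rintegrableZl measurableT 4 k2.
have k4 : intg (fun w => Res w ^+ 2).
  apply: rintegrable_le k3 => //; first exact: measurable_funX.
  by move=> w _; rewrite ger0_norm ?sqr_ge0.
split => //; apply: (le_trans (le_Rintegral _ k4 k3 _)) => //.
rewrite RintegralZl// RintegralD// RintegralD// Rintegral_probability_cst RintegralZl//.
rewrite ler_pM2l// lerD2r; apply: lerD; first by rewrite ler_wpM2l// ltW.
by apply: (le_trans h2); rewrite ler_pM2l.
Qed.

Let h1 w : R := derive1 h (X s w).
Let h2 w : R := derive1n 2 h (X s w).
Let bs w : R := b (X s w).
Let q w : R := taylor2_quotient h (X s w) (X t w).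

Let h_continuous : continuous h.
Proof. by case: h_C2 => d1 _ _ z; exact/differentiable_continuous/derivable1_diffP. Qed.

Let h1_continuous : continuous (derive1 h).
Proof. by case: h_C2 => _ d2 _ z; exact/differentiable_continuous/derivable1_diffP. Qed.

Let comp_measurable (f : R -> R) u : continuous f -> measurable_fun setT (fun w => f (X u w)).
Proof. by move=> fc; apply: measurableT_comp => //; exact: continuous_measurable_fun. Qed.

Let comp_ameas (f : R -> R) : continuous f -> ameas s (fun w => f (X s w)).
Proof.
move=> fc; apply: (@ameas_comp _ _ _ _ _ _ _ _ f (Xa s0)).
exact: continuous_measurable_fun.
Qed.

Let bs_integrable : intg bs.
Proof.
apply: (@growth_integrable _ _ _ P _ Xm iX b (`|b 0| + Lip)).
  exact: (lipschitz_continuous Lip0 b_lip).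
exact: lipschitz_norm_growth.
Qed.

(** The martingale part of the increment is orthogonal to the bounded variable [h1], known at [s],
    and [K] contributes exactly [dK] times the mean of [h1]. What remains is the variation of the
    drift along the path, turned into a quadratic quantity by an arithmetic-geometric inequality of
    weight [e]. *)
Lemma first_order_term (e : R) : 0 < e -> intg (fun w => h1 w * (X t w - X s w)) /\
  `|\int[P]_w (h1 w * (X t w - X s w)) - (\int[P]_w (h1 w * bs w)) * dt
     - (\int[P]_w h1 w) * dK| <=
  Ch * (Lip / 2 * (e * dt + e^-1 * (C2 * (dt + dK ^+ 2) * dt))).
Proof.
move=> e0; have [iJ hJ] := EJ.
have [iD ED] := ito_martingale P_complete B_bm B_X0_indep
  (diffusion_joint Xc Xm Lip0 sigma_lip) (diffusion_continuous Xc Lip0 sigma_lip)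
  mI phiH phiI t0 (diffusion_sqr_integrable P_complete B_bm B_X0_indep Xc Xm Knd Lip0
  b_lip sigma_lip mI phiH phiI X_eq iX0 t0) s0 st' (comp_ameas h1_continuous)
  (fun w => h1_bounded (X s w)).
have mh1 := comp_measurable s h1_continuous.
have bi s' t' w : leb.-integrable `[s', t'] (EFin \o (fun u => b (X u w))).
  by apply: continuous_itv_integrable; exact: drift_continuous Xc Lip0 b_lip w.
pose E1 w := h1 w * (tint (fun u => b (X u w)) s t - bs w * dt).
pose G w := Ch * (Lip / 2 * (e * dt + e^-1 * J w)).
have E1G w : `|E1 w| <= G w.
  rewrite /E1 normrM; apply: ler_pM => //; first exact: h1_bounded.
  have ci : leb.-integrable `[s, t] (EFin \o (fun=> bs w)).
    by apply: (@itv_integrable _ _ _ _ `|bs w|).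
  rewrite -[bs w * dt](tint_cst (bs w) st') -tintB//.
  have iB : leb.-integrable `[s, t] (EFin \o (fun u => b (X u w) - bs w)).
    exact: rintegrableB.
  apply: (le_trans (le_normr_Rintegral _ iB)) => //.
  have ce : leb.-integrable `[s, t] (EFin \o (fun=> e)).
    by apply: (@itv_integrable _ _ _ _ `|e|).
  have ji := tintegrableZl e^-1 (path_incr_integrable w).
  have gi := tintegrableZl (Lip / 2) (tintegrableD ce ji).
  rewrite -[e * dt](tint_cst e st') -[e^-1 * J w]tintZl// -tintD// -tintZl; last exact: tintegrableD.
  apply: le_Rintegral => //.
    by have := integrable_norm iB; exact: eq_integrable.
  move=> u _; apply: (le_trans (b_lip _ _)); rewrite -mulrA ler_wpM2l//.
  exact: norm_le_amgm.
have iG : intg G.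
  apply: rintegrableZl => //; apply: rintegrableZl => //; apply: rintegrableD => //.
    exact: finite_measure_integrable_cst.
  exact: rintegrableZl.
have mE1 : measurable_fun setT E1.
  apply: measurable_funM => //; apply: measurable_funB.
    apply: (@measurable_tint _ _ _ (fun u w => b (X u w))).
    exact: (drift_joint Xc Xm Lip0 b_lip).
  apply: measurable_funM => //; apply: comp_measurable.
  exact: (lipschitz_continuous Lip0 b_lip).
have iE1 : intg E1 by exact: rintegrable_le iG.
have h1C w : `|h1 w| <= Ch by exact: h1_bounded.
have ih1 : intg h1 by exact: (@intg_bounded _ _ _ P h1 Ch mh1 h1C).
have ihb : intg (fun w => h1 w * bs w) by exact: (@intgM_bounded _ _ _ P h1 bs Ch mh1 h1C bs_integrable).
have decomp w : h1 w * (X t w - X s w) =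
    h1 w * (I t w - I s w) + E1 w + dt * (h1 w * bs w) + dK * h1 w.
  by rewrite !X_eq// (@tint_split _ _ 0 s t)// /E1 /dK; ring.
have i1 := rintegrableD measurableT iD iE1.
have i2 := rintegrableZl measurableT dt ihb.
have i3 := rintegrableD measurableT i1 i2.
have i4 := rintegrableZl measurableT dK ih1.
have i5 := rintegrableD measurableT i3 i4.
have -> : (fun w => h1 w * (X t w - X s w)) = fun w =>
    h1 w * (I t w - I s w) + E1 w + dt * (h1 w * bs w) + dK * h1 w.
  by apply/funext => w; exact: decomp.
split => //; rewrite RintegralD// RintegralD// RintegralD// RintegralZl// RintegralZl// ED add0r.
rewrite (_ : _ - _ - _ = \int[P]_w E1 w); last by ring.
apply: (le_trans (le_normr_Rintegral measurableT iE1)).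
apply: (le_trans (le_Rintegral _ _ iG _)) => //.
  by have := integrable_norm iE1; exact: eq_integrable.
have ic : intg (fun=> e * dt) by exact: finite_measure_integrable_cst.
have j1 := rintegrableZl measurableT e^-1 iJ.
have j2 := rintegrableD measurableT ic j1.
rewrite RintegralZl//; last exact: rintegrableZl.
rewrite RintegralZl// RintegralD// Rintegral_probability_cst RintegralZl//.
rewrite ler_wpM2l// ler_wpM2l ?divr_ge0// lerD2l ler_wpM2l// invr_ge0 ltW//.
Qed.

Let V w := 2^-1 * h2 w + q w.

(** The main term is the expectation of [2^-1 * h2 w * Z w ^+ 2 * U w ^+ 2], where the factor in
    front of [U w ^+ 2] is known at [s] and splits off. [second_order_arith] bounds the rest, and
    passing from [Z] back to [sig] costs [zeta]. *)
Lemma second_order_term (e c : R) : 0 < e -> 0 < c ->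
  intg (fun w => V w * (X t w - X s w) ^+ 2) /\
  `|\int[P]_w (V w * (X t w - X s w) ^+ 2) - (\int[P]_w (2^-1 * h2 w * sig w ^+ 2)) * dt| <=
  3 * Ch * (e * ((\int[P]_w sig w ^+ 2) * dt) + (1 + e^-1) * \int[P]_w Res w ^+ 2)
  + L ^+ 2 / 2 * (c * dt^-1 * (48 * expR 2^-1 * dt ^+ 2) + c^-1 * dt * \int[P]_w q w ^+ 2)
  + Ch / 2 * zeta * dt.
Proof.
move=> e0 c0; have [iR _] := residual_sqr.
have mh2 : measurable_fun setT h2.
  by apply: comp_measurable; case: h_C2.
have mq : measurable_fun setT q by exact: (measurable_taylor2_quotient h_C2).
have qC w : `|q w| <= 2 * Ch by exact: (taylor2_quotient_bounded h_C2).
have VC w : `|V w| <= 3 * Ch.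
  apply: (le_trans (ler_normD _ _)); rewrite normrM ger0_norm ?invr_ge0//.
  by have := h2_bounded (X s w); have := qC w; have := Ch0; rewrite -/(h2 w); lra.
have [iU iU2 iU4 [_ _ EU4]] := increment_moments B_bm s0 st'.
have iq2 : intg (fun w => q w ^+ 2).
  apply: (@intg_bounded _ _ _ P _ ((2 * Ch) ^+ 2)); first exact: measurable_funX.
  by move=> w; rewrite normrX lerXn2r ?nnegrE// mulr_ge0.
have Z2L w : Z w ^+ 2 <= L ^+ 2.
  by rewrite -real_normK ?num_real// lerXn2r ?nnegrE.
have Z2_ameas : ameas s (fun w => Z w ^+ 2) by exact: ameasM.
have iZ2 : intg (fun w => Z w ^+ 2).
  apply: (rintegrable_le measurableT _ _ isig); first exact: measurable_funX.
  by move=> w _; rewrite ger0_norm ?sqr_ge0.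
have [iZU EZU] := increment_sqr P_complete B_bm B_X0_indep s0 st' Z2_ameas iZ2.
have kC w : `|2^-1 * h2 w| <= Ch / 2.
  by rewrite normrM ger0_norm ?invr_ge0// mulrC ler_pM2r//; exact: h2_bounded.
have mk : measurable_fun setT (fun w => 2^-1 * h2 w) by exact: measurable_funM.
have kZ_ameas : ameas s (fun w => 2^-1 * h2 w * Z w ^+ 2).
  apply: ameasM => //; apply: ameasM; first exact: ameas_cst.
  by apply: comp_ameas; case: h_C2.
have ikZ : intg (fun w => 2^-1 * h2 w * Z w ^+ 2).
  exact: (@intgM_bounded _ _ _ P (fun w => 2^-1 * h2 w) (fun w => Z w ^+ 2) (Ch / 2) mk kC iZ2).
have iks : intg (fun w => 2^-1 * h2 w * sig w ^+ 2).
  exact: (@intgM_bounded _ _ _ P (fun w => 2^-1 * h2 w) (fun w => sig w ^+ 2) (Ch / 2) mk kC isig).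
have [ikZU EkZU] := increment_sqr P_complete B_bm B_X0_indep s0 st' kZ_ameas ikZ.
pose G w := 3 * Ch * (e * (Z w ^+ 2 * U w ^+ 2) + (1 + e^-1) * Res w ^+ 2)
  + L ^+ 2 / 2 * (c * dt^-1 * U w ^+ 4 + c^-1 * dt * q w ^+ 2).
have j1 := rintegrableZl measurableT e iZU.
have j2 := rintegrableZl measurableT (1 + e^-1) iR.
have j3 := rintegrableD measurableT j1 j2.
have j3' := rintegrableZl measurableT (3 * Ch) j3.
have j4 := rintegrableZl measurableT (c * dt^-1) iU4.
have j5 := rintegrableZl measurableT (c^-1 * dt) iq2.
have j6 := rintegrableD measurableT j4 j5.
have j6' := rintegrableZl measurableT (L ^+ 2 / 2) j6.
have iG : intg G := rintegrableD measurableT j3' j6'.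
pose E2 w := V w * (X t w - X s w) ^+ 2 - 2^-1 * h2 w * Z w ^+ 2 * U w ^+ 2.
have E2G w : `|E2 w| <= G w.
  rewrite /E2 (_ : X t w - X s w = Z w * U w + Res w); last by rewrite /Res; ring.
  exact: second_order_arith.
have mV : measurable_fun setT V by exact: measurable_funD.
have mE2 : measurable_fun setT E2.
  apply: measurable_funB; last exact: rintegrable_measurable ikZU.
  by apply: measurable_funM => //; apply: measurable_funX; exact: measurable_funB.
have iE2 : intg E2 by exact: rintegrable_le iG.
have iV := rintegrableD measurableT iE2 ikZU.
have VE : (fun w => V w * (X t w - X s w) ^+ 2) =
    fun w => E2 w + 2^-1 * h2 w * Z w ^+ 2 * U w ^+ 2.
  by apply/funext => w; rewrite /E2 subrK.
rewrite VE; split => //.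
rewrite RintegralD// EkZU.
have kzeta : `|\int[P]_w (2^-1 * h2 w * Z w ^+ 2) - \int[P]_w (2^-1 * h2 w * sig w ^+ 2)|
    <= Ch / 2 * zeta.
  rewrite -RintegralB//; have iB := rintegrableB measurableT ikZ iks.
  apply: (le_trans (le_normr_Rintegral measurableT iB)).
  have iz := rintegrableZl measurableT (Ch / 2) izeta.
  rewrite -RintegralZl//; apply: le_Rintegral => //.
    by have := integrable_norm iB; exact: eq_integrable.
  move=> w _; rewrite -mulrBr normrM; apply: ler_pM => //.
  (* Since [Z w] is [sig w] or 0, the difference of the squares is the square of the difference. *)
  rewrite distrC /Z; case: (`|sig w| <= L).
    by rewrite mulr1 !subrr expr0n normr0.
  by rewrite mulr0 expr0n/= !subr0 ger0_norm ?sqr_ge0.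
have EE2 : `|\int[P]_w E2 w| <= \int[P]_w G w.
  apply: (le_trans (le_normr_Rintegral measurableT iE2)); apply: le_Rintegral => //.
  by have := integrable_norm iE2; exact: eq_integrable.
rewrite (_ : _ - _ = \int[P]_w E2 w + (\int[P]_w (2^-1 * h2 w * Z w ^+ 2)
   - \int[P]_w (2^-1 * h2 w * sig w ^+ 2)) * dt); last by rewrite -/dt; ring.
apply: (le_trans (ler_normD _ _)); apply: lerD; last first.
  by rewrite normrM (gtr0_norm dt0) ler_pM2r.
apply: (le_trans EE2); rewrite RintegralD// RintegralZl// RintegralZl// RintegralD// RintegralD//.
rewrite !RintegralZl// EZU; apply: lerD.
  apply: ler_wpM2l; first exact: mulr_ge0.
  rewrite lerD2r ler_pM2l// ler_pM2r//; exact: le_Rintegral.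
apply: ler_wpM2l; first by rewrite divr_ge0// sqr_ge0.
rewrite lerD2r ler_pM2l ?divr_gt0//.
Qed.

Let h_growth x : `|h x| <= (`|h 0| + Ch) * (1 + x ^+ 2).
Proof.
have [hd _ _] := h_C2.
exact: (lipschitz_norm_growth (derivative_lipschitz hd h1_bounded) x).
Qed.

(** Taylor's formula with [taylor2_quotient] is an identity, so all the errors are those of the
    first and of the second order term. *)
Lemma expected_increment (e c : R) : 0 < e -> 0 < c ->
  `|\int[P]_w h (X t w) - \int[P]_w h (X s w)
    - (\int[P]_w generator b sigma h (X s w)) * dt - (\int[P]_w h1 w) * dK| <=
  Ch * (Lip / 2 * (e * dt + e^-1 * (C2 * (dt + dK ^+ 2) * dt))) +
  (3 * Ch * (e * ((\int[P]_w sig w ^+ 2) * dt) + (1 + e^-1) *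
     (4 * (dt * (Cb * dt) +
     2 * (2 * Lip ^+ 2 * (C2 * (dt + dK ^+ 2) * dt) + 2 * dt * zeta) + dK ^+ 2)))
  + L ^+ 2 / 2 * (c * dt^-1 * (48 * expR 2^-1 * dt ^+ 2) + c^-1 * dt * \int[P]_w q w ^+ 2)
  + Ch / 2 * zeta * dt).
Proof.
move=> e0 c0; have [i1 f1] := first_order_term e0; have [i2 f2] := second_order_term e0 c0.
have [_ hR] := residual_sqr.
have ih u : intg (fun w => h (X u w)) by exact: (growth_integrable Xm iX h_continuous h_growth).
have mh1 : measurable_fun setT h1 by exact: comp_measurable.
have mk : measurable_fun setT (fun w => 2^-1 * h2 w).
  by apply: measurable_funM => //; apply: comp_measurable; case: h_C2.
have h1C w : `|h1 w| <= Ch by exact: h1_bounded.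
have kC w : `|2^-1 * h2 w| <= Ch / 2.
  by rewrite normrM ger0_norm ?invr_ge0// mulrC ler_pM2r//; exact: h2_bounded.
have ihb := @intgM_bounded _ _ _ P h1 bs Ch mh1 h1C bs_integrable.
have iks := @intgM_bounded _ _ _ P (fun w => 2^-1 * h2 w) (fun w => sig w ^+ 2) (Ch / 2) mk kC isig.
have -> : \int[P]_w generator b sigma h (X s w) =
    \int[P]_w (h1 w * bs w) + \int[P]_w (2^-1 * h2 w * sig w ^+ 2).
  rewrite -RintegralD//; apply: eq_Rintegral => w _.
  by rewrite /generator /h1 /h2 /bs /sig; ring.
have -> : \int[P]_w h (X t w) - \int[P]_w h (X s w) =
    \int[P]_w (h1 w * (X t w - X s w)) + \int[P]_w (V w * (X t w - X s w) ^+ 2).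
  rewrite -RintegralB// -RintegralD//; apply: eq_Rintegral => w _.
  exact: taylor2E.
set a1 := \int[P]_w (h1 w * (X t w - X s w)) in f1 *.
set a2 := \int[P]_w (V w * _) in f2 *.
set a3 := \int[P]_w (h1 w * bs w) in f1 *.
set a4 := \int[P]_w (2^-1 * h2 w * _) in f2 *.
have -> : a1 + a2 - (a3 + a4) * dt - (\int[P]_w h1 w) * dK =
    (a1 - a3 * dt - (\int[P]_w h1 w) * dK) + (a2 - a4 * dt) by ring.
apply: (le_trans (ler_normD _ _)); apply: lerD => //.
apply: (le_trans f2); rewrite !lerD2r; apply: ler_wpM2l; first exact: mulr_ge0.
rewrite lerD2l; apply: ler_wpM2l; last exact: hR.
by rewrite addr_ge0// invr_ge0 ltW.
Qed.

End local_expansion.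

(** Here [x] is [t - s] and [k] is [K t - K s]. Once [x + k] is factored out, the coefficient is a
    multiple of [e], plus terms vanishing with the step at fixed [e], plus the truncation error
    [ze], plus a part in [c] and [om / c] depending on [L]. *)
Lemma expansion_coefficient (R : realFieldType)
    (x k ze om e c Ch Lip C2 Cb S2 L ka : R) :
  0 < x -> 0 <= k -> 0 <= ze -> 0 <= om -> 0 < e -> 0 < c -> 0 <= Ch -> 0 <= Lip ->
  0 <= C2 -> 0 <= Cb -> 0 <= S2 -> 0 <= ka ->
  Ch * (Lip / 2 * (e * x + e^-1 * (C2 * (x + k ^+ 2) * x))) +
  (3 * Ch * (e * (S2 * x) + (1 + e^-1) * (4 * (x * (Cb * x) +
     2 * (2 * Lip ^+ 2 * (C2 * (x + k ^+ 2) * x) + 2 * x * ze) + k ^+ 2)))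
  + L ^+ 2 / 2 * (c * x^-1 * (ka * x ^+ 2) + c^-1 * x * om) + Ch / 2 * ze * x) <=
  ((Ch * Lip / 2 + 3 * Ch * S2) * e
   + (Ch * Lip / 2 * e^-1 * C2 + 12 * Ch * (1 + e^-1) * (Cb + 4 * Lip ^+ 2 * C2 + 1))
     * (x + k + k ^+ 2)
   + (48 * Ch * (1 + e^-1) + Ch / 2) * ze
   + L ^+ 2 / 2 * (c * ka + c^-1 * om)) * (x + k).
Proof.
move=> x0 k0 ze0 om0 e0 c0 Ch0 Lip0 C20 Cb0 S20 ka0.
have x0' := ltW x0; have k2 := sqr_ge0 k; have L2 := sqr_ge0 Lip; have LL := sqr_ge0 L.
have e0' : 0 <= e^-1 by rewrite invr_ge0 ltW.
have c0' : 0 <= c^-1 by rewrite invr_ge0 ltW.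
have -> : c * x^-1 * (ka * x ^+ 2) = c * ka * x by field; rewrite gt_eqF.
pose y := x + k; pose m := x + k + k ^+ 2.
have xy : x <= y by rewrite lerDl.
have ky : k <= y by rewrite lerDr.
have xm : x <= m by rewrite /m -addrA lerDl addr_ge0.
have km : k <= m by rewrite /m; lra.
have xkm : x + k ^+ 2 <= m by rewrite /m; lra.
have p1 : (x + k ^+ 2) * x <= m * y by apply: ler_pM => //; exact: addr_ge0.
have p2 : x * x <= m * y by exact: ler_pM.
have p3 : k ^+ 2 <= m * y by rewrite expr2; exact: ler_pM.
have p4 : C2 * (x + k ^+ 2) * x <= C2 * (m * y) by rewrite -mulrA ler_wpM2l.
have p5 : x * (Cb * x) <= Cb * (m * y) by rewrite mulrCA ler_wpM2l.
have p6 : x * ze <= y * ze by rewrite ler_wpM2r.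
have q1 : e * x + e^-1 * (C2 * (x + k ^+ 2) * x) <= e * y + e^-1 * (C2 * (m * y)).
  by apply: lerD; apply: ler_wpM2l => //; exact: ltW.
have q2 : 2 * Lip ^+ 2 * (C2 * (x + k ^+ 2) * x) <= 2 * Lip ^+ 2 * (C2 * (m * y)).
  by rewrite ler_wpM2l// mulr_ge0.
have q3 : x * (Cb * x) + 2 * (2 * Lip ^+ 2 * (C2 * (x + k ^+ 2) * x) + 2 * x * ze) + k ^+ 2
    <= Cb * (m * y) + 2 * (2 * Lip ^+ 2 * (C2 * (m * y)) + 2 * y * ze) + m * y.
  by move: p5 q2 p3 p6; lra.
have q4 : e * (S2 * x) <= e * (S2 * y).
  by rewrite (ler_wpM2l (ltW e0))// ler_wpM2l.
have r1 : Ch * (Lip / 2 * (e * x + e^-1 * (C2 * (x + k ^+ 2) * x))) <=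
    Ch * (Lip / 2 * (e * y + e^-1 * (C2 * (m * y)))).
  by rewrite ler_wpM2l// ler_wpM2l// divr_ge0.
have r2 := ler_wpM2l (addr_ge0 (@ler01 R) e0') (ler_wpM2l (ler0n R 4) q3).
have r3 := ler_wpM2l (mulr_ge0 (ler0n R 3) Ch0) (lerD q4 r2).
have r4 : L ^+ 2 / 2 * (c * ka * x + c^-1 * x * om) <= L ^+ 2 / 2 * (c * ka * y + c^-1 * y * om).
  apply: ler_wpM2l; first by rewrite divr_ge0.
  apply: lerD; first by rewrite ler_wpM2l// mulr_ge0// ltW.
  by rewrite ler_wpM2r// ler_wpM2l.
have r5 : Ch / 2 * ze * x <= Ch / 2 * ze * y.
  by rewrite ler_wpM2l// mulr_ge0// divr_ge0.
apply: le_trans (lerD r1 (lerD (lerD r3 r4) r5)) _.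
by rewrite le_eqVlt; apply/orP; left; apply/eqP; rewrite -/y -/m; ring.
Qed.

Lemma small_multiple (R : realFieldType) (a e : R) : 0 <= a -> 0 < e ->
  a * (e / (4 * (a + 1))) <= e / 4.
Proof.
move=> a0 e0; have a1 : 0 < 4 * (a + 1) by rewrite mulr_gt0// ltr_wpDl.
rewrite mulrA ler_pdivrMr// (_ : e / 4 * _ = a * e + e); last by field.
by rewrite lerDl ltW.
Qed.

Section solution_expansion.
Context d (T : measurableType d) (R : realType) (P : probability T R).
Variables (B : R -> {RV P >-> R}) (X0 : {RV P >-> R}).
Notation leb := (@lebesgue_measure R).
Hypothesis P_complete : measure_is_complete P.
Hypothesis B_bm : brownian_motion B.
Hypothesis B_X0_indep :
  independent_systems P (sigma_of X0) (sigma_path (fun t => B t)).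
Local Notation intg f := (P.-integrable setT (EFin \o f)).
Local Notation ameas := (ameas B X0).
Variables (X I : R -> T -> R) (K b sigma : R -> R) (Lip : R).
Variable phi : nat -> simple_process (augmented_filtration P X0 (fun t => B t)).
Hypotheses (Xc : forall w, continuous (X ^~ w)) (Xm : forall u, measurable_fun setT (X u)).
Hypothesis Xa : forall u, 0 <= u -> ameas u (X u).
Hypothesis Knd : {homo K : x y / x <= y}.
Hypothesis Lip0 : 0 <= Lip.
Hypothesis b_lip : forall x y, `|b x - b y| <= Lip * `|x - y|.
Hypothesis sigma_lip : forall x y, `|sigma x - sigma y| <= Lip * `|x - y|.
Hypothesis mI : forall t, 0 <= t -> measurable_fun setT (I t).
Hypothesis phiH : forall t e : R, 0 <= t -> 0 < e ->
  P [set w | e <= tint (fun u => (sp_fun (phi n) u w - sigma (X u w)) ^+ 2) 0 t]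
    @[n --> \oo] --> 0%E.
Hypothesis phiI : forall t e : R, 0 <= t -> 0 < e ->
  P [set w | e <= `|sp_integral (phi n) (fun r => B r) t w - I t w|]
    @[n --> \oo] --> 0%E.
Hypothesis X_eq : forall w t, 0 <= t ->
  X t w = X0 w + tint (fun u => b (X u w)) 0 t + I t w + K t.
Hypothesis iX0 : intg (fun w => X0 w ^+ 2).

Hypothesis Kc : continuous K.
Hypothesis X_neg : forall u, X u = X (Num.max u 0).

Variables (h : R -> R) (Ch : R).
Hypothesis h_C2 : twice_continuously_differentiable h.
Hypothesis h1_bounded : forall x, `|derive1 h x| <= Ch.
Hypothesis h2_bounded : forall x, `|derive1n 2 h x| <= Ch.

Lemma truncation_L2_cvg s :
  \int[P]_w (sigma (X s w) - sigma (X s w) * (`|sigma (X s w)| <= n%:R)%R%:R) ^+ 2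
    @[n --> \oo] --> (0 : R).
Proof.
have sc := lipschitz_continuous Lip0 sigma_lip.
have ms : measurable_fun setT (fun w => sigma (X s w)).
  by apply: measurableT_comp => //; exact: continuous_measurable_fun.
pose Y (n : nat) w := (sigma (X s w) - sigma (X s w) * (`|sigma (X s w)| <= n%:R)%R%:R) ^+ 2.
have is2 : intg (fun w => sigma (X s w) ^+ 2).
  pose c := 2 * sigma 0 ^+ 2 + 2 * Lip ^+ 2.
  apply: (@growth_integrable _ _ _ P _ Xm _ (fun x => sigma x ^+ 2) c).
  - exact: (X_sqr_integrable P_complete B_bm B_X0_indep Xc Xm Knd Lip0
      b_lip sigma_lip mI phiH phiI X_eq iX0 X_neg).
  - by move=> x; apply: cvgM; exact: sc.
  - move=> x; rewrite ger0_norm ?sqr_ge0//.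
    exact: (lipschitz_growth Lip0 sigma_lip (lexx c)).
have mY n : measurable_fun setT (Y n).
  apply: measurable_funX; apply: measurable_funB => //; apply: measurable_funM => //.
  rewrite (_ : (fun _ => _) = \1_[set w | `|sigma (X s w)| <= n%:R]).
    by apply: measurable_indic; apply: measurable_set_le; exact: measurableT_comp.
  by apply/funext => w; rewrite indicE mem_setE.
have Yb n w : setT w -> `|Y n w| <= sigma (X s w) ^+ 2.
  move=> _; rewrite ger0_norm ?sqr_ge0// /Y; case: (`|sigma (X s w)| <= n%:R).
    by rewrite mulr1 subrr expr0n/= sqr_ge0.
  by rewrite mulr0 subr0.
have [|_] := @Rintegral_dct _ _ _ P setT measurableT Y (cst 0) _ mY
  (@measurable_cst _ _ _ _ setT (0 : R)) is2 Yb.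
  apply: aeW => w _; apply: cvg_near_cst; near=> n.
  rewrite /Y (_ : (_ <= _) = true) ?mulr1 ?subrr ?expr0n//.
  by near: n; exact: nbhs_infty_ger.
by rewrite Rintegral_probability_cst.
Unshelve. all: by end_near. Qed.

(** The constants depend on one another, which fixes the order: [e1], then the level [n] since [De]
    contains the inverse of [e1], then [c] since it depends on [L], and the radius last. Each of the
    first three choices costs [e / 4], so [F] tends to at most 3 e / 4 at [s] and is below [e]
    nearby. *)
Lemma local_expansion s e : 0 <= s -> 0 < e -> exists2 d, 0 < d &
  forall t, s < t -> t < s + d ->
  `|\int[P]_w h (X t w) - \int[P]_w h (X s w)
    - (\int[P]_w generator b sigma h (X s w)) * (t - s)
    - (\int[P]_w derive1 h (X s w)) * (K t - K s)| <= e * (t - s + (K t - K s)).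
Proof.
move=> s0 e0.
have s1 : 0 <= s + 1 by rewrite addr_ge0.
have Ch0 : 0 <= Ch by exact: le_trans (h1_bounded 0).
have [C2 C20 HC2] := mean_square_increment P_complete B_bm B_X0_indep Xc Xm Knd Lip0
  b_lip sigma_lip mI phiH phiI X_eq iX0 s1.
have [Cb Cb0 HCb] := time_integral_sqr_bound P_complete B_bm B_X0_indep Xc Xm Knd Lip0
  b_lip sigma_lip mI phiH phiI X_eq iX0 s1 b_lip.
pose S2 := \int[P]_w sigma (X s w) ^+ 2.
have S20 : 0 <= S2 by apply: Rintegral_ge0 => w _; exact: sqr_ge0.
pose ze (n : nat) := \int[P]_w (sigma (X s w) - sigma (X s w) * (`|sigma (X s w)| <= n%:R)%R%:R) ^+ 2.
have ze0 n : 0 <= ze n by apply: Rintegral_ge0 => w _; exact: sqr_ge0.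
pose om t := \int[P]_w taylor2_quotient h (X s w) (X t w) ^+ 2.
have om0 t : 0 <= om t by apply: Rintegral_ge0 => w _; exact: sqr_ge0.
pose ka : R := 48 * expR 2^-1.
have ka0 : 0 < ka by rewrite mulr_gt0// expR_gt0.
pose A1 := Ch * Lip / 2 + 3 * Ch * S2.
have A10 : 0 <= A1 by rewrite addr_ge0// ?divr_ge0// !mulr_ge0.
pose e1 := e / (4 * (A1 + 1)).
have A4 : 0 < 4 * (A1 + 1) by rewrite mulr_gt0// ltr_wpDl.
have e10 : 0 < e1 by rewrite divr_gt0.
have A1e : A1 * e1 <= e / 4 by exact: small_multiple.
pose Be := Ch * Lip / 2 * e1^-1 * C2 + 12 * Ch * (1 + e1^-1) * (Cb + 4 * Lip ^+ 2 * C2 + 1).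
pose De := 48 * Ch * (1 + e1^-1) + Ch / 2.
have De0 : 0 <= De.
  rewrite addr_ge0 ?divr_ge0//; apply: mulr_ge0; first by rewrite mulr_ge0.
  by rewrite addr_ge0// invr_ge0 ltW.
have [n Dze] : exists n, De * ze n <= e / 4.
  have e40 : 0 < e / 4 / (De + 1) by rewrite divr_gt0 ?divr_gt0// ltr_wpDl.
  have [N _ HN] := cvgr_lt _ (truncation_L2_cvg s) _ e40.
  exists N; have /ltW := HN N (leqnn N); rewrite -/(ze N) ler_pdivlMr ?ltr_wpDl// => h1.
  by apply: le_trans h1; rewrite mulrC ler_wpM2l// lerDl.
pose L : R := n%:R; have L0 : 0 <= L by rewrite ler0n.
pose c := e / (4 * (L ^+ 2 / 2 * ka + 1)).
have La0 : 0 <= L ^+ 2 / 2 * ka by rewrite mulr_ge0 ?(ltW ka0)// divr_ge0// sqr_ge0.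
have Lk : 0 < 4 * (L ^+ 2 / 2 * ka + 1) by rewrite mulr_gt0// ltr_wpDl.
have c0 : 0 < c by rewrite divr_gt0.
have Lc : L ^+ 2 / 2 * (c * ka) <= e / 4.
  rewrite (_ : _ * (c * ka) = (L ^+ 2 / 2 * ka) * c); last by ring.
  exact: small_multiple.
pose F t := A1 * e1 + Be * (t - s + (K t - K s) + (K t - K s) ^+ 2) + De * ze n
   + L ^+ 2 / 2 * (c * ka + c^-1 * om t).
have Fc : F t @[t --> s] --> A1 * e1 + Be * (0 + 0 + 0 * 0) + De * ze n
   + L ^+ 2 / 2 * (c * ka + c^-1 * (0 : R)).
  have omc : om t @[t --> s] --> (0 : R) by exact: (taylor2_quotient_L2_cvg h_C2 h2_bounded).
  have Kc0 : K t - K s @[t --> s] --> (0 : R).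
    by rewrite -[X in _ --> X](subrr (K s)); apply: cvgB; [exact: Kc|exact: cvg_cst].
  have tc0 : t - s @[t --> s] --> (0 : R).
    by rewrite -[X in _ --> X](subrr s); apply: cvgB; [exact: cvg_id|exact: cvg_cst].
  apply: cvgD.
    apply: cvgD; last exact: cvg_cst.
    apply: cvgD; first exact: cvg_cst.
    apply: cvgM; first exact: cvg_cst.
    by apply: cvgD; [exact: cvgD|exact: cvgM].
  apply: cvgM; first exact: cvg_cst.
  apply: cvgD; first exact: cvg_cst.
  by apply: cvgM; first exact: cvg_cst.
have lim_lt : A1 * e1 + Be * (0 + 0 + 0 * 0) + De * ze n
   + L ^+ 2 / 2 * (c * ka + c^-1 * (0 : R)) < e.
  rewrite !mulr0 !addr0 mulr0 addr0.
  by move: A1e Dze Lc e0; set u1 := A1 * e1; set u2 := De * _; set u3 := L ^+ 2 / 2 * _; lra.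
have [r /= r0 Hr] := cvgr_lt _ Fc _ lim_lt.
exists (Num.min r 1); first by rewrite lt_min r0 ltr01.
move=> t st; rewrite -ltrBlDl lt_min => /andP[td t1].
have tt : t <= s + 1 by rewrite -lerBlDl ltW.
have Ft : F t < e.
  by apply: Hr => /=; rewrite distrC gtr0_norm// subr_gt0.
have st' := ltW st.
have dK0 : 0 <= K t - K s by rewrite subr_ge0 Knd.
have H1 u : s <= u -> u <= t -> intg (fun w => (X u w - X s w) ^+ 2) /\
    \int[P]_w (X u w - X s w) ^+ 2 <= C2 * ((u - s) + (K u - K s) ^+ 2).
  by move=> su ut; apply: HC2 => //; exact: le_trans tt.
have H2 := HCb s t s0 st' tt.
have EI := expected_increment P_complete B_bm B_X0_indep Xc Xm Xa Knd Lip0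
  b_lip sigma_lip mI phiH phiI X_eq iX0 X_neg h_C2 h1_bounded h2_bounded s0 st
  C20 H1 H2 L0 e10 c0.
apply: le_trans EI _.
apply: le_trans (ler_wpM2r _ (ltW Ft)); last by rewrite addr_ge0// subr_ge0.
have := @expansion_coefficient R (t - s) (K t - K s) (ze n) (om t) e1 c Ch Lip C2 Cb S2 L ka.
by apply => //; [rewrite subr_gt0|exact: ltW].
Qed.

End solution_expansion.

(** * Densities of Stieltjes measures *)

Section density_measure.
Context d (T : measurableType d) (R : realType) (mu : {measure set T -> \bar R}).
Variable f : T -> R.
Hypotheses (f0 : forall x, 0 <= f x) (mf : measurable_fun setT f).

Let nu (A : set T) := (\int[mu]_(x in A) (f x)%:E)%E.

Let nu0 : nu set0 = 0%E. Proof. exact: integral_set0. Qed.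

Let nu_ge0 A : (0 <= nu A)%E.
Proof. by apply: integral_ge0 => x _; rewrite lee_fin. Qed.

Let nu_sigma_additive : semi_sigma_additive nu.
Proof.
move=> F mF tF mUF; rewrite /nu ge0_integral_bigcup//.
- apply: cvg_toP => //; apply: ereal_nondecreasing_is_cvgn => m n mn.
  by apply: lee_sum_nneg_natr => // k _ _; apply: integral_ge0 => x _; rewrite lee_fin.
- by apply/measurable_EFinP; exact: measurable_funTS.
- by move=> x _; rewrite lee_fin.
Qed.

Definition with_density : {measure set T -> \bar R} :=
  HB.pack nu (isMeasure.Build _ _ _ nu nu0 nu_ge0 nu_sigma_additive).

End density_measure.

Section stieltjes_density.
Context {R : realType} (K : cumulative R R) (k : R -> R).
Notation leb := (@lebesgue_measure R).
Hypotheses (K0 : forall t, t <= 0 -> K t = 0) (k0 : forall t, 0 <= k t).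
Hypothesis mk : measurable_fun setT k.
Hypothesis ki : forall s t, leb.-integrable `[s, t] (EFin \o k).
Hypothesis KE : forall s t, 0 <= s -> s <= t -> K t - K s = tint k s t.

Lemma stieltjes_measure_oc s t : s <= t ->
  lebesgue_stieltjes_measure K `]s, t] = (K t - K s)%:E.
Proof.
move=> st; rewrite /lebesgue_stieltjes_measure /measure_extension measurable_mu_extE/=; last exact: is_ocitv.
by rewrite wlength_itv_bnd.
Qed.

(** [K] vanishes at negative times, where [k] is unrelated to it. *)
Let kp t : R := k t * \1_(`]0, +oo[) t.

Let kp0 t : 0 <= kp t. Proof. exact: mulr_ge0. Qed.

Let mkp : measurable_fun setT kp.
Proof. by apply: measurable_funM => //; exact: measurable_indic. Qed.

Let integral_oc s t : (\int[leb]_(x in `]s, t]) (kp x)%:E =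
  \int[leb]_(x in `]Num.max s 0%R, t]) (k x)%:E)%E.
Proof.
rewrite (_ : `]Num.max s 0, t]%classic = `]s, t] `&` `]0, +oo[); last first.
  apply/seteqP; split => x /=; rewrite !in_itv/= andbT gt_max.
    by move=> /andP[/andP[-> ->] ->].
  by move=> [/andP[-> ->] ->].
rewrite integral_mkcondr; apply: eq_integral => x _.
by rewrite patchE /kp indicE; case: (x \in _); rewrite ?mulr1 ?mulr0.
Qed.

(** The two measures agree on the half-open intervals, which determine the Stieltjes measure. [K]
    being 0 up to time 0, an interval ]a, b] may be cut at [Num.max a 0]. *)
Let stieltjesE A : measurable A ->
  lebesgue_stieltjes_measure K A = (\int[leb]_(t in A) (kp t)%:E)%E.
Proof.
move=> mA; have oc X : ocitv X -> lebesgue_stieltjes_measure K X = with_density leb kp0 mkp X.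
  move=> [[a b] _ <-]/=; rewrite /with_density /= integral_oc.
  have [ab|ba] := leP a b; last first.
    rewrite !set_itv_ge ?bnd_simp -?leNgt ?(ltW ba) ?le_max ?(ltW ba)//.
    by rewrite measure0 integral_set0.
  rewrite (stieltjes_measure_oc ab).
  have KM : K (Num.max a 0) = K a.
    by have [a0|//] := leP a 0; rewrite !K0.
  have [b0|b0] := leP b (Num.max a 0).
    rewrite set_itv_ge ?bnd_simp -?leNgt// integral_set0; congr (_%:E).
    apply/eqP; rewrite subr_eq0; apply/eqP; rewrite -KM.
    have [a0|a0] := leP a 0.
      by move: b0; rewrite max_r// => b0; rewrite !K0.
    by move: b0; rewrite max_l ?(ltW a0)// => b0; congr (K _); apply: le_anti; rewrite ab b0.
  have M0 : 0 <= Num.max a 0 by rewrite le_max lexx orbT.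
  rewrite -KM KE ?(ltW b0)// /tint /Rintegral fineK; last exact: (integrable_fin_num _ (ki _ _)).
  by rewrite -integral_itv_obnd_cbnd// ; apply/measurable_EFinP; exact: measurable_funTS.
by rewrite (lebesgue_stieltjes_measure_unique oc).
Qed.

(** On [0, +oo[ the functions [k] and [kp] can differ only at 0, a null set. *)
Lemma stieltjes_densityE (A : set R) : measurable A -> A `<=` `[0, +oo[ ->
  lebesgue_stieltjes_measure K A = (\int[leb]_(t in A) (k t)%:E)%E.
Proof.
move=> mA A0; rewrite stieltjesE//; apply: ae_eq_integral => //.
- by apply/measurable_EFinP; exact: measurable_funTS.
- by apply/measurable_EFinP; exact: measurable_funTS.
exists [set (0 : R)]; split => //; first exact: lebesgue_measure_set1.
move=> x /= H; apply: contrapT => /eqP x0; apply: H => /A0/=.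
rewrite in_itv/= andbT => x0'; rewrite /kp indicE mem_set ?mulr1//=.
by rewrite in_itv/= andbT lt_def x0.
Qed.

Lemma stieltjes_dominates : lebesgue_stieltjes_measure K `<< leb.
Proof.
move=> N N0 A mA AN; rewrite stieltjesE//.
apply: null_set_integral => //; last exact: N0.
by apply/measurable_EFinP; exact: measurable_funTS.
Qed.

End stieltjes_density.

Section preliminaries.
Context {R : realType}.

(** The Lipschitz property holds for all constants beyond some threshold; one of them is chosen, and
    chosen nonnegative. *)
Lemma lipschitz_constant (f : R -> R) : [lipschitz f x | x in [set: R]] ->
  exists2 L : R, 0 <= L & forall x y, `|f x - f y| <= L * `|x - y|.
Proof.
move=> [L [_ HL]]; exists (Num.max L 0 + 1); first by rewrite addr_ge0// le_max lexx orbT.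
move=> x y; apply: (HL (Num.max L 0 + 1) _ (x, y)) => //.
by rewrite ltr_pwDr// le_max lexx.
Qed.

(** The function [h y - (m - e) * y] is strictly increasing, thanks to the slack [e], so its
    derivative is nonnegative. *)
Lemma increasing_bilip_derive1 (h : R -> R) (m : R) : {homo h : x y / x <= y} ->
  (forall x, derivable h x 1) -> (forall x y, m * `|x - y| <= `|h x - h y|) ->
  forall x, m <= derive1 h x.
Proof.
move=> h_incr hd h_bilip x; apply/ler_addgt0Pr => e e0.
pose k y := h y - (m - e) * y.
have kd z : is_derive z (1 : R) k (derive1 h z - (m - e)).
  have d1 : is_derive z (1 : R) h (derive1 h z) by rewrite derive1E; exact: derivableP.
  rewrite /k; apply: is_derive_eq; rewrite /GRing.scale/=; lra.
have kE : derive1 k x = derive1 h x - (m - e).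
  by rewrite derive1E; exact: (@derive_val _ _ _ _ _ _ _ (kd x)).
suff : 0 <= derive1 k x by rewrite kE; lra.
apply: (@incr_derive1_ge0 _ k setT x); last by rewrite interiorT.
  by move=> y _; have := kd y; case.
move=> y z _ _ yz; rewrite /k.
have := h_bilip z y; rewrite !ger0_norm ?subr_ge0 ?(ltW yz)//; last exact/h_incr/ltW.
have : 0 < e * (z - y) by rewrite mulr_gt0// subr_gt0.
lra.
Qed.

Lemma continuous_max0 (f : R -> R) : {within `[(0 : R), +oo[, continuous f} ->
  continuous (fun u : R => f (Num.max u 0)).
Proof.
have M0 v : `[(0 : R), +oo[%classic (Num.max v 0).
  by rewrite /= in_itv/= andbT le_max lexx orbT.
move=> /subspace_continuousP fc u.
apply: (cvg_comp (fun v : R => Num.max v 0) f _ (fc _ (M0 u))).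
move=> A /= NA.
have H : nbhs u (fun v : R => `[(0 : R), +oo[%classic (Num.max v 0) -> A (Num.max v 0)).
  exact: (@max0_continuous R u _ NA).
suff : nbhs u (fun v : R => A (Num.max v 0)) by [].
by apply: filterS H => v; apply; exact: M0.
Qed.

End preliminaries.

(** [A] is not assumed measurable: it coincides with [A'] outside [N], and its part inside [N] is
    measurable by completeness. *)
Lemma measure_eq_off_null d (T : measurableType d) (R : realType) (P : {measure set T -> \bar R})
    (N A A' : set T) : measure_is_complete P -> measurable N -> P N = 0%E ->
  measurable A' -> (forall w, ~ N w -> A w <-> A' w) -> P A = P A'.
Proof.
move=> Pc mN PN mA' AA'.
have neg C : C `<=` N -> measurable C by move=> CN; apply: Pc; exists N.
have AE : A = (A' `\` N) `|` (A `&` N).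
  apply/seteqP; split => w.
    by move=> Aw; have [Nw|nN] := pselect (N w); [right|left; split => //; apply/AA'].
  by move=> [[A'w nN]|[]//]; apply/(AA' w nN).
have mA : measurable A.
  rewrite AE; apply: measurableU; first exact: measurableD.
  by apply: neg => w [].
rewrite -(measureU0 mA mN PN) -(measureU0 mA' mN PN); congr (P _).
apply/seteqP; split => w; (have [Nw|nN] := pselect (N w); first by right).
  by move=> [/(AA' w nN)|//]; left.
by move=> [/(AA' w nN)|//]; left.
Qed.

(** * The reflection acts only at contact *)

Section flatness.
Context {R : realType} (K : cumulative R R) (phi : R -> R).
Hypotheses (Kc : continuous K) (phic : continuous phi) (phi0 : forall t, 0 <= phi t).
Hypothesis flat : forall t, 0 <= t ->
  (\int[lebesgue_stieltjes_measure K]_(s in `[0%R, t]) (phi s)%:E = 0)%E.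

(** Near [s] the function [phi] is at least [phi s / 2], so [phi s / 2] times the increment of [K]
    is at most the integral of [phi] against [dK], which is 0. *)
Lemma flat_off_contact s : 0 <= s -> 0 < phi s ->
  exists2 d, 0 < d & forall t, s < t < s + d -> K t = K s.
Proof.
move=> s0 ps; have p2 : 0 < phi s / 2 by rewrite divr_gt0.
have [d d0 Hd] := continuous_lim_eps (@phic s) p2.
exists d => // t /andP[st td].
have mphi D : measurable_fun D (fun u => (phi u)%:E).
  by apply/measurable_EFinP; apply: measurable_funTS; exact: continuous_measurable_fun.
have t0 : 0 <= t := le_trans s0 (ltW st).
have : ((phi s / 2)%:E * (K t - K s)%:E <= 0)%E.
  rewrite -(flat t0) -(stieltjes_measure_oc K (ltW st)) -integral_cst//.
  apply: (@le_trans _ _ (\int[lebesgue_stieltjes_measure K]_(u in `]s, t]) (phi u)%:E)%E).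
    apply: ge0_le_integral => //.
    - by move=> u _; rewrite lee_fin ltW.
    - exact: mphi.
    move=> u /=; rewrite in_itv/= => /andP[su ut]; rewrite lee_fin.
    have : `|u - s| < d by rewrite gtr0_norm ?subr_gt0//; lra.
    by move=> /Hd; rewrite ltr_norml => /andP[+ _]; lra.
  apply: ge0_subset_integral => //; first exact: mphi.
    by move=> u _; rewrite lee_fin.
  move=> u /=; rewrite !in_itv/= => /andP[su ->]; rewrite andbT.
  exact: le_trans s0 (ltW su).
rewrite -EFinM lee_fin pmulr_rle0// subr_le0 => Kts.
by apply: le_anti; rewrite Kts/= cumulative_is_nondecreasing// ltW.
Qed.

End flatness.

(** * The main theorem *)

Lemma generator_continuous (R : realType) (b sigma h : R -> R) (Lip : R) : 0 <= Lip ->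
  (forall x y, `|b x - b y| <= Lip * `|x - y|) ->
  (forall x y, `|sigma x - sigma y| <= Lip * `|x - y|) ->
  twice_continuously_differentiable h -> continuous (generator b sigma h).
Proof.
move=> Lip0 b_lip sigma_lip [_ d2 h2c] x.
have h1c : continuous (derive1 h) by move=> z; exact/differentiable_continuous/derivable1_diffP.
have bc := lipschitz_continuous Lip0 b_lip; have sc := lipschitz_continuous Lip0 sigma_lip.
apply: cvgD; first by apply: cvgM; [exact: bc|exact: h1c].
apply: cvgM; last exact: h2c.
by apply: cvgM; [exact: cvg_cst|apply: cvgM; exact: sc].
Qed.

Section regular_solution.
Context d (T : measurableType d) (R : realType) (P : probability T R).
Variables (B : R -> {RV P >-> R}) (X0 : {RV P >-> R}).
Notation leb := (@lebesgue_measure R).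
Hypothesis P_complete : measure_is_complete P.
Hypothesis B_bm : brownian_motion B.
Hypothesis B_X0_indep :
  independent_systems P (sigma_of X0) (sigma_path (fun t => B t)).
Local Notation intg f := (P.-integrable setT (EFin \o f)).
Local Notation ameas := (ameas B X0).
Variables (X I : R -> T -> R) (K : cumulative R R) (b sigma : R -> R) (Lip : R).
Variable phi : nat -> simple_process (augmented_filtration P X0 (fun t => B t)).
Hypotheses (Xc : forall w, continuous (X ^~ w)) (Xm : forall u, measurable_fun setT (X u)).
Hypothesis Xa : forall u, 0 <= u -> ameas u (X u).
Hypothesis Lip0 : 0 <= Lip.
Hypothesis b_lip : forall x y, `|b x - b y| <= Lip * `|x - y|.
Hypothesis sigma_lip : forall x y, `|sigma x - sigma y| <= Lip * `|x - y|.
Hypothesis mI : forall t, 0 <= t -> measurable_fun setT (I t).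
Hypothesis phiH : forall t e : R, 0 <= t -> 0 < e ->
  P [set w | e <= tint (fun u => (sp_fun (phi n) u w - sigma (X u w)) ^+ 2) 0 t]
    @[n --> \oo] --> 0%E.
Hypothesis phiI : forall t e : R, 0 <= t -> 0 < e ->
  P [set w | e <= `|sp_integral (phi n) (fun r => B r) t w - I t w|]
    @[n --> \oo] --> 0%E.
Hypothesis X_eq : forall w t, 0 <= t ->
  X t w = X0 w + tint (fun u => b (X u w)) 0 t + I t w + K t.
Hypothesis iX0 : intg (fun w => X0 w ^+ 2).

Hypothesis Kc : continuous K.
Hypothesis X_neg : forall u, X u = X (Num.max u 0).

Variables (h : R -> R) (Ch m : R).
Hypothesis h_C2 : twice_continuously_differentiable h.
Hypothesis h1_bounded : forall x, `|derive1 h x| <= Ch.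
Hypothesis h2_bounded : forall x, `|derive1n 2 h x| <= Ch.
Hypotheses (m_gt0 : 0 < m) (h1_ge : forall x, m <= derive1 h x).

Let phi_ t := \int[P]_w h (X t w).
Let g_ t := \int[P]_w derive1 h (X t w).
Let a_ t := \int[P]_w generator b sigma h (X t w).

Hypothesis K_neg : forall t, t <= 0 -> K t = 0.
Hypothesis phi_ge0 : forall t, 0 <= t -> 0 <= phi_ t.
Hypothesis K_flat : forall t, 0 <= t ->
  (\int[lebesgue_stieltjes_measure K]_(s in `[0%R, t]) (phi_ s)%:E = 0)%E.

Let Knd : {homo K : x y / x <= y} := cumulative_is_nondecreasing K.

Let Ch0 : 0 <= Ch. Proof. exact: le_trans (h1_bounded 0). Qed.

Let iX := X_sqr_integrable P_complete B_bm B_X0_indep Xc Xm Knd Lip0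
  b_lip sigma_lip mI phiH phiI X_eq iX0 X_neg.

Let X_cvg := mean_square_cvg P_complete B_bm B_X0_indep Xc Xm Knd Lip0
  b_lip sigma_lip mI phiH phiI X_eq iX0 Kc X_neg.

Let h_continuous : continuous h.
Proof. by case: h_C2 => d1 _ _ z; exact/differentiable_continuous/derivable1_diffP. Qed.

Let h1_continuous : continuous (derive1 h).
Proof. by case: h_C2 => _ d2 _ z; exact/differentiable_continuous/derivable1_diffP. Qed.

Let h_growth : forall x, `|h x| <= (`|h 0| + Ch) * (1 + x ^+ 2).
Proof.
have [hd _ _] := h_C2.
exact: (lipschitz_norm_growth (derivative_lipschitz hd h1_bounded)).
Qed.

Let h1_growth x : `|derive1 h x| <= Ch * (1 + x ^+ 2).
Proof.
by apply: (le_trans (h1_bounded x)); rewrite ler_peMr// lerDl sqr_ge0.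
Qed.

Let gen_continuous : continuous (generator b sigma h).
Proof. exact: (generator_continuous Lip0 b_lip sigma_lip h_C2). Qed.

Let gen_growth x : `|generator b sigma h x| <=
  ((`|b 0| + Lip) * Ch + (2 * sigma 0 ^+ 2 + 2 * Lip ^+ 2) * Ch) * (1 + x ^+ 2).
Proof.
apply: (le_trans (ler_normD _ _)); rewrite mulrDl; apply: lerD.
  rewrite normrM [leRHS]mulrAC; apply: ler_pM => //; exact: lipschitz_norm_growth.
rewrite normrM [leRHS]mulrAC; apply: ler_pM => //.
rewrite normrM ger0_norm ?invr_ge0// (ger0_norm (sqr_ge0 _)).
have := lipschitz_growth Lip0 sigma_lip (lexx (2 * sigma 0 ^+ 2 + 2 * Lip ^+ 2)) x.
have := sqr_ge0 (sigma x); set u := _ * (1 + _); lra.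
Qed.

Lemma regular_integrable t : [/\ intg (fun w => h (X t w)),
  intg (fun w => derive1 h (X t w)) & intg (fun w => generator b sigma h (X t w))].
Proof.
split; first exact: (growth_integrable Xm iX h_continuous h_growth).
  exact: (growth_integrable Xm iX h1_continuous h1_growth).
exact: (growth_integrable Xm iX gen_continuous gen_growth).
Qed.

Let phi_continuous : continuous phi_.
Proof. exact: (growth_expectation_continuous Xc Xm iX X_cvg h_continuous h_growth). Qed.

Let g_continuous : continuous g_.
Proof. exact: (growth_expectation_continuous Xc Xm iX X_cvg h1_continuous h1_growth). Qed.

Let a_continuous : continuous a_.
Proof. exact: (growth_expectation_continuous Xc Xm iX X_cvg gen_continuous gen_growth). Qed.

Let g_ge t : m <= g_ t.
Proof.
have [_ ig _] := regular_integrable t.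
rewrite -(Rintegral_probability_cst P m); apply: le_Rintegral => //.
exact: finite_measure_integrable_cst.
Qed.

Let phi_nonneg t : 0 <= phi_ t.
Proof. by rewrite /phi_ X_neg; apply: phi_ge0; rewrite le_max lexx orbT. Qed.

Lemma regular_density : let k := contact_rate phi_ a_ g_ in
  [/\ lebesgue_stieltjes_measure K `<< leb, measurable_fun setT k &
   forall A : set R, measurable A -> A `<=` `[0, +oo[ ->
     lebesgue_stieltjes_measure K A = (\int[leb]_(t in A) (k t)%:E)%E].
Proof.
move=> k.
have fl := flat_off_contact phi_continuous phi_nonneg K_flat.
have ex s e : 0 <= s -> 0 < e -> exists2 d, 0 < d & forall t, s < t < s + d ->
    `|phi_ t - phi_ s - a_ s * (t - s) - g_ s * (K t - K s)|
    <= e * (t - s + (K t - K s)).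
  move=> s0 e0; have [r r0 Hr] := local_expansion P_complete B_bm B_X0_indep Xc Xm Xa Knd
    Lip0 b_lip sigma_lip mI phiH phiI X_eq iX0 Kc X_neg h_C2 h1_bounded h2_bounded s0 e0.
  by exists r => // t /andP[st tr]; exact: Hr.
have KE s t : 0 <= s -> s <= t -> K t - K s = tint k s t.
  exact: (contact_densityE Knd Kc phi_continuous a_continuous g_continuous m_gt0 g_ge
    phi_nonneg fl ex).
have mk : measurable_fun setT k.
  exact: (measurable_contact_rate phi_continuous a_continuous g_continuous m_gt0 g_ge).
have ki := contact_rate_integrable phi_continuous a_continuous g_continuous m_gt0 g_ge.
have k0 t : 0 <= k t.
  rewrite mulr_ge0// divr_ge0//; first by rewrite /negpart le_max lexx orbT.
  exact: le_trans (ltW m_gt0) (g_ge t).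
split => //; first exact: (stieltjes_dominates K_neg k0 mk ki KE).
by move=> A; exact: (stieltjes_densityE K_neg k0 mk ki KE).
Qed.

End regular_solution.

Lemma eq_cvg_seq (R : realType) (u v : nat -> \bar R) (l : \bar R) :
  (forall n, u n = v n) -> u n @[n --> \oo] --> l -> v n @[n --> \oo] --> l.
Proof. by move=> /funext ->. Qed.

(** * A modification whose paths are all continuous *)

Section regular_version.
Context d (T : measurableType d) (R : realType) (P : probability T R).
Variables (B : R -> {RV P >-> R}) (X0 : {RV P >-> R}).
Hypothesis P_complete : measure_is_complete P.
Local Notation ameas := (ameas B X0).
Variables (X : R -> T -> R) (N : set T).
Hypotheses (mN : measurable N) (PN : P N = 0%E).
Hypothesis X_cont : forall w, ~ N w -> {within `[(0 : R), +oo[, continuous (X ^~ w)}.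
Hypothesis X_ameas : forall t, 0 <= t -> ameas t (X t).

(* Freezing at negative times makes expectations continuous on the whole line. *)
Definition regular_version (u : R) (w : T) : R :=
  if w \in N then 0 else X (Num.max u 0) w.

Local Notation Xr := regular_version.

Lemma regular_versionE u w : ~ N w -> 0 <= u -> Xr u w = X u w.
Proof. by move=> nN u0; rewrite /regular_version memNset// max_l. Qed.

Lemma regular_version_max u : Xr u = Xr (Num.max u 0).
Proof.
apply/funext => w; rewrite /regular_version [in RHS]max_l//.
by rewrite le_max lexx orbT.
Qed.

Lemma regular_version_continuous w : continuous (Xr ^~ w).
Proof.
have [Nw|nN] := pselect (N w).
  rewrite (_ : Xr ^~ w = cst 0); first exact: cst_continuous.
  by apply/funext => u; rewrite /regular_version mem_set.
rewrite (_ : Xr ^~ w = fun u => X (Num.max u 0) w).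
  exact: (continuous_max0 (X_cont nN)).
by apply/funext => u; rewrite /regular_version memNset.
Qed.

Lemma regular_version_ae t : 0 <= t -> {ae P, forall w, X t w = Xr t w}.
Proof.
move=> t0; exists N; split => // w /= XXr; apply: contrapT => nN.
by apply: XXr; rewrite regular_versionE.
Qed.

Lemma regular_version_ameas t : 0 <= t -> ameas t (Xr t).
Proof. by move=> t0; exact: ameas_ae (X_ameas t0) (regular_version_ae t0). Qed.

Lemma measurable_regular_version u : measurable_fun setT (Xr u).
Proof.
rewrite regular_version_max; apply: (ameas_measurable P_complete).
by apply: regular_version_ameas; rewrite le_max lexx orbT.
Qed.

Lemma regular_version_expectation (F : R -> R) t : 0 <= t -> continuous F ->
  P.-integrable setT (EFin \o (fun w => F (Xr t w))) ->
  ('E_P[F \o X t])%E = (\int[P]_w F (Xr t w))%:E.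
Proof.
move=> t0 Fc iF.
have mF : measurable_fun setT F by exact: continuous_measurable_fun.
rewrite unlock /Rintegral fineK; last exact: integrable_fin_num iF.
apply: ae_eq_integral => //.
- apply/measurable_EFinP; apply: measurableT_comp => //.
  exact: (ameas_measurable P_complete (X_ameas t0)).
- exact: measurable_int iF.
by have := regular_version_ae t0; apply: filterS => w /= -> _.
Qed.

End regular_version.

Theorem proposition2p6 (d : measure_display) (T : measurableType d)
    (R : realType) (P : probability T R)
    (B : R -> {RV P >-> R}) (X0 : {RV P >-> R})
    (b sigma h : R -> R) (m M : R)
    (X : R -> T -> R) (K : cumulative R R)
    (P_complete : measure_is_complete P)
    (B_bm : brownian_motion B)
    (B_X0_indep :
       independent_systems P (sigma_of X0) (sigma_path (fun t => B t)))
    (b_lip : [lipschitz b x | x in [set: R]])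
    (sigma_lip : [lipschitz sigma x | x in [set: R]])
    (X0_sqint : (X0 : T -> R) \in Lfun P 2%:E)
    (h_incr : {homo h : x y / x <= y})
    (h_C2 : twice_continuously_differentiable h)
    (h_bounded : exists C : R, forall x : R,
       `|derive1 h x| <= C /\ `|derive1n 2 h x| <= C)
    (m_gt0 : 0 < m) (m_le_M : m <= M)
    (h_bilip : forall x y : R,
       m * `|x - y| <= `|h x - h y| /\ `|h x - h y| <= M * `|x - y|)
    (h_X0 : (0 <= 'E_P[h \o X0])%E)
    (XK_sol : flat_deterministic_solution P b sigma h X0 (fun t => B t) X K) :
  [/\ lebesgue_stieltjes_measure K `<< (@lebesgue_measure R),
      measurable_fun (`[0, +oo[ : set R) (reflection_density P b sigma h X) &
      forall A : set R, measurable A -> A `<=` `[0, +oo[ ->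
        lebesgue_stieltjes_measure K A
        = (\int[lebesgue_measure]_(t in A)
             (reflection_density P b sigma h X t)%:E)%E ].
Proof.
have [Lb Lb0 b_lip'] := lipschitz_constant b_lip.
have [Ls Ls0 sigma_lip'] := lipschitz_constant sigma_lip.
pose Lip := Num.max Lb Ls.
have Lip0 : 0 <= Lip by rewrite le_max Lb0.
have bL x y : `|b x - b y| <= Lip * `|x - y|.
  by apply: (le_trans (b_lip' x y)); rewrite ler_wpM2r// le_max lexx.
have sL x y : `|sigma x - sigma y| <= Lip * `|x - y|.
  by apply: (le_trans (sigma_lip' x y)); rewrite ler_wpM2r// le_max lexx orbT.
have [Ch hC] := h_bounded.
have h1C x : `|derive1 h x| <= Ch by have [] := hC x.
have h2C x : `|derive1n 2 h x| <= Ch by have [] := hC x.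
have [hd h1d _] := h_C2.
have h1m := increasing_bilip_derive1 h_incr hd (fun x y => (h_bilip x y).1).
have [Xad Xcont Kc K_neg [I [[Iad Icont [phi Hphi]] Xeq]] Xcons Xflat] := XK_sol.
(* One null set serves both the continuity of the paths and the equation. *)
have [N [mN PN QN]] : {ae P, forall w, {within `[(0 : R), +oo[, continuous (X ^~ w)} /\
    forall t : R, 0 <= t -> X t w = X0 w + \int[lebesgue_measure]_(s in `[0, t]) b (X s w)
              + I t w + K t}.
  by move: Xcont Xeq; apply: filterS2 => w.
have good w : ~ N w -> {within `[(0 : R), +oo[, continuous (X ^~ w)} /\
    forall t : R, 0 <= t -> X t w = X0 w + \int[lebesgue_measure]_(s in `[0, t]) b (X s w)
              + I t w + K t.
  by move=> nN; apply: contrapT => H; apply: nN; exact: QN.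
pose Xr := regular_version X N.
have Xrc := regular_version_continuous (fun w nN => (good w nN).1).
have Xrm := measurable_regular_version P_complete mN PN Xad.
have Xra := regular_version_ameas mN PN Xad.
have XrE := @regular_versionE _ _ _ X N.
(* The integral is redefined from the equation, which then holds for every [w]; outside [N] it is
   still [I]. *)
pose Ir t w := Xr t w - X0 w - tint (fun u => b (Xr u w)) 0 t - K t.
have Xr_eq w t : 0 <= t -> Xr t w = X0 w + tint (fun u => b (Xr u w)) 0 t + Ir t w + K t.
  by move=> _; rewrite /Ir; ring.
have IrE t w : ~ N w -> 0 <= t -> Ir t w = I t w.
  move=> nN t0; rewrite /Ir /Xr XrE// (good w nN).2//.
  rewrite (_ : tint _ 0 t = \int[lebesgue_measure]_(s in `[0, t]) b (X s w)); first by ring.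
  by apply: eq_Rintegral => u; rewrite inE/= in_itv/= => /andP[u0 _]; rewrite XrE.
have mIr t : 0 <= t -> measurable_fun setT (Ir t).
  move=> t0; apply: measurable_funB => //; apply: measurable_funB.
    by apply: measurable_funB => //; exact: Xrm.
  apply: (@measurable_tint _ _ _ (fun u w => b (Xr u w))).
  exact: (drift_joint Xrc Xrm Lip0 bL).
have sj := diffusion_joint Xrc Xrm Lip0 sL.
have sc := diffusion_continuous Xrc Lip0 sL.
have phiH t e : 0 <= t -> 0 < e ->
    P [set w | e <= tint (fun u => (sp_fun (phi n) u w - sigma (Xr u w)) ^+ 2) 0 t]
      @[n --> \oo] --> 0%E.
  move=> t0 e0; have [H _] := Hphi t t0.
  (* The event for [X] differs from the one for [Xr] only inside [N], so both have the same
     probability although the former is not known to be measurable. *)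
  apply: eq_cvg_seq (H e e0) => n; apply: (measure_eq_off_null P_complete mN PN).
    apply: measurable_set_ge.
    apply: (@measurable_tint _ _ _ (fun u w => (sp_fun (phi n) u w - sigma (Xr u w)) ^+ 2)).
    by apply: measurable_funX; apply: measurable_funB; [exact: sp_fun_joint|exact: sj].
  move=> w nN /=.
  have i1 := sp_diff_integrable P_complete phi sj sc 0 t w n.
  rewrite -lee_fin /tint /Rintegral fineK; last exact: (integrable_fin_num _ i1).
  suff -> : (\int[lebesgue_measure]_(s in `[0%R, t]) ((sp_fun (phi n) s w - sigma (X s w)) ^+ 2)%:E
    = \int[lebesgue_measure]_(s in `[0%R, t]) ((sp_fun (phi n) s w - sigma (Xr s w)) ^+ 2)%:E)%E by [].
  by apply: eq_integral => u; rewrite inE/= in_itv/= => /andP[u0 _]; rewrite /Xr XrE.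
have phiI t e : 0 <= t -> 0 < e ->
    P [set w | e <= `|sp_integral (phi n) (fun r => B r) t w - Ir t w|]
      @[n --> \oo] --> 0%E.
  move=> t0 e0; have [_ H] := Hphi t t0.
  apply: eq_cvg_seq (H e e0) => n; apply: (measure_eq_off_null P_complete mN PN).
    apply: measurable_set_ge; apply: measurableT_comp => //.
    by apply: measurable_funB; [exact: sp_integral_measurable|exact: mIr].
  by move=> w nN /=; rewrite lee_fin IrE.
have iX0 := Lfun2_integrable_sqr X0_sqint.
have hi := regular_integrable P_complete B_bm B_X0_indep Xrc Xrm Lip0 bL sL mIr phiH phiI
  Xr_eq iX0 (regular_version_max X N) h_C2 h1C h2C.
have c0 : continuous h by move=> z; exact/differentiable_continuous/derivable1_diffP.
have c1 : continuous (derive1 h) by move=> z; exact/differentiable_continuous/derivable1_diffP.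
have cg : continuous (generator b sigma h) by exact: (generator_continuous Lip0 bL sL h_C2).
have Eh t : 0 <= t -> ('E_P[h \o X t])%E = (\int[P]_w h (Xr t w))%:E.
  move=> t0; apply: (regular_version_expectation P_complete mN PN Xad) => //.
  by have [] := hi t.
have phi_ge0 t : 0 <= t -> 0 <= \int[P]_w h (Xr t w).
  by move=> t0; have := Xcons t t0; rewrite Eh.
have K_flat t : 0 <= t -> (\int[lebesgue_stieltjes_measure K]_(s in `[0%R, t])
    (\int[P]_w h (Xr s w))%:E = 0)%E.
  move=> t0; rewrite -(Xflat t t0); apply: eq_integral => s.
  by rewrite inE/= in_itv/= => /andP[s0 _]; rewrite Eh.
have [dom mk HA] := regular_density P_complete B_bm B_X0_indep Xrc Xrm Xra Lip0 bL sL
  mIr phiH phiI Xr_eq iX0 Kc (regular_version_max X N) h_C2 h1C h2C m_gt0 h1m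
  K_neg phi_ge0 K_flat.
(* Restricted to nonnegative times: before 0 the process [Xr] is frozen, while [X] is arbitrary. *)
have kE t : 0 <= t -> reflection_density P b sigma h X t =
    contact_rate (fun t => \int[P]_w h (Xr t w))
      (fun t => \int[P]_w generator b sigma h (Xr t w))
      (fun t => \int[P]_w derive1 h (Xr t w)) t.
  move=> t0; have [_ i1 i2] := hi t; rewrite /reflection_density /contact_rate Eh// eqe.
  by rewrite !(regular_version_expectation P_complete mN PN Xad).
split => //.
- apply: eq_measurable_fun (measurable_funTS mk) => t.
  by rewrite inE/= in_itv/= andbT => t0; rewrite kE.
move=> A mA A0; rewrite HA//; apply: eq_integral => t; rewrite inE => /A0/=.
by rewrite in_itv/= andbT => t0; rewrite kE.
Qed.
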